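(* Let the parameters $p,q,r,\tilde r,\rho$ satisfy one of the following: (A) $1<p\le q<\infty$, $1<r,\tilde r<\infty$, $\rho=\infty$; (B) $1<q<p<\infty$, $1<r,\tilde r<\infty$, $0<\rho<\infty$ and $\frac1q=\frac1p+\frac1\rho$; (C) $0<q\le1<p<\infty$, $1<r<\infty$, $\tilde r=1$, $0<\rho<\infty$ and $\frac1q=\frac1p+\frac1\rho$. Then there is a constant $C>0$, depending only on $n,p,q,r,\tilde r,\rho$, such that for every $(w,v)\in\mathcal{A}^{r,\tilde r,{\rm loc}}_{p,q,\rho}(\mathbb{R}^n)$ and every $f\in Lip_{\rm c}(\mathbb{R}^n)$, $$\|v\cdot f\|_{L^q(\mathbb{R}^n)}\le C\,[w,v]_{\mathcal{A}^{r,\tilde r,{\rm loc}}_{p,q,\rho}(\mathbb{R}^n)}\left(\bigl\|w|\nabla f|\bigr\|_{L^p(\mathbb{R}^n)}+\|w\cdot f\|_{L^p(\mathbb{R}^n)}\right).$$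
   Context: $\mathcal{D}(\mathbb{R}^n)$ is the family of dyadic cubes $2^{-j}(m+[0,1)^n)$, $j\in\mathbb{Z}$, $m\in\mathbb{Z}^n$; $\ell_Q$ is the side length of $Q$. $Lip_{\rm c}(\mathbb{R}^n)$ is the family of all compactly supported Lipschitz functions on $\mathbb{R}^n$. A weight on $\mathbb{R}^n$ is a function $w\in L^1_{\rm loc}(\mathbb{R}^n)$ with $w(x)>0$ and $w(x)^{-1}>0$ for a.e. $x$. $p'=p/(p-1)$. For $1<p<\infty$, $0<q<\infty$, $1\le r,\tilde r<\infty$, $0<\rho\le\infty$, $\mathcal{A}^{r,\tilde r,{\rm loc}}_{p,q,\rho}(\mathbb{R}^n)$ is the family of all pairs $(w,v)$ of weights on $\mathbb{R}^n$ with $$[w,v]_{\mathcal{A}^{r,\tilde r,{\rm loc}}_{p,q,\rho}(\mathbb{R}^n)}:=\left(\sum_{Q\in\mathcal{D}(\mathbb{R}^n),\ |Q|\le1}\left[\frac{\ell_Q}{|Q|^{\frac1p-\frac1q}}\left(\frac1{|Q|}\int_Q w(x)^{-p'r}\,dx\right)^{\frac1{p'r}}\left(\frac1{|Q|}\int_Q v(x)^{q\tilde r}\,dx\right)^{\frac1{q\tilde r}}\right]^\rho\right)^{\frac1\rho}<\infty,$$ with the $\ell^\rho$-sum replaced by the supremum over $Q\in\mathcal{D}(\mathbb{R}^n)$, $|Q|\le1$, when $\rho=\infty$. *)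

(* Defs.v *)
From HB Require Import structures.
From mathcomp Require Import all_boot all_order all_algebra.
From mathcomp Require Import all_classical all_reals all_analysis.

Set Implicit Arguments.
Unset Strict Implicit.
Unset Printing Implicit Defensive.

Import Order.TTheory GRing.Theory Num.Theory.
Import numFieldNormedType.Exports.

Local Open Scope classical_set_scope.
Local Open Scope ring_scope.

Definition measure_rV_display : measure_display -> measure_display.
Proof. exact. Qed.

Section borel_rV.
Context {R : realType} (n : nat).

Definition rV_coord (i : 'I_n) (x : 'rV[R]_n) : measurableTypeR R := x ord0 i.

Let rV_set0 : g_sigma_preimage rV_coord set0.
Proof. exact: sigma_algebra0. Qed.

Let rV_setC A : g_sigma_preimage rV_coord A -> g_sigma_preimage rV_coord (~` A).
Proof. exact: sigma_algebraC. Qed.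

Let rV_bigcup (F : _^nat) : (forall i, g_sigma_preimage rV_coord (F i)) ->
  g_sigma_preimage rV_coord (\bigcup_i (F i)).
Proof. exact: sigma_algebra_bigcup. Qed.

HB.instance Definition _ := @isMeasurable.Build
  (measure_rV_display default_measure_display)
  'rV[R]_n (g_sigma_preimage rV_coord) rV_set0 rV_setC rV_bigcup.

Lemma measurable_rV_coord (i : 'I_n) : measurable_fun [set: 'rV[R]_n] (rV_coord i).
Proof.
move=> _ Y mY; rewrite setTI; apply: sub_sigma_algebra => /=.
rewrite -bigcup_seq/=; exists i => /=; first by rewrite mem_index_enum.
by exists Y => //; rewrite setTI.
Qed.

Lemma measurable_fun_rV d (T : measurableType d) (f : T -> 'rV[R]_n) :
  (forall i, measurable_fun [set: T] (rV_coord i \o f)) ->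
  measurable_fun [set: T] f.
Proof.
move=> mf _ A mA.
have E := @g_sigma_preimage_comp _ _ n _ (fun i => rV_coord i) _ f.
have : preimage_set_system [set: T] f (g_sigma_preimage rV_coord)
    (setT `&` f @^-1` A) by exists A.
rewrite -E; apply: smallest_sub; first exact: sigma_algebra_measurable.
rewrite -bigcup_seq; apply: bigcup_sub => i _ B [C mC <-].
exact: mf.
Qed.

End borel_rV.

Section cons_rV.
Context {R : realType} (n : nat).

Definition cons_rV (x : measurableTypeR R * 'rV[R]_n) : 'rV[R]_n.+1 :=
  \row_i (if unlift ord0 i is Some j then x.2 ord0 j else x.1).

Definition uncons_rV (x : 'rV[R]_n.+1) : measurableTypeR R * 'rV[R]_n :=
  (rV_coord ord0 x, \row_j x ord0 (lift ord0 j)).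

Lemma cons_rVK : cancel cons_rV uncons_rV.
Proof.
case=> a b; rewrite /uncons_rV /rV_coord /cons_rV; congr pair.
  by rewrite mxE unlift_none.
by apply/rowP => j; rewrite !mxE liftK.
Qed.

Lemma uncons_rVK : cancel uncons_rV cons_rV.
Proof.
move=> x; apply/rowP => i; rewrite mxE.
by case: unliftP => [j|] -> //=; rewrite mxE.
Qed.

Lemma measurable_cons_rV : measurable_fun setT cons_rV.
Proof.
apply: measurable_fun_rV => i.
case: (unliftP ord0 i) => [j|] ->.
- rewrite (_ : _ \o _ = rV_coord j \o snd).
    by apply: measurableT_comp => //; exact: measurable_rV_coord.
  by apply/funext => x /=; rewrite /rV_coord mxE liftK.
- rewrite (_ : _ \o _ = fst) //.
  by apply/funext => x /=; rewrite /rV_coord mxE unlift_none.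
Qed.

Lemma measurable_uncons_rV : measurable_fun setT uncons_rV.
Proof.
apply/measurable_fun_pairP; split; first exact: measurable_rV_coord.
apply: measurable_fun_rV => j.
rewrite (_ : _ \o _ = rV_coord (lift ord0 j)); first exact: measurable_rV_coord.
by apply/funext => x /=; rewrite /rV_coord mxE.
Qed.

End cons_rV.

Section lebesgue_rV.
Local Open Scope ereal_scope.
Context {R : realType}.

Section step.
Context (n : nat) (m : {sigma_finite_measure set 'rV[R]_n -> \bar R}).

Definition lebesgue_rV_step : set 'rV[R]_n.+1 -> \bar R :=
  pushforward (@lebesgue_measure R \x m) (@cons_rV R n).

Let mcons : measurable_fun setT (@cons_rV R n) := @measurable_cons_rV R n.

Let step0 : lebesgue_rV_step set0 = 0.
Proof. exact: measure0. Qed.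

Let step_ge0 A : 0 <= lebesgue_rV_step A.
Proof. exact: measure_ge0. Qed.

Let step_sigma_additive : semi_sigma_additive lebesgue_rV_step.
Proof. exact: measure_semi_sigma_additive. Qed.

HB.instance Definition _ := isMeasure.Build _ _ _ lebesgue_rV_step
  step0 step_ge0 step_sigma_additive.

Let step_sigma_finite : sigma_finite setT lebesgue_rV_step.
Proof.
have /sigma_finiteP[F [UF ndF mF]] := sigma_finiteT (@lebesgue_measure R).
have /sigma_finiteP[G [UG ndG mG]] := sigma_finiteT m.
exists (fun k => @uncons_rV R n @^-1` (F k `*` G k)).
  rewrite -preimage_bigcup -[LHS](preimage_setT (@uncons_rV R n)).
  congr (_ @^-1` _); rewrite -setXTT UF UG predeqE => -[x y]; split.
    move=> [/= [i _ Fx] [j _ Gy]]; exists (maxn i j) => //; split.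
    - by move: x Fx; exact/subsetPset/ndF/leq_maxl.
    - by move: y Gy; exact/subsetPset/ndG/leq_maxr.
  by move=> [k _ []/= ? ?]; split; exists k.
move=> k; have [mFk Fkoo] := mF k; have [mGk Gkoo] := mG k; split.
  rewrite -[X in measurable X]setTI; apply: measurable_uncons_rV => //.
  exact: measurableX.
rewrite /lebesgue_rV_step /pushforward -comp_preimage.
rewrite (_ : _ \o _ = id) ?preimage_id; last first.
  by apply/funext => x /=; rewrite cons_rVK.
by rewrite product_measure1E// lte_mul_pinfty// ge0_fin_numE.
Qed.

HB.instance Definition _ := Measure_isSigmaFinite.Build _ _ _ lebesgue_rV_step
  step_sigma_finite.

End step.

Fixpoint borel_lebesgue_rV n : {sigma_finite_measure set 'rV[R]_n -> \bar R} :=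
  if n is n'.+1 then lebesgue_rV_step (borel_lebesgue_rV n')
  else \d_(0%R : 'rV[R]_0).

Definition box_rV n (A : 'I_n -> set R) : set 'rV[R]_n :=
  [set x | forall i, A i (x ord0 i)].

Lemma box_rV_cons n (A : 'I_n.+1 -> set R) :
  box_rV A = @uncons_rV R n @^-1` (A ord0 `*` box_rV (fun i => A (lift ord0 i))).
Proof.
apply/seteqP; split => x /=.
  by move=> Ax; split => [|i]; rewrite ?mxE; exact: Ax.
move=> [A0 A1] i; case: (unliftP ord0 i) => [j|] -> //.
by have := A1 j; rewrite mxE.
Qed.

Lemma measurable_box_rV n (A : 'I_n -> set (measurableTypeR R)) :
  (forall i, measurable (A i)) -> measurable (box_rV A).
Proof.
elim: n A => [|n IH] A mA.
  by rewrite (_ : box_rV A = setT) //; apply/seteqP; split => // x _ [].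
rewrite box_rV_cons -[X in measurable X]setTI.
apply: measurable_uncons_rV => //; apply: measurableX => //.
exact: (IH (fun i => A (lift ord0 i))).
Qed.

Lemma borel_lebesgue_rV_box n (A : 'I_n -> set (measurableTypeR R)) :
  (forall i, measurable (A i)) ->
  borel_lebesgue_rV n (box_rV A) = \prod_(i < n) lebesgue_measure (A i).
Proof.
elim: n A => [|n IH] A mA.
  by rewrite big_ord0 /= diracE mem_set // => -[].
rewrite big_ord_recl -(IH (fun i => A (lift ord0 i))) // box_rV_cons /=.
rewrite /lebesgue_rV_step /pushforward -comp_preimage.
rewrite (_ : _ \o _ = id) ?preimage_id; last first.
  by apply/funext => x /=; rewrite cons_rVK.
apply: product_measure1E => //.
exact: (measurable_box_rV (A := fun i => A (lift ord0 i))).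
Qed.

(* R^n with the Lebesgue sigma-algebra: the completion of the Borel one. *)
Definition lebesgue_rV_type n : measurableType _ :=
  caratheodory_type ((borel_lebesgue_rV n)^*)%mu.

Definition lebesgue_rV n : {measure set (lebesgue_rV_type n) -> \bar R} :=
  @completed_measure_extension _ _ _ (borel_lebesgue_rV n).

End lebesgue_rV.
Arguments borel_lebesgue_rV : clear implicits.
Arguments lebesgue_rV_type : clear implicits.
Arguments lebesgue_rV : clear implicits.

Section weights.
Context {R : realType} (n : nat).
Local Notation mu := (lebesgue_rV R n).

Definition locally_integrable_rV (w : 'rV[R]_n -> R) : Prop :=
  measurable_fun [set: lebesgue_rV_type R n] w /\
  forall K : set 'rV[R]_n, compact K -> (\int[mu]_(x in K) `|w x|%:E < +oo)%E.

Definition weight (w : 'rV[R]_n -> R) : Prop :=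
  locally_integrable_rV w /\ {ae mu, forall x, 0 < w x /\ 0 < (w x)^-1}.

End weights.

(* The pair (j, m) stands for the cube 2^-j (m + [0,1)^n); for n > 0 distinct
   pairs give distinct cubes, so sums over dyadic cubes are sums over pairs. *)
Section dyadic.
Context {R : realType} (n : nat).
Implicit Types Q : int * 'rV[int]_n.

Definition dyadic_side Q : R := 2 ^ (- Q.1).

Definition dyadic_cube Q : set 'rV[R]_n :=
  [set x | forall i, dyadic_side Q * (Q.2 ord0 i)%:~R <= x ord0 i <
                     dyadic_side Q * (Q.2 ord0 i + 1)%:~R].

Definition dyadic_volume Q : R := fine (lebesgue_rV R n (dyadic_cube Q)).

Definition dyadic_average Q (g : 'rV[R]_n -> R) : \bar R :=
  ((dyadic_volume Q)^-1%:E * \int[lebesgue_rV R n]_(x in dyadic_cube Q) (g x)%:E)%E.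

Definition small_dyadic : set (int * 'rV[int]_n) :=
  [set Q | dyadic_volume Q <= 1].

End dyadic.

Definition conjugate_exponent {R : realType} (p : R) : R := p / (p - 1).

Section two_weight_class.
Context {R : realType} (n : nat).
Local Notation mu := (lebesgue_rV R n).
Implicit Types (p q r rt : R) (rho : \bar R) (w v : 'rV[R]_n -> R).

Definition Aloc_term p q r rt w v (Q : int * 'rV[int]_n) : \bar R :=
  let p' := conjugate_exponent p in
  ((dyadic_side Q / dyadic_volume Q `^ (p^-1 - q^-1))%:E
   * dyadic_average Q (fun x => w x `^ (- (p' * r)))%R `^ (p' * r)^-1
   * dyadic_average Q (fun x => v x `^ (q * rt))%R `^ (q * rt)^-1)%E.

(* Only 0 < rho <= +oo is meaningful. *)
Definition Aloc_const p q r rt rho w v : \bar R :=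
  match rho with
  | s%:E => ((\esum_(Q in @small_dyadic R n)
                Aloc_term p q r rt w v Q `^ s) `^ s^-1)%E
  | _ => ereal_sup (Aloc_term p q r rt w v @` @small_dyadic R n)
  end.

Definition Aloc p q r rt rho w v : Prop :=
  [/\ weight w, weight v & (Aloc_const p q r rt rho w v < +oo)%E].

End two_weight_class.

Section lipschitz_functions.
Context {R : realType} (n : nat).
Implicit Types f : 'rV[R]_n -> R.

(* The library norm on 'rV[R]_n is the sup norm; being equivalent to the
   Euclidean norm, it gives the same Lipschitz functions. *)
Definition Lip_c f : Prop :=
  (exists k : R, k.-lipschitz f) /\ compact (closure [set x | f x != 0]).

(* Euclidean norm of the gradient. A Lipschitz function is differentiable
   almost everywhere; elsewhere the value is irrelevant. *)
Definition grad_norm f (x : 'rV[R]_n) : R :=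
  Num.sqrt (\sum_(i < n) ('D_(delta_mx ord0 i) f x) ^+ 2).

Definition Lnorm_rV (p : R) (g : 'rV[R]_n -> R) : \bar R :=
  'N[lebesgue_rV R n]_p%:E[EFin \o g]%E.

End lipschitz_functions.

(* Main.v *)
Require Import Defs.
From HB Require Import structures.
From mathcomp Require Import all_boot all_order all_algebra.
From mathcomp Require Import all_classical all_reals all_analysis.
From mathcomp Require Import measurable_realfun zify ring lra.

(** The inequality is proved by dyadic stopping cubes: the function is dominated
by a sum of averages over dyadic cubes, the cubes are thinned out to a sparse
family, and the exponents [r] and [rt] leave room for a strict gain in Hoelder's
inequality, which the sparse family turns into a summable estimate.

Pointwise domination. Put g = |grad f| + |f|, l_S for the side of a cube S,
|S| for its volume and <g>_S for the average of g over it. On every line a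
Lipschitz function is the integral of its derivative ([lipschitz_FTC]), so
f(x + t e) - f(x) is controlled by an integral of |D_e f|; hence the averages of
f over a dyadic cube S and over one of its children differ by at most
C l_S <g>_S ([child_average_oscillation]). Telescoping down to depth N, starting
from the unit cube around x, gives
  |f(x)| <= C sum_S l_S <g>_S 1_S(x) + O(2^-N)
([pointwise_tree_bound]). The average of f over the unit cube is the reason for
the term |f| in g. Now select the cubes whose average of g is more than twice
that of the last selected ancestor. Sides halve from one generation to the next,
so the cubes skipped in between form a geometric series, and the sum over all
cubes is at most four times the sum over the selected ones
([tree_le_stopping]). The selected cubes S obey the Carleson embedding
  sum_S |S| <h>_S^t <= C_t int h^t    for t > 1
([carleson_embedding]).

Weights. Let s be the conjugate exponent of p' r; since r > 1, s < p. By
Hoelder, <g>_S <= <w^(-p' r)>_S^(1/(p' r)) <(w g)^s>_S^(1/s), so that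
  l_S <g>_S |S|^(1/q) <v^(q rt)>_S^(1/(q rt)) <= a_S b_S,
where a_S is the term of S in the two-weight constant and
b_S = |S|^(1/p) <(w g)^s>_S^(1/s) ([coeff_product_ge]). The Carleson embedding
with t = p/s bounds the sum of the b_S^p by a multiple of the integral of
(w g)^p ([sum_energy_coeff_le]), and discrete Hoelder, with the exponent [rho]
for the a_S, bounds the sum of the (a_S b_S)^q in all three ranges of the
parameters ([sum_Aloc_product_le]).

From the coefficients to the norm. Let Phi be the sum of l_S <g>_S 1_S over the
selected cubes. For q <= 1 the power q is subadditive, and the integral of
(v Phi)^q is at most the sum of the (a_S b_S)^q ([weighted_bound_le1]). For
q > 1 write (v Phi)^q = v Phi psi with psi = (v Phi)^(q-1), apply Hoelder to
v psi on every cube with exponents q rt and u = (q rt)', and the Carleson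
embedding to psi^u with t = q'/u, which exceeds 1 because rt > 1; this bounds
the integral by a multiple of its power 1/q' ([weighted_bound_gt1]).
Letting N grow removes the error term ([approximation_limit]). *)

Set Implicit Arguments.
Unset Strict Implicit.
Unset Printing Implicit Defensive.

Import Order.TTheory GRing.Theory Num.Theory.
Import numFieldNormedType.Exports.

Local Open Scope classical_set_scope.
Local Open Scope ring_scope.

(** * Elementary inequalities *)

Section powers.
Context (R : realType).
Implicit Types (x y a b e t : R).

Lemma powRVK x a : 0 <= x -> a != 0 -> (x `^ a) `^ a^-1 = x.
Proof. by move=> x0 a0; rewrite -powRrM mulfV// powRr1. Qed.

Lemma powRKV x a : 0 <= x -> a != 0 -> (x `^ a^-1) `^ a = x.
Proof. by move=> x0 a0; rewrite -powRrM mulVf// powRr1. Qed.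

Lemma powR_divE t x y : 0 <= x -> 0 < y -> x `^ t / y `^ t = (x / y) `^ t.
Proof.
move=> x0 y0; rewrite powRM ?invr_ge0 ?(ltW y0)//.
by rewrite -[y^-1]powR_inv1 ?(ltW y0)// -powRrM mulN1r powRN.
Qed.

(** Convexity: the graph of u^t lies above its tangent at [c]. This is Young's
inequality for [u] and c^(t-1). *)
Lemma tangent_powR t (c u : R) : 1 < t -> 0 <= c -> 0 <= u ->
  t * c `^ (t - 1) * u - (t - 1) * c `^ t <= u `^ t.
Proof.
move=> t1 c0 u0.
have t0 : 0 < t by lra.
have tn0 : t != 0 by rewrite gt_eqF.
have t1n0 : t - 1 != 0 by rewrite gt_eqF ?subr_gt0.
have t1p : 0 < t - 1 by rewrite subr_gt0.
have := @conjugate_powR R u (c `^ (t - 1)) t (t / (t - 1)) u0 (powR_ge0 _ _) t0.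
rewrite -powRrM mulrCA divff// mulr1.
move=> /(_ (divr_gt0 t0 t1p)).
have -> : t^-1 + (t / (t - 1))^-1 = 1 by rewrite invf_div; field.
move=> /(_ erefl); rewrite invf_div -(ler_pM2l t0) => H.
have -> : t * c `^ (t - 1) * u = t * (u * c `^ (t - 1)) by ring.
rewrite lerBlDr; apply: le_trans H _.
rewrite mulrDr mulrCA divff// mulr1 lerD2l.
by rewrite mulrCA [t * _]mulrCA divff// mulr1 mulrC.
Qed.

(** Young's inequality for x^q and y^q, with the conjugate exponents s/q and p/q. *)
Lemma young_product (q p s x y : R) :
  0 < q -> 0 < p -> 0 < s -> q^-1 = p^-1 + s^-1 -> 0 <= x -> 0 <= y ->
  (x * y) `^ q <= q / s * x `^ s + q / p * y `^ p.
Proof.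
move=> q0 p0 s0 qps x0 y0.
rewrite powRM//.
have H := conjugate_powR (powR_ge0 x q) (powR_ge0 y q)
  (divr_gt0 s0 q0) (divr_gt0 p0 q0).
rewrite !invf_div -!powRrM in H.
apply: le_trans (H _) _.
  by rewrite -mulrDr addrC -qps mulfV// gt_eqF.
rewrite ![x `^ _ * _]mulrC ![y `^ _ * _]mulrC.
by rewrite ![q * (_ / q)]mulrC !divfK ?gt_eqF.
Qed.

Lemma powR_le_add1 x (sigma tau : R) : 0 <= x -> 0 < sigma -> sigma <= tau ->
  x `^ sigma <= 1 + x `^ tau.
Proof.
move=> x0 s0 st; have [x1|x1] := leP 1 x.
  by apply: (@le_trans _ _ (x `^ tau)); [exact: ler_powR|rewrite lerDr].
apply: (@le_trans _ _ 1); last by rewrite lerDl powR_ge0.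
rewrite -[leRHS](powRr0 1); have -> : (1 : R) `^ 0 = 1 `^ sigma by rewrite powR1.
by apply: ge0_ler_powR; rewrite ?nnegrE ?(ltW s0) ?(ltW x1).
Qed.

Lemma powRD_le_double x y e : 0 < e -> 0 <= x -> 0 <= y ->
  (x + y) `^ e <= 2 `^ e * (x `^ e + y `^ e).
Proof.
move=> e0; wlog xy : x y / x <= y.
  move=> H x0 y0; case: (leP x y) => [xy|/ltW yx]; first exact: H.
  by rewrite addrC [X in _ * X]addrC; exact: H.
move=> x0 y0; apply: (@le_trans _ _ ((2 * y) `^ e)).
  by apply: ge0_ler_powR; rewrite ?nnegrE ?(ltW e0) ?addr_ge0 ?mulr_ge0//
    mulr2n mulrDl mul1r lerD2r.
by rewrite powRM// ler_wpM2l ?powR_ge0// lerDr powR_ge0.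
Qed.

(** Subadditivity: for z = x and z = y the ratio z/(x+y) lies in [0,1], where
raising to a power e <= 1 increases it. *)
Lemma powRD_le x y e : 0 < e -> e <= 1 -> 0 <= x -> 0 <= y ->
  (x + y) `^ e <= x `^ e + y `^ e.
Proof.
move=> e0 e1 x0 y0.
have := addr_ge0 x0 y0; rewrite le_eqVlt => /predU1P[xy0|xy0].
  by rewrite -xy0 powR0 ?gt_eqF// addr_ge0// powR_ge0.
have frac z : 0 <= z -> z <= x + y -> (x + y) `^ e * (z / (x + y)) <= z `^ e.
  move=> z0 zxy; have := z0; rewrite le_eqVlt => /predU1P[<-|z1].
    by rewrite mul0r mulr0 powR_ge0.
  have -> : z `^ e = (x + y) `^ e * (z / (x + y)) `^ e.
    by rewrite -powRM ?divr_ge0 ?(ltW xy0)// mulrCA divff ?gt_eqF ?mulr1.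
  rewrite ler_wpM2l ?powR_ge0//; apply: ger1_powR => //.
  by rewrite divr_gt0//= ler_pdivrMr// mul1r.
have -> : (x + y) `^ e = (x + y) `^ e * (x / (x + y)) + (x + y) `^ e * (y / (x + y)).
  by rewrite -mulrDr -mulrDl divff ?mulr1// gt_eqF.
by apply: lerD; apply: frac; rewrite // ?lerDl ?lerDr.
Qed.

Lemma sum_powR_le (I : Type) e (s : seq I) (z : I -> R) : 0 < e -> e <= 1 ->
  (forall i, 0 <= z i) ->
  (\sum_(i <- s) z i) `^ e <= \sum_(i <- s) z i `^ e.
Proof.
move=> e0 e1 z0; elim: s => [|i s IH].
  by rewrite !big_nil powR0// gt_eqF.
rewrite !big_cons; apply: le_trans (powRD_le _ _ _ _) _ => //.
  exact: sumr_ge0.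
by rewrite lerD2l.
Qed.

Lemma sum_powR_le_const (I : Type) e (s : seq I) : 0 < e -> exists C : R, 0 <= C /\
  forall z : I -> R, (forall i, 0 <= z i) ->
  (\sum_(i <- s) z i) `^ e <= C * \sum_(i <- s) z i `^ e.
Proof.
move=> e0; elim: s => [|i s [C [C0 IH]]].
  by exists 0; split => // z z0; rewrite !big_nil powR0 ?mul0r// gt_eqF.
exists (2 `^ e * (1 + C)); split.
  by rewrite mulr_ge0 ?powR_ge0// addr_ge0.
move=> z z0; rewrite !big_cons; apply: le_trans (powRD_le_double _ _ _) _ => //.
  exact: sumr_ge0.
rewrite -mulrA ler_wpM2l ?powR_ge0//.
have S0 : 0 <= \sum_(j <- s) z j `^ e by apply: sumr_ge0 => j _; exact: powR_ge0.
have := IH _ z0; have := powR_ge0 (z i) e; have := mulr_ge0 C0 (powR_ge0 (z i) e).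
lra.
Qed.

Lemma normalize_hoelder (x y z V1 a b : R) : 0 < V1 -> 0 <= y -> 0 <= z ->
  a^-1 + b^-1 = 1 -> x <= y `^ a^-1 * z `^ b^-1 ->
  x / V1 <= (y / V1) `^ a^-1 * (z / V1) `^ b^-1.
Proof.
move=> V10 y0 z0 ab xyz.
have VV : 0 <= V1^-1 by rewrite invr_ge0 ltW.
rewrite (powRM _ y0 VV) (powRM _ z0 VV) mulrACA -powRD; last first.
  by rewrite ab oner_eq0.
by rewrite ab (powRr1 VV) ler_wpM2r.
Qed.

Lemma conjugate_exponentP e : 1 < e ->
  1 < conjugate_exponent e /\ e^-1 + (conjugate_exponent e)^-1 = 1.
Proof.
move=> e1; rewrite /conjugate_exponent; split.
  by rewrite ltr_pdivlMr ?subr_gt0// mul1r gtrBl.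
rewrite invf_div.
by rewrite -[X in X + _]mul1r -mulrDl addrC subrK mulfV// gt_eqF// (lt_trans ltr01).
Qed.

Lemma conjugate_exponentK e : 1 < e -> conjugate_exponent (conjugate_exponent e) = e.
Proof.
move=> e1; have [e'1 ee'] := conjugate_exponentP e1.
have [_ e'e''] := conjugate_exponentP e'1.
by apply: invr_inj; move: ee' e'e''; lra.
Qed.

(** The gain in Hoelder's inequality: enlarging an exponent lowers its conjugate. *)
Lemma conjugate_exponentM_lt a b : 1 < a -> 1 < b ->
  conjugate_exponent (a * b) < conjugate_exponent a.
Proof.
move=> a1 b1; have a0 : 0 < a by rewrite (lt_trans ltr01).
have ab1 : 1 < a * b by rewrite (lt_trans a1)// ltr_pMr.
have [a'1 aa'] := conjugate_exponentP a1; have [ab'1 abab'] := conjugate_exponentP ab1.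
rewrite -ltf_pV2 ?posrE ?(lt_trans ltr01 a'1) ?(lt_trans ltr01 ab'1)//.
have : (a * b)^-1 < a^-1 by rewrite ltf_pV2 ?posrE ?mulr_gt0 ?ltr_pMr// (lt_trans ltr01).
lra.
Qed.

Lemma le_poweR e (u v : \bar R) : 0 <= e ->
  (0 <= u)%E -> (u <= v)%E -> (u `^ e <= v `^ e)%E.
Proof.
move=> e0 u0 uv; apply: gt0_ler_poweR => //; rewrite in_itv/= leey andbT//.
exact: le_trans uv.
Qed.

Lemma measurable_powR_fun d (T : measurableType d) (h : T -> R) e :
  measurable_fun setT h -> measurable_fun setT (fun z => h z `^ e).
Proof. by move=> mh; exact: (measurableT_comp (@measurable_powR R e) mh). Qed.

End powers.

(** * Flattened lists *)

Lemma subseq_flatten_map (J I : eqType) (f g : J -> seq I) (s : seq J) :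
  (forall j, subseq (f j) (g j)) ->
  subseq (flatten [seq f j | j <- s]) (flatten [seq g j | j <- s]).
Proof. by move=> fg; elim: s => //= d s; exact: cat_subseq. Qed.

Lemma uniq_flatten_map (J I : eqType) (f : J -> seq I) (s : seq J) :
  uniq s -> (forall j, j \in s -> uniq (f j)) ->
  (forall i j x, i \in s -> j \in s -> x \in f i -> x \in f j -> i = j) ->
  uniq (flatten [seq f j | j <- s]).
Proof.
elim: s => [//|j s IH] /= /andP[js us] uf disj.
rewrite cat_uniq uf ?mem_head//= IH//; last 2 first.
- by move=> i si; apply: uf; rewrite inE si orbT.
- by move=> i i' x si si'; apply: disj; rewrite inE ?si ?si' orbT.
rewrite andbT; apply/hasPn => x /flattenP[_ /mapP[i si ->]] xfi.
apply/negP => xfj; move/negP: js; apply.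
by rewrite (disj j i x) ?mem_head// inE si orbT.
Qed.

(** * Lipschitz functions of one variable *)

(** Both outer measures are infima over the same covers by intervals, so it is
enough to compare the lengths of intervals. *)
Lemma stieltjes_le_lebesgue (R : realType) (F : cumulative R R) (K : R) :
  0 < K -> (forall x y, x <= y -> F y - F x <= K * (y - x)) ->
  forall A : set (measurableTypeR R),
  (lebesgue_stieltjes_measure F A <= K%:E * lebesgue_measure A)%E.
Proof.
move=> K0 FK A.
rewrite /lebesgue_measure /lebesgue_stieltjes_measure /= /measure_extension.
rewrite /mu_ext -lee_pdivrMl//; apply: le_ereal_inf_tmp => _ [B BA <-].
rewrite lee_pdivrMl//.
apply: (@le_trans _ _ (\sum_(k <oo) (wlength F (B k)))%E).
  by apply: ereal_inf_lbound; exists B.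
rewrite -nneseriesZl; last by move=> i _; exact: wlength_ge0.
apply: lee_nneseries => [i _ _|i _]; first exact: wlength_ge0.
have [/(_ i) + _] := BA.
move=> /ocitvP[->|[[x y] /= xy ->]].
  by rewrite wlength0 mule_ge0 ?wlength_ge0 ?lee_fin ?(ltW K0).
rewrite !wlength_itv_bnd ?(ltW xy)// -EFinM lee_fin.
exact/FK/ltW.
Qed.

Lemma klipschitzP (R : realType) (V : normedModType R) (k : R) (f : V -> R) :
  k.-lipschitz f -> forall x y, `|f x - f y| <= k * `|x - y|.
Proof. by move=> fk x y; exact: (fk (x, y)). Qed.

Lemma lipschitz_continuous (R : realType) (V : normedModType R) (k : R)
  (f : V -> R) : (forall x y, `|f x - f y| <= k * `|x - y|) -> continuous f.
Proof.
move=> fk x; apply/cvgrPdist_lt => e e0.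
have k0 : 0 < `|k| + 1 by rewrite ltr_wpDl.
near=> y; apply: (le_lt_trans (fk _ _)).
have : `|x - y| < e / (`|k| + 1).
  by near: y; apply: cvgr_dist_lt; rewrite ?divr_gt0.
rewrite ltr_pdivlMr//; apply: le_lt_trans.
by rewrite mulrC ler_wpM2l// (le_trans (ler_norm k))// lerDl.
Unshelve. all: by end_near. Qed.

(** Adding k x to psi yields a nondecreasing function F whose Stieltjes measure is
at most a multiple of Lebesgue measure. By the Lebesgue differentiation theorem
its Radon-Nikodym density is F' almost everywhere, so psi' is the density minus
k, and psi is the integral of psi'. *)
Lemma lipschitz_FTC (R : realType) (psi : R -> R) (k a b : R) : a < b ->
  (forall x y, `|psi x - psi y| <= k * `|x - y|) ->
  measurable_fun setT ('D_1 psi : R -> R) ->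
  (`|psi b - psi a|%:E <=
    \int[lebesgue_measure]_(x in `]a, b]) `|'D_1 psi x|%:E)%E.
Proof.
move=> ab psik mpsi'.
have k0 : 0 <= k.
  by have := psik 1 0; rewrite subr0 normr1 mulr1; apply: le_trans.
(* Adding slope k makes the function nondecreasing, with slope at most 2 k. *)
pose F x := psi x + k * x.
have k1 : 0 < 2 * k + 1 by lra.
have cpsi : continuous psi by apply: lipschitz_continuous psik.
have cF : continuous F.
  by move=> x; apply: cvgD; [exact: cpsi|exact: mulrl_continuous].
have ndF : nondecreasing F.
  move=> x y xy; rewrite /F -subr_ge0.
  have := psik x y; rewrite ler_norml => /andP[_].
  by rewrite distrC ger0_norm ?subr_ge0// => H; lra.
have FK x y : x <= y -> F y - F x <= (2 * k + 1) * (y - x).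
  move=> xy; have := psik y x; rewrite ler_norml => /andP[_].
  by rewrite ger0_norm ?subr_ge0// /F => H; lra.
pose cum := isCumulative.Build R _ R F ndF (right_continuousW cF).
pose F' : cumulative R R := HB.pack F cum.
pose muF := lebesgue_stieltjes_measure F'.
have muFle := @stieltjes_le_lebesgue R F' (2 * k + 1) k1 FK.
pose mD : measurable (`]a, b]%classic : set (measurableTypeR R)) :=
  @measurable_itv R `]a, b].
have moo : (muF `]a, b]%classic < +oo)%E.
  apply: (le_lt_trans (muFle _)).
  rewrite lebesgue_measure_itv/= lte_fin ab -EFinB -EFinM ltry//.
pose nu := mfrestr mD moo.
have numu : nu `<< @lebesgue_measure R.
  apply/null_content_dominatesP => A mA A0.
  rewrite /nu /mfrestr /mrestr.
  apply/eqP; rewrite eq_le measure_ge0 andbT.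
  apply: le_trans (muFle _) _.
  suff -> : lebesgue_measure (A `&` `]a, b]%classic) = 0%E by rewrite mule0.
  apply: (subset_measure0 _ mA) => //.
  exact: measurableI.
have [phi [phi0 phifin phiint phiE]] := radon_nikodym_sigma_finite numu.
pose ph (x : R) : R := fine (phi x).
have phE : EFin \o ph = phi by apply/funext => x /=; rewrite /ph fineK.
have phloc : locally_integrable setT ph.
  by apply: open_integrable_locally; [exact: openT|rewrite phE].
have muFE x : a <= x <= b -> nu `]a, x]%classic = (F x - F a)%:E.
  move=> /andP[ax xb]; rewrite /nu /mfrestr /mrestr.
  rewrite (_ : _ `&` _ = `]a, x]%classic); last first.
    apply/seteqP; split => y /=; first by case.
    rewrite !in_itv/= => /andP[ay yx]; rewrite ay yx (le_trans yx)//.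
  rewrite /muF /lebesgue_stieltjes_measure /= /measure_extension.
  rewrite measurable_mu_extE /=; last exact: is_ocitv.
  by rewrite wlength_itv_bnd.
have derE : {ae lebesgue_measure, forall x, `]a, b]%classic x ->
    `|'D_1 psi x|%:E = `|ph x - k|%:E}.
  have := lebesgue_differentiation phloc.
  (* x needs a neighbourhood to its right inside ]a, b], hence x < b. *)
have nb : {ae lebesgue_measure, forall x : R, x != b}.
    exists [set b]; split => //; first exact: lebesgue_measure_set1.
    by move=> x /= /negP; rewrite negbK => /eqP.
  apply: (@filterS2 _ _ (ae_filter_ringOfSetsType _)) nb => x xb phx /=.
  rewrite in_itv/= => /andP[ax xleb].
  have {xb xleb}xb : x < b by rewrite lt_neqAle xb.
  have iph : lebesgue_measure.-integrable
    [set` Interval (BRight a) (BRight b)] (EFin \o ph).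
    by rewrite phE; apply: integrableS phiint.
  have [dI DI] := FTC1_lebesgue_pt xb iph ax phx.
  move: dI DI; set I := fun y : R => _ => dI DI.
  have dI' : is_derive x 1 I (ph x).
    by apply: DeriveDef => //; rewrite -derive1E.
  have IE : forall y, a < y -> y <= b -> I y = F y - F a.
    move=> y ay yb; rewrite /I /Rintegral.
    have -> : (\int[lebesgue_measure]_(t in `]a, y]) (ph t)%:E = nu `]a, y]%classic)%E.
      by apply/esym; etransitivity; [apply: phiE; exact: measurable_itv|rewrite -phE].
    by rewrite muFE// ltW.
  suff : is_derive x 1 psi (ph x - k) by move=> d; rewrite derive_val.
  have : is_derive x 1 (fun y => I y + (F a - k * y)) (ph x + (0 - k * 1)).
    apply: is_deriveD; apply: is_deriveB.
  rewrite sub0r mulr1; apply: near_eq_is_derive.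
  near=> y; rewrite IE; first by rewrite /F; ring.
  - by near: y; exact: (cvgr_gt x (@cvg_id _ _)).
  - by near: y; exact: lt_le_nbhsl.
have lab : lebesgue_measure (`]a, b]%classic : set R) = (b - a)%:E.
  by rewrite lebesgue_measure_itv/= lte_fin ab EFinB.
have kint : lebesgue_measure.-integrable `]a, b]%classic (EFin \o cst k).
  apply: measurable_bounded_integrable => //; last exact: bounded_cst.
  by rewrite [ltLHS]lab ltry.
have phint : lebesgue_measure.-integrable `]a, b]%classic (EFin \o ph).
  by rewrite phE; exact: integrableS phiint.
have mphk : measurable_fun (`]a, b]%classic : set R) (fun x => ph x - k).
  apply: measurable_funD => //.
  by apply/measurable_EFinP; exact: measurable_int phint.
have psiE : (\int[lebesgue_measure]_(x in `]a, b]) (ph x - k)%:E =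
             (psi b - psi a)%:E)%E.
  rewrite integralB_EFin//= integral_cst//= lab.
  have -> : (\int[lebesgue_measure]_(t in `]a, b]) (ph t)%:E = nu `]a, b]%classic)%E.
    by apply/esym; etransitivity; [apply: phiE; exact: measurable_itv|rewrite -phE].
  rewrite muFE ?lexx ?(ltW ab)// -EFinM -EFinB /F; congr EFin; ring.
rewrite -abse_EFin -psiE.
apply: le_trans (le_abse_integral _ _ _) _ => //.
  exact/measurable_EFinP.
rewrite le_eqVlt; apply/orP; left; apply/eqP.
apply: ge0_ae_eq_integral => //.
- by apply/measurable_EFinP; exact: measurableT_comp.
- apply/measurable_EFinP; apply: measurableT_comp => //.
  exact: measurable_funTS.
- apply: (@filterS _ _ (ae_filter_ringOfSetsType _)) derE => x H xab /=.
  by rewrite H.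
Unshelve. all: by end_near. Qed.

(** * Stopping cubes in a tree *)

Section stopping_times.
Context (R : realType) (I : eqType) (D : finType) (child : I -> D -> I).
Implicit Types (F G H P V A chi l : I -> R) (Q : I) (lam t : R) (N : nat).

(** Volumes, integrals and the indicator of a fixed point all have this property
along the dyadic tree. *)
Definition tree_additive F := forall Q, F Q = \sum_(d : D) F (child Q d).

Fixpoint tree N Q : seq I :=
  if N is N'.+1 then
    Q :: flatten [seq tree N' (child Q d) | d <- enum D]
  else [::].

(** The principal cubes for the averages [A], down to depth [N]; [lam] is the average
of the last selected ancestor. *)
Fixpoint stopping A lam N Q : seq I :=
  if N is N'.+1 then
    if 2 * lam < A Q
    then Q :: flatten [seq stopping A (A Q) N' (child Q d) | d <- enum D]
    else flatten [seq stopping A lam N' (child Q d) | d <- enum D]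
  else [::].

Lemma sum_flatten_child (f : D -> seq I) F :
  \sum_(S <- flatten [seq f d | d <- enum D]) F S =
  \sum_(d : D) \sum_(S <- f d) F S.
Proof. by rewrite big_flatten big_map big_enum. Qed.

Lemma stopping_subseq A lam N Q : subseq (stopping A lam N Q) (tree N Q).
Proof.
elim: N lam Q => [//|N IH] lam Q /=.
case: ifP => _; first by rewrite eqxx; apply: subseq_flatten_map => d.
by apply: subseq_trans (subseq_cons _ _); apply: subseq_flatten_map => d.
Qed.

Section packing.
Variables (V G : I -> R).
Hypotheses (V0 : forall Q, 0 < V Q) (Vadd : tree_additive V).
Hypotheses (G0 : forall Q, 0 <= G Q) (Gadd : tree_additive G).
Let A Q := G Q / V Q.

Let A0 Q : 0 <= A Q. Proof. by rewrite divr_ge0// ltW. Qed.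

Let AE Q : G Q = A Q * V Q. Proof. by rewrite /A divfK// gt_eqF. Qed.

(** A selected cube [Q] has lam |Q| < G Q / 2, and by induction the cubes selected
below it, for which the threshold is A Q, have total volume at most
G Q / A Q = |Q|: together 2 |Q| < G Q / lam. *)
Lemma stopping_mass_le lam N Q : 0 < lam ->
  \sum_(S <- stopping A lam N Q) V S <= G Q / lam.
Proof.
elim: N lam Q => [|N IH] lam Q lam0 /=.
  by rewrite big_nil divr_ge0// ltW.
case: ifPn => lamA; last first.
  rewrite sum_flatten_child Gadd mulr_suml; apply: ler_sum => d _.
  exact: IH.
have AQ0 : 0 < A Q by apply: le_lt_trans lamA; rewrite mulr_ge0// ltW.
rewrite big_cons sum_flatten_child.
apply: (@le_trans _ _ (V Q + \sum_(d : D) G (child Q d) / A Q)).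
  by rewrite lerD2l; apply: ler_sum => d _; exact: IH.
rewrite -mulr_suml -Gadd {1}AE [A Q * _]mulrC mulfK ?gt_eqF//.
rewrite ler_pdivlMr// AE.
have : (2 * lam) * V Q <= A Q * V Q by rewrite ler_wpM2r ?ltW.
lra.
Qed.

(** A cube that is skipped has average at most twice the current threshold, and
sides halve, so the skipped cubes around a point form a geometric series. The
term with [lam] on the right is the contribution of the last selected ancestor,
which is what the induction hands down. *)
Lemma tree_le_stopping chi l lam N Q :
  (forall Q, 0 <= chi Q) -> tree_additive chi ->
  (forall Q, 0 <= l Q) -> (forall Q d, l (child Q d) = l Q / 2) -> 0 <= lam ->
  \sum_(S <- tree N Q) l S * A S * chi S <=
  4 * (\sum_(S <- stopping A lam N Q) l S * A S * chi S + lam * l Q * chi Q).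
Proof.
move=> chi0 chiadd l0 lchild.
elim: N lam Q => [|N IH] lam Q lam0 /=.
  by rewrite !big_nil add0r; do !apply: mulr_ge0.
rewrite big_cons sum_flatten_child.
have IHc mu : 0 <= mu ->
    \sum_(d : D) \sum_(S <- tree N (child Q d)) l S * A S * chi S <=
    4 * \sum_(d : D) \sum_(S <- stopping A mu N (child Q d)) l S * A S * chi S
      + 2 * mu * l Q * chi Q.
  move=> mu0; rewrite (chiadd Q) !mulr_sumr -big_split/=.
  apply: ler_sum => d _; apply: le_trans (IH _ _ mu0) _.
  by rewrite mulrDr lerD2l lchild le_eqVlt; apply/orP; left; apply/eqP; field.
case: ifPn => lamA.
  rewrite big_cons sum_flatten_child.
  have := IHc _ (A0 Q).
  have : 0 <= l Q * A Q * chi Q.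
    apply: mulr_ge0; [apply: mulr_ge0|]; [exact: l0|exact: A0|exact: chi0].
  have : 0 <= lam * l Q * chi Q by do !apply: mulr_ge0.
  lra.
rewrite sum_flatten_child.
have := IHc _ lam0.
have : l Q * chi Q * A Q <= l Q * chi Q * (2 * lam).
  by rewrite ler_wpM2l ?mulr_ge0// leNgt.
lra.
Qed.

Section carleson.
Variables (H P : I -> R) (t : R).
Hypotheses (t1 : 1 < t).
Hypotheses (H0 : forall Q, 0 <= H Q) (Hadd : tree_additive H).
Hypotheses (Padd : tree_additive P).
Hypothesis HP : forall Q, V Q * (H Q / V Q) `^ t <= P Q.

(** The reciprocal of the relative loss in [perspective_gain]. *)
Definition carleson_const (t : R) : R :=
  (2 `^ (1 - t) * (1 - (3 / 2) `^ (1 - t)))^-1.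

Lemma carleson_const_gt0 (s : R) : 1 < s -> 0 < carleson_const s.
Proof.
move=> s1; rewrite invr_gt0 mulr_gt0 ?powR_gt0// subr_gt0.
have : 1 `^ (s - 1) < (3 / 2 : R) `^ (s - 1).
  by apply: gt0_ltr_powR; rewrite ?nnegrE; lra.
by rewrite powR1 -(opprB s 1) powRN => lt1; rewrite invf_lt1// (lt_trans _ lt1).
Qed.

(** The perspective z (h/z)^t of a convex power is convex and homogeneous of degree
one, hence subadditive: sum the tangent inequality at the mean [c]. *)
Lemma perspective_subadd (h z : D -> R) :
  (forall d, 0 <= h d) -> (forall d, 0 < z d) -> 0 < \sum_d z d ->
  (\sum_d z d) * ((\sum_d h d) / (\sum_d z d)) `^ t <=
  \sum_d z d * (h d / z d) `^ t.
Proof.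
move=> h0 z0 Z0; set c := (\sum_d h d) / _.
have c0 : 0 <= c.
  by apply: divr_ge0; [apply: sumr_ge0 => d _|exact: ltW].
apply: (@le_trans _ _ (\sum_d z d *
    (t * c `^ (t - 1) * (h d / z d) - (t - 1) * c `^ t))); last first.
  apply: ler_sum => d _; rewrite ler_pM2l//.
  by apply: tangent_powR => //; rewrite divr_ge0// ltW.
rewrite [leRHS](eq_bigr (fun d => t * c `^ (t - 1) * h d - z d * ((t - 1) * c `^ t))).
  2: move=> d _; rewrite mulrBr; congr (_ - _).
  2: by rewrite mulrCA [z d * _]mulrC divfK ?gt_eqF.
rewrite sumrB -mulr_sumr -mulr_suml.
have -> : \sum_i h i = c * \sum_d z d by rewrite /c divfK// gt_eqF.
have -> : c `^ t = c * c `^ (t - 1) by rewrite mulr_powRB1// (lt_trans ltr01).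
by rewrite le_eqVlt; apply/orP; left; apply/eqP; ring.
Qed.

(** As z (h/z)^t = h^t z^(1-t), the claim concerns z^(1-t) - (z+v)^(1-t). Since
z <= 2 v, the step from z to z + v multiplies z by at least 3/2. *)
Lemma perspective_gain (h v z : R) : 0 <= h -> 0 < v -> v <= z -> z <= 2 * v ->
  v * (h / v) `^ t <=
  carleson_const t * (z * (h / z) `^ t - (z + v) * (h / (z + v)) `^ t).
Proof.
move=> h0 v0 vz z2v.
have z0 : 0 < z by apply: lt_le_trans vz.
have zv0 : 0 < z + v by rewrite addr_gt0.
have pE (x : R) : 0 < x -> x * (h / x) `^ t = h `^ t * x `^ (1 - t).
  move=> x0; rewrite powRM ?invr_ge0 ?(ltW x0)// -powR_inv1 ?(ltW x0)// -powRrM.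
  rewrite mulrCA -{1}[x]powRr1 ?(ltW x0)// -powRD; last by rewrite (gt_eqF x0) implybT.
  by rewrite mulN1r.
rewrite !pE// -mulrBr mulrCA ler_wpM2l ?powR_ge0//.
have cc := carleson_const_gt0 t1.
have t1' : 0 <= t - 1 by rewrite subr_ge0 ltW.
have anti (x y : R) : 0 < x -> x <= y -> y `^ (1 - t) <= x `^ (1 - t).
  move=> x0 xy; have y0 : 0 < y by apply: lt_le_trans xy.
  rewrite -(opprB t 1) !powRN lef_pV2 ?posrE ?powR_gt0//.
  by rewrite ge0_ler_powR ?nnegrE// ltW.
rewrite -ler_pdivrMl//.
apply: (@le_trans _ _ (z `^ (1 - t) - (3 / 2 * z) `^ (1 - t))); last first.
  rewrite lerD2l lerN2; apply: anti; [by rewrite mulr_gt0 ?divr_gt0|lra].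
rewrite powRM ?(ltW z0) ?divr_ge0//.
rewrite /carleson_const invrK -{1}[z `^ _]mul1r -mulrBl.
rewrite [X in X <= _]mulrAC [leRHS]mulrC -powRM ?(ltW v0)//.
apply: ler_wpM2r; last exact: anti.
by have := cc; rewrite invr_gt0 pmulr_rgt0 ?powR_gt0// => /ltW.
Qed.

(** Bellman function argument. Let Z be the volume of [Q] plus the volumes of the
cubes selected inside [Q]. The budget P Q - Z (H Q / Z)^t is superadditive over
the children and, when [Q] is selected, Z grows by V Q, which releases a fixed
multiple of V Q (H Q / V Q)^t because Z <= 2 V Q before the selection. *)
Lemma carleson_embedding lam N Q : 0 <= lam ->
  \sum_(S <- stopping A lam N Q) V S * (H S / V S) `^ t <=
  carleson_const t * P Q.
Proof.
move=> lam0.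
pose Z lam N Q := V Q + \sum_(S <- stopping A lam N Q) V S.
suff : \sum_(S <- stopping A lam N Q) V S * (H S / V S) `^ t <=
    carleson_const t * (P Q - Z lam N Q * (H Q / Z lam N Q) `^ t).
  move=> /le_trans; apply; rewrite ler_pM2l ?carleson_const_gt0//.
  rewrite gerBl mulr_ge0 ?powR_ge0// addr_ge0 ?(ltW (V0 _))//.
  by apply: sumr_ge0 => S _; rewrite ltW.
have Z0 mu M S : 0 < Z mu M S.
  by rewrite ltr_pwDl ?V0//; apply: sumr_ge0 => S' _; rewrite ltW.
have step mu M S :
    \sum_d carleson_const t * (P (child S d) -
      Z mu M (child S d) * (H (child S d) / Z mu M (child S d)) `^ t) <=
    carleson_const t * (P S - (\sum_d Z mu M (child S d)) *
      (H S / (\sum_d Z mu M (child S d))) `^ t).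
  rewrite -mulr_sumr ler_pM2l ?carleson_const_gt0// sumrB -Padd.
  rewrite lerD2l lerN2 (Hadd S); apply: perspective_subadd => //.
  apply: lt_le_trans (V0 S) _; rewrite Vadd; apply: ler_sum => d _.
  by rewrite lerDl sumr_ge0// => S' _; rewrite ltW.
elim: N lam Q lam0 => [|N IH] lam Q lam0 /=.
  rewrite big_nil /Z /= big_nil addr0 mulr_ge0 ?subr_ge0//.
  exact/ltW/carleson_const_gt0.
have ZE mu : \sum_d Z mu N (child Q d) =
    V Q + \sum_d \sum_(S <- stopping A mu N (child Q d)) V S.
  by rewrite big_split/= -Vadd.
rewrite -[Z lam N.+1 Q]/(V Q + \sum_(S <- stopping A lam N.+1 Q) V S) /=.
case: ifPn => lamA; last first.
  rewrite !sum_flatten_child -ZE; apply: le_trans (step _ _ _).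
  by apply: ler_sum => d _; exact: IH.
rewrite !big_cons !sum_flatten_child addrCA -ZE [V Q + \sum_d Z _ _ _]addrC.
have AQ0 : 0 < A Q by apply: le_lt_trans lamA; rewrite mulr_ge0.
apply: (@le_trans _ _ (V Q * (H Q / V Q) `^ t +
   carleson_const t * (P Q - (\sum_d Z (A Q) N (child Q d)) *
      (H Q / (\sum_d Z (A Q) N (child Q d))) `^ t))).
  rewrite lerD2l; apply: le_trans (step _ _ _).
  by apply: ler_sum => d _; exact: IH.
have sle : \sum_d \sum_(S <- stopping A (A Q) N (child Q d)) V S <= V Q.
  apply: (@le_trans _ _ (\sum_(d : D) G (child Q d) / A Q)).
    by apply: ler_sum => d _; exact: stopping_mass_le.
  by rewrite -mulr_suml -Gadd {1}AE [A Q * _]mulrC mulfK ?gt_eqF.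
have s0 : 0 <= \sum_d \sum_(S <- stopping A (A Q) N (child Q d)) V S.
  by apply: sumr_ge0 => d _; apply: sumr_ge0 => S _; rewrite ltW.
have := @perspective_gain (H Q) (V Q) (\sum_d Z (A Q) N (child Q d)) (H0 Q) (V0 Q).
rewrite ZE => /(_ _ _).
have -> : V Q <= V Q + \sum_d \sum_(S <- stopping A (A Q) N (child Q d)) V S.
  by rewrite lerDl.
have -> : V Q + \sum_d \sum_(S <- stopping A (A Q) N (child Q d)) V S <= 2 * V Q.
  lra.
move=> /(_ isT isT); set x := _ * (_ / (V Q + _ + _)) `^ t; set y := (V Q + _) * _ `^ _.
by rewrite !mulrBr; lra.
Qed.

End carleson.
End packing.
End stopping_times.

(** * Translation invariance *)

Section translation.
Context (R : realType).

Lemma lebesgue_measure_shift (a : R) (A : set (measurableTypeR R)) :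
  measurable A -> lebesgue_measure ((+%R^~ a) @^-1` A) = lebesgue_measure A.
Proof.
move=> mA; have ma : measurable_fun setT
    (fun x : measurableTypeR R => x + a : measurableTypeR R).
  by apply: measurable_funD.
pose nu := measure_function_pushforward__canonical__measure_function_Measure
  (@lebesgue_measure R) ma.
apply/esym; rewrite -[RHS]/(nu A); apply: lebesgue_measure_unique => // X.
move=> /ocitvP[->|[[x y] /= xy ->]]; first by rewrite !measure0.
rewrite /nu/= /pushforward lebesgue_measure_itv/= lte_fin xy.
rewrite (_ : _ @^-1` _ = `]x - a, y - a]%classic).
  by rewrite lebesgue_measure_itv/= lte_fin ltrD2r xy -!EFinB; congr EFin; ring.
by apply/seteqP; split => z /=; rewrite !in_itv/= ltrBlDr lerBrDr.
Qed.

Lemma measurable_shift_rV n (a : 'rV[R]_n) :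
  measurable_fun setT (fun x : 'rV[R]_n => x + a).
Proof.
apply: measurable_fun_rV => i.
rewrite (_ : _ \o _ = fun x => rV_coord i x + rV_coord i a).
  by apply: measurable_funD => //; exact: measurable_rV_coord.
by apply/funext => x; rewrite /rV_coord /= mxE.
Qed.

(** Uniqueness of product measures reduces this to one coordinate at a time. *)
Lemma borel_lebesgue_rV_shift n (a : 'rV[R]_n) (A : set 'rV[R]_n) :
  measurable A ->
  borel_lebesgue_rV R n ((+%R^~ a) @^-1` A) = borel_lebesgue_rV R n A.
Proof.
elim: n a A => [|n IH] a A mA.
  by congr (_ _); apply/seteqP; split => x /=; rewrite (_ : x + a = x)//; apply/rowP => -[].
pose a' := uncons_rV a.
have mshift : measurable_fun setT
    (fun z : measurableTypeR R * 'rV[R]_n =>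
      ((z.1 + a'.1, z.2 + a'.2) : measurableTypeR R * 'rV[R]_n)).
  apply/measurable_fun_pairP; split.
    rewrite (_ : _ \o _ = fun z => z.1 + a'.1)//.
    by apply: measurable_funD => //; exact: measurable_fst.
  rewrite (_ : _ \o _ = (fun x => x + a'.2) \o snd)//.
  by apply: measurableT_comp => //; exact: measurable_shift_rV.
pose nu := measure_function_pushforward__canonical__measure_function_Measure
  (lebesgue_measure \x borel_lebesgue_rV R n)%E mshift.
have nuE : forall X : set (measurableTypeR R * 'rV[R]_n), measurable X ->
    (lebesgue_measure \x borel_lebesgue_rV R n)%E X = nu X.
  apply: product_measure_unique => X Y mX mY.
  have -> : nu (X `*` Y) = (lebesgue_measure \x borel_lebesgue_rV R n)%E
      ((+%R^~ a'.1 @^-1` X) `*` (+%R^~ a'.2 @^-1` Y)) by [].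
  rewrite product_measure1E.
  - by congr (_ * _)%E; [exact: lebesgue_measure_shift|exact: IH].
  - by rewrite -[X in measurable X]setTI; apply: measurable_funD.
  - by rewrite -[X in measurable X]setTI; apply: measurable_shift_rV.
rewrite /= /lebesgue_rV_step /pushforward /= [RHS]nuE.
  rewrite /nu /= /pushforward; congr (_ _).
  apply/funext => z; congr (A _); apply/rowP => i; rewrite !mxE.
  by case: (unliftP ord0 i) => [j|] -> /=; rewrite ?mxE.
rewrite -[X in measurable X]setTI; exact: measurable_cons_rV.
Qed.

Lemma ge0_integral_shift_rV n (a : 'rV[R]_n) (F : 'rV[R]_n -> \bar R) :
  measurable_fun setT F -> (forall x, 0 <= F x)%E ->
  (\int[borel_lebesgue_rV R n]_x F (x + a)%R = \int[borel_lebesgue_rV R n]_x F x)%E.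
Proof.
move=> mF F0.
have ma := measurable_shift_rV a.
have := @ge0_integral_pushforward _ _ _ _ R _ ma (borel_lebesgue_rV R n) setT F.
move=> /(_ measurableT mF (fun y _ => F0 y)); rewrite preimage_setT /= => <-.
apply: eq_measure_integral => /= A mA _; exact: borel_lebesgue_rV_shift.
Qed.

End translation.

(** * Dyadic cubes *)

Section dyadic_cubes.
Context (R : realType) (n : nat).
Implicit Types (Q : int * 'rV[int]_n) (x y : 'rV[R]_n).
Local Notation side := (@dyadic_side R n).
Local Notation cube := (@dyadic_cube R n).

Lemma rV_norm_le (x : 'rV[R]_n) (c : R) : 0 <= c ->
  (forall i, `|x ord0 i| <= c) -> `|x| <= c.
Proof.
move=> c0 xc; rewrite -[leLHS]/(mx_norm x) mx_normrE; apply: bigmax_le => //= -[i j] _ /=.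
by rewrite ord1.
Qed.

Lemma coord_norm_le (x : 'rV[R]_n) i : `|x ord0 i| <= `|x|.
Proof. rewrite -[leRHS]/(mx_norm x) mx_normrE; apply: (le_bigmax _ _ (ord0, i)). Qed.

Definition dyadic_index (j : int) x : int * 'rV[int]_n :=
  (j, \row_i Num.floor (x ord0 i / 2 ^ (- j))).

Definition dyadic_child Q (d : {ffun 'I_n -> bool}) : int * 'rV[int]_n :=
  (Q.1 + 1, \row_i (2 * Q.2 ord0 i + (d i)%:Z)).

Definition dyadic_corner Q : 'rV[R]_n := \row_i (side Q * (Q.2 ord0 i)%:~R).

Lemma dyadic_side_gt0 Q : 0 < side Q.
Proof. by rewrite /dyadic_side exprz_gt0. Qed.

Lemma dyadic_side_child Q d : side (dyadic_child Q d) = side Q / 2.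
Proof. by rewrite /dyadic_side /= opprD expfzDr. Qed.

(** At a fixed level the cubes are the fibres of [dyadic_index], hence a partition. *)
Lemma dyadic_cubeP Q x : cube Q x <-> dyadic_index Q.1 x = Q.
Proof.
case: Q => j m; have s0 := dyadic_side_gt0 (j, m); split => [xQ|[<-]].
  congr pair; apply/rowP => i; rewrite mxE; apply: floor_def.
  have := xQ i; rewrite /dyadic_side/= => /andP[le1 lt1].
  by rewrite ler_pdivlMr// ltr_pdivrMr// ![_%:~R * _]mulrC le1.
move=> i; rewrite /dyadic_side /= mxE.
rewrite ![2 ^ (- j) * _]mulrC -ler_pdivlMr// -ltr_pdivrMr//.
by rewrite real_floor_le ?real_floorD1_gt ?num_real.
Qed.

Lemma dyadic_cube_index j x : cube (dyadic_index j x) x.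
Proof. exact/dyadic_cubeP. Qed.

Lemma dyadic_cube_corner Q : cube Q (dyadic_corner Q).
Proof.
move=> i; rewrite mxE lexx /= ltr_pM2l ?dyadic_side_gt0//.
by rewrite ltr_int ltzD1.
Qed.

Lemma dyadic_cube_dist Q x y : cube Q x -> cube Q y -> `|x - y| <= side Q.
Proof.
move=> xQ yQ; have s0 := dyadic_side_gt0 Q; apply: rV_norm_le; first exact: ltW.
move=> i; rewrite !mxE; have := xQ i; have := yQ i.
by rewrite intrD mulrDr mulr1 ler_norml; lra.
Qed.

Lemma dyadic_child_coordE Q d i :
  ((dyadic_child Q d).2 ord0 i)%:~R = 2 * (Q.2 ord0 i)%:~R + (d i)%:R :> R.
Proof. by rewrite mxE intrD intrM -!pmulrn. Qed.

(** The bit d i tells in which half of the i-th edge the point lies. *)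
Lemma dyadic_cube_child Q x :
  cube Q x <-> exists d, cube (dyadic_child Q d) x.
Proof.
have s0 := dyadic_side_gt0 Q; split => [xQ|[d xd] i]; last first.
  have := xd i; rewrite dyadic_side_child !intrD !dyadic_child_coordE mulr1z.
  case: (d i); rewrite /= ?mulr1n ?mulr0n => /andP[? ?].
    by apply/andP; split; lra.
  by apply/andP; split; lra.
exists [ffun i => side Q / 2 * (2 * (Q.2 ord0 i)%:~R + 1) <= x ord0 i] => i.
have := xQ i; rewrite dyadic_side_child !intrD !dyadic_child_coordE ffunE mulr1z.
case: (leP (side Q / 2 * (2 * (Q.2 ord0 i)%:~R + 1)) (x ord0 i)) => /=;
  rewrite ?mulr1n ?mulr0n => ? /andP[? ?].
  by apply/andP; split; lra.
by apply/andP; split; lra.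
Qed.

Lemma dyadic_child_inj Q : injective (dyadic_child Q).
Proof.
move=> d d' [] /rowP dd'; apply/ffunP => i; have := dd' i.
by rewrite !mxE => /addrI; case: (d i); case: (d' i).
Qed.

Lemma dyadic_cube_disjoint Q Q' x : Q.1 = Q'.1 -> cube Q x -> cube Q' x ->
  Q = Q'.
Proof. by move=> QQ' /dyadic_cubeP <- /dyadic_cubeP <-; rewrite QQ'. Qed.

Lemma dyadic_cube_bigsetU Q :
  cube Q = \big[setU/set0]_(d <- enum {ffun 'I_n -> bool})
    cube (dyadic_child Q d).
Proof.
rewrite -bigcup_seq; apply/seteqP; split => x.
  by move/dyadic_cube_child => [d xd]; exists d => //=; rewrite mem_enum.
by move=> [d _ xd]; apply/dyadic_cube_child; exists d.
Qed.

Lemma dyadic_cube_trivIset Q (D : set {ffun 'I_n -> bool}) :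
  trivIset D (fun d => cube (dyadic_child Q d)).
Proof.
move=> d d' _ _ [x [xd xd']]; apply: (@dyadic_child_inj Q).
exact: dyadic_cube_disjoint xd xd'.
Qed.

Lemma dyadic_indicator_additive x :
  @tree_additive R _ _ dyadic_child (fun Q => (x \in cube Q)%:R).
Proof.
move=> Q; have [xQ|xQ] := pselect (cube Q x); last first.
  rewrite memNset// big1// => d _; rewrite memNset// => xd.
  by apply: xQ; apply/dyadic_cube_child; exists d.
have [d xd] := (dyadic_cube_child Q x).1 xQ.
rewrite (bigD1 d)//= !mem_set// big1 ?addr0// => d' d'd.
rewrite memNset// => xd'; move/eqP: d'd; apply.
by apply: (@dyadic_child_inj Q); exact: dyadic_cube_disjoint xd' xd.
Qed.

Lemma dyadic_cubeE Q : cube Q = box_rV (fun i =>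
  `[side Q * (Q.2 ord0 i)%:~R, side Q * (Q.2 ord0 i + 1)%:~R[%classic).
Proof. by apply/seteqP; split => x xQ i; have := xQ i; rewrite /= in_itv. Qed.

Lemma measurable_dyadic_cube Q : measurable (cube Q).
Proof. by rewrite dyadic_cubeE; exact: measurable_box_rV. Qed.

Lemma borel_dyadic_cube Q : borel_lebesgue_rV R n (cube Q) = (side Q ^+ n)%:E.
Proof.
rewrite dyadic_cubeE borel_lebesgue_rV_box//.
rewrite (eq_bigr (fun=> (side Q)%:E)); last first.
  move=> i _; rewrite lebesgue_measure_itv/= lte_fin.
  rewrite ltr_pM2l ?dyadic_side_gt0// ltr_int ltzD1 lexx -EFinB; congr EFin.
  by rewrite intrD; ring.
by rewrite prodEFin prodr_const card_ord.
Qed.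

End dyadic_cubes.

(** * Measurability of directional derivatives *)

Section lipschitz_measurability.
Context (R : realType) (n : nat).
Implicit Types (f : 'rV[R]_n -> R) (e x y : 'rV[R]_n) (k : R).

Lemma bigcap_measurable_rat d (T : measurableType d) (F : rat -> set T) :
  (forall r, measurable (F r)) -> measurable (\bigcap_r F r).
Proof.
move=> mF; rewrite -(setCK (\bigcap_r F r)); apply: measurableC.
rewrite setC_bigcap; apply: bigcupT_measurable_rat => r.
exact: measurableC.
Qed.

Lemma measurable_dyadic_index_comp (j : int) (h : int * 'rV[int]_n -> R) :
  measurable_fun setT (fun x : 'rV[R]_n => h (dyadic_index j x)).
Proof.
move=> _ B mB; rewrite setTI.
rewrite (_ : _ @^-1` B = \bigcup_(m : 'rV[int]_n)
   (if h (j, m) \in B then dyadic_cube (j, m) else set0)).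
  apply: countable_bigcupT_measurable; first exact: countableP.
  by move=> m; case: ifP => _ //; exact: measurable_dyadic_cube.
apply/seteqP; split => x /=.
  move=> Bx; exists (dyadic_index j x).2 => //; rewrite mem_set//.
  exact: (dyadic_cube_index j x).
move=> [m _]; case: ifPn => // /[!inE] Bm /dyadic_cubeP /= ->//.
Qed.

(** The sigma-algebra is generated by the coordinates. A Lipschitz function is the
pointwise limit of its values at the corners of smaller and smaller cubes, and
each approximation takes countably many values on measurable cubes. *)
Lemma measurable_lipschitz f k :
  (forall x y, `|f x - f y| <= k * `|x - y|) -> measurable_fun setT f.
Proof.
move=> fk.
apply: (@measurable_fun_cvg _ _ _ _
  (fun N x => f (dyadic_corner R (dyadic_index N%:Z x)))).
  move=> N; exact: (measurable_dyadic_index_comp N (f \o @dyadic_corner R n)).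
move=> x _.
have cf := lipschitz_continuous fk.
apply: (cvg_comp (fun N : nat => dyadic_corner R (dyadic_index N%:Z x)) f _ (cf x)).
apply/(@cvgrPdist_le R 'rV[R]_n) => eps eps0.
near=> N; apply: (@le_trans _ _ (2 ^- N)).
  have -> : 2 ^- N = @dyadic_side R n (dyadic_index N%:Z x) by rewrite /dyadic_side -exprnN.
  apply: (dyadic_cube_dist (dyadic_cube_index N%:Z x)).
  exact: dyadic_cube_corner.
rewrite -exprVn; near: N.
have /cvgrPdist_le/(_ eps eps0) : (fun N => (2^-1 : R) ^+ N) @ \oo --> (0 : R).
  by apply: cvg_expr; rewrite ger0_norm ?invr_ge0// invf_lt1// ltr1n.
apply: filterS => N; by rewrite sub0r normrN ger0_norm.
Unshelve. all: by end_near. Qed.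

Definition diff_quotient f e (h : R) x : R := h^-1 *: (f (h *: e + x) - f x).

Lemma measurable_diff_quotient f e h : measurable_fun setT f ->
  measurable_fun setT (diff_quotient f e h).
Proof.
move=> mf; apply: measurable_funM => //; apply: measurable_funB => //.
rewrite (_ : (fun x => f (h *: e + x)) = f \o (+%R^~ (h *: e))).
  by apply: measurableT_comp => //; exact: measurable_shift_rV.
by apply/funext => x /=; rewrite addrC.
Qed.

(** The Cauchy criterion for the difference quotients at step zero, with rational
steps only, so that it involves countably many conditions. *)
Definition cauchy_quotients f e x := forall m : nat, exists k : nat,
  forall r s : rat, 0 < `|ratr r : R| < k.+1%:R^-1 ->
    0 < `|ratr s : R| < k.+1%:R^-1 ->
    `|diff_quotient f e (ratr r) x - diff_quotient f e (ratr s) x| <= m.+1%:R^-1.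

(** Rational steps suffice since the quotient is continuous in a nonzero step. *)
Lemma derivable_cauchy_quotients f e x : continuous f ->
  derivable f x e <-> cauchy_quotients f e x.
Proof.
move=> cf; split => [dfe m|fc].
  move: dfe => /cvg_ex[/= l /cvgrPdist_le /(_ (m.+1%:R^-1 / 2))].
  rewrite divr_gt0// => /(_ isT) [d /= d0 dl].
  pose k := Num.truncn d^-1.
  have kd : k.+1%:R^-1 < d.
    by rewrite invf_plt ?posrE// truncnS_gt.
  exists k => r s /andP[r0 rk] /andP[s0 sk].
  have H (u : R) : 0 < `|u| -> `|u| < k.+1%:R^-1 ->
      `|l - diff_quotient f e u x| <= m.+1%:R^-1 / 2.
    move=> u0 uk; apply: dl => /=; last by rewrite -normr_gt0.
    by rewrite sub0r normrN (lt_trans uk).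
  apply: le_trans (ler_distD l _ _) _.
  by rewrite [leRHS]splitr lerD ?H// distrC H.
apply: cauchy_cvg; apply: cauchy_exP => eps eps0.
pose m := Num.truncn eps^-1.
have me : m.+1%:R^-1 < eps by rewrite invf_plt ?posrE// truncnS_gt.
have [k fk] := fc m.
have k0 : 0 < k.+1%:R^-1 :> R by rewrite invr_gt0.
(* A rational step below 1/(k+1); its quotient is the centre of the Cauchy ball. *)
pose s : rat := k.+2%:R^-1.
have s0 : 0 < `|ratr s : R| < k.+1%:R^-1.
  rewrite /s fmorphV rmorph_nat normfV normr_nat invr_gt0 ltr0n /=.
  by rewrite ltf_pV2 ?posrE ?ltr0n// ltr_nat.
exists (diff_quotient f e (ratr s) x).
exists k.+1%:R^-1 => //= h.
rewrite /ball_ /= sub0r normrN => hk h0.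
rewrite -ball_normE /=.
apply: le_lt_trans me; apply/ler_addgt0Pr => eta eta0.
have cdq : {for h, continuous (fun h => diff_quotient f e h x)}.
  rewrite /diff_quotient; apply: continuousM; first exact: inv_continuous.
  apply: continuousB; last exact: cvg_cst.
  apply: continuous_comp; last exact: cf.
  by apply: continuousD; [exact: scalel_continuous|exact: cvg_cst].
have : \forall y \near h, `|diff_quotient f e h x - diff_quotient f e y x| < eta
    /\ (`|y| < k.+1%:R^-1 /\ y != 0).
  near=> y; split; last split.
  - by near: y; exact: (cvgrPdist_lt _ _).1.
  - by near: y; apply: (cvgr_lt `|h|) => //; exact: norm_continuous.
  - by near: y; exact: (cvgr_neq0 h).
move=> /nbhs_ballP[d /= d0 dB].
have [|y [yd [r _ ry]]] := @dense_rat R (ball h d) _ (ball_open _ _).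
  by exists h; exact: ballxx.
have [close [rk r0]] := dB y yd.
rewrite -ry in close rk r0.
apply: le_trans (ler_distD (diff_quotient f e (ratr r) x) _ _) _.
apply: lerD; first by rewrite fk// normr_gt0 r0.
by rewrite distrC ltW.
Unshelve. all: by end_near. Qed.

(** On the measurable set where the limit exists the derivative is a limit of
measurable quotients; elsewhere it is the constant default value of limits. *)
Lemma measurable_derive_lipschitz f e k :
  (forall x y, `|f x - f y| <= k * `|x - y|) ->
  measurable_fun setT ('D_e f : 'rV[R]_n -> R).
Proof.
move=> fk; have mf := measurable_lipschitz fk.
have cf := lipschitz_continuous fk.
have mq h := measurable_diff_quotient e h mf.
have mE : measurable [set x | derivable f x e].
  rewrite (_ : [set x | _] = \bigcap_(m : nat) \bigcup_(k : nat)
    \bigcap_(r : rat) \bigcap_(s : rat)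
    [set x | 0 < `|ratr r : R| < k.+1%:R^-1 ->
      0 < `|ratr s : R| < k.+1%:R^-1 ->
    `|diff_quotient f e (ratr r) x - diff_quotient f e (ratr s) x|
      <= m.+1%:R^-1]); last first.
    apply/seteqP; split => x /=.
      move=> /(derivable_cauchy_quotients _ _ cf) fx m _.
      by have [j fj] := fx m; exists j => // r _ s _; exact: fj.
    move=> H; apply/(derivable_cauchy_quotients _ _ cf) => m.
    have [j _ Hj] := H m I; exists j => r s; exact: (Hj r I s I).
  apply: bigcap_measurableType => // m _; apply: bigcup_measurable => j _.
  apply: bigcap_measurable_rat => r; apply: bigcap_measurable_rat => s.
  have [rj|rj] := boolP (0 < `|ratr r : R| < j.+1%:R^-1); last first.
    by rewrite (_ : [set x | _] = setT)//; apply/seteqP; split.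
  have [sj|sj] := boolP (0 < `|ratr s : R| < j.+1%:R^-1); last first.
    by rewrite (_ : [set x | _] = setT)//; apply/seteqP; split.
  rewrite (_ : [set x | _] = (fun x =>
    `|diff_quotient f e (ratr r) x - diff_quotient f e (ratr s) x|) @^-1`
     `]-oo, m.+1%:R^-1]%classic).
    rewrite -[X in measurable X]setTI.
    apply: (measurableT_comp (@normr_measurable R setT) (measurable_funB _ _)) => //.
  apply/seteqP; split => x /=; rewrite in_itv/=; first exact.
  by [].
pose c := point : R.
rewrite (_ : 'D_e f = fun x => if `[< derivable f x e >] then 'D_e f x else c).
  2: apply/funext => x; case: asboolP => // /dvgP dv; exact: dv.
apply: measurable_fun_if => //.
- apply: (@measurable_fun_bool _ _ _ _ true).
  rewrite setTI (_ : _ @^-1` _ = [set x | derivable f x e])//.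
  by apply/seteqP; split => x /= /asboolP.
- apply: (@measurable_fun_cvg _ _ _ _
    (fun N => diff_quotient f e (N.+1%:R^-1))).
    by move=> N; exact: measurable_funTS.
  move=> x [_ /= /asboolP dfx].
  have fl : diff_quotient f e h x @[h --> 0^'] --> 'D_e f x by exact: dfx.
  apply: ((cvgr_dnbhsP _ _ _).1 fl); split; last exact: cvg_harmonic.
  by move=> N; rewrite invr_neq0.
Qed.
End lipschitz_measurability.

(** * Increments in a fixed direction *)

Section shift_estimate.
Context (R : realType) (n : nat).
Implicit Types (f : 'rV[R]_n -> R) (e x y : 'rV[R]_n) (k : R).
Local Notation m := (borel_lebesgue_rV R n).

Lemma derive_line f e x (s : R) :
  'D_1 (fun s : R => f (s *: e + x)) s = 'D_e f (s *: e + x).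
Proof.
have E : (fun h : R => h^-1 *: (((fun u : R => f (u *: e + x)) \o shift s)
    (h *: (1 : R)) - f (s *: e + x))) =
    (fun h : R => h^-1 *: ((f \o shift (s *: e + x)) (h *: e) - f (s *: e + x))).
  by apply/funext => h /=; rewrite [h *: 1]mulr1 scalerDl addrA.
by rewrite /derive -E.
Qed.

Lemma measurable_line e : measurable_fun setT
  (fun z : 'rV[R]_n * measurableTypeR R => (z.2 : R) *: e + z.1 : 'rV[R]_n).
Proof.
apply: measurable_fun_rV => i.
rewrite (_ : _ \o _ = fun z => (z.2 : R) * e ord0 i + rV_coord i z.1).
  apply: measurable_funD.
    by apply: measurable_funM => //; exact: measurable_snd.
  by apply: measurableT_comp => //; exact: measurable_rV_coord.
by apply/funext => z; rewrite /rV_coord /= !mxE.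
Qed.

Lemma line_increment_le f e k (t : R) x : 0 < t ->
  (forall x y, `|f x - f y| <= k * `|x - y|) ->
  (`|f (t *: e + x) - f x|%:E <=
   \int[lebesgue_measure]_(s in `]0%R, t]) `|'D_e f (s *: e + x)|%:E)%E.
Proof.
move=> t0 fk.
have := @lipschitz_FTC R (fun s => f (s *: e + x)) (k * `|e|) 0 t t0.
rewrite scale0r add0r => H; apply: le_trans (H _ _) _.
- move=> u v; apply: le_trans (fk _ _) _.
  by rewrite opprD addrACA subrr addr0 -scalerBl normrZ mulrA mulrAC.
- rewrite (_ : (fun s => _) = 'D_e f \o (fun s => s *: e + x)); last first.
    by apply/funext => s; rewrite derive_line.
  apply: measurableT_comp; first exact: measurable_derive_lipschitz fk.
  exact: (measurableT_comp (measurable_line e) (measurable_pair1 x)).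
- by under eq_integral do rewrite derive_line.
Qed.

(** Integrate [line_increment_le] over [A] and exchange the integrals. For each s the
inner integral of |D_e f| is over the translate of [A] by s e, which lies in [B]. *)
Lemma shift_estimate f e k (t : R) (A B : set 'rV[R]_n) : 0 < t ->
  (forall x y, `|f x - f y| <= k * `|x - y|) ->
  measurable A -> measurable B ->
  (forall x s, A x -> 0 < s <= t -> B (s *: e + x)) ->
  (\int[m]_(x in A) `|f (t *: e + x) - f x|%:E <=
   t%:E * \int[m]_(x in B) `|'D_e f x|%:E)%E.
Proof.
move=> t0 fk mA mB AB.
have mD := measurable_derive_lipschitz e fk.
have mf := measurable_lipschitz fk.
pose I : set (measurableTypeR R) := `]0%R, t]%classic.
have mI : measurable I by exact: measurable_itv.
pose g (z : 'rV[R]_n * measurableTypeR R) : \bar R :=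
  (\1_A z.1 * (\1_I z.2 * `|'D_e f ((z.2 : R) *: e + z.1)|))%:E.
have mg : measurable_fun setT g.
  apply/measurable_EFinP; apply: measurable_funM.
    apply: (measurableT_comp (measurable_indic mA)); exact: measurable_fst.
  apply: measurable_funM.
    apply: (measurableT_comp (measurable_indic mI)); exact: measurable_snd.
  apply: measurableT_comp => //.
  exact: (measurableT_comp mD (measurable_line e)).
have g0 z : (0 <= g z)%E by rewrite lee_fin !mulr_ge0.
apply: (@le_trans _ _ (\int[m]_x \int[lebesgue_measure]_s g (x, s))%E).
  rewrite integral_mkcond; apply: ge0_le_integral => //.
  - by move=> x _; rewrite erestrict_ge0// => y _; rewrite lee_fin.
  - apply/(measurable_restrictT _ _).1 => //; apply/measurable_funTS.
    apply/measurable_EFinP; apply: measurableT_comp => //.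
    apply: measurable_funB => //.
    rewrite (_ : (fun x => f (t *: e + x)) = f \o (+%R^~ (t *: e))).
      by apply: measurableT_comp => //; exact: measurable_shift_rV.
    by apply/funext => x /=; rewrite addrC.
  - exact: measurable_fun_fubini_tonelli_F.
  move=> x _; rewrite patchE; case: ifPn => [xA|xA]; last exact: integral_ge0.
  apply: le_trans (line_increment_le e x t0 fk) _.
  rewrite integral_mkcond le_eqVlt; apply/orP; left; apply/eqP.
  apply: eq_integral => s _; rewrite /g patchE /= indicE xA mul1r.
  by rewrite indicE; case: ifPn => sI; rewrite ?mul1r// mul0r.
rewrite fubini_tonelli//.
set K := (\int[m]_(x in B) _)%E.
have K0 : (0 <= K)%E by apply: integral_ge0 => x _; rewrite lee_fin.
apply: (@le_trans _ _ (\int[lebesgue_measure]_s ((\1_I s)%:E * K))%E); last first.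
  rewrite ge0_integralZr//; last exact/measurable_EFinP/measurable_indic.
  rewrite integral_indic// setIT lee_wpmul2r//.
  have EI : lebesgue_measure (`]0%R, t]%classic : set R) = t%:E.
    by rewrite lebesgue_measure_itv/= lte_fin t0 -EFinB subr0.
  by rewrite [leLHS]EI.
apply: ge0_le_integral => //.
- by move=> s _; apply: integral_ge0.
- exact: measurable_fun_fubini_tonelli_G.
- by apply: emeasurable_funM => //; exact/measurable_EFinP/measurable_indic.
move=> s _; rewrite /g /= indicE; case: (boolP (s \in I)) => sI; last first.
  rewrite mul0e; under eq_integral do rewrite mul0r mulr0.
  by rewrite integral0.
rewrite mul1e /K [leRHS]integral_mkcond.
rewrite -[leRHS](@ge0_integral_shift_rV R n (s *: e)); last 2 first.
- apply/(measurable_restrictT _ _).1 => //; apply/measurable_funTS.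
  by apply/measurable_EFinP; exact: measurableT_comp.
- by move=> x; rewrite erestrict_ge0// => y _; rewrite lee_fin.
apply: ge0_le_integral => //.
- rewrite (_ : (fun x => _) = g \o (fun x => (x, s))).
    exact: (measurableT_comp mg (measurable_pair2 s)).
  by apply/funext => x; rewrite /g /= [\1_I s]indicE sI.
- apply: measurableT_comp; last exact: measurable_shift_rV.
  apply/(measurable_restrictT _ _).1 => //; apply/measurable_funTS.
  by apply/measurable_EFinP; exact: measurableT_comp.
move=> x _; rewrite indicE; case: (boolP (x \in A)) => xA; last first.
  by rewrite mul0r erestrict_ge0// => y _; rewrite lee_fin.
have xB : x + s *: e \in B.
  rewrite inE addrC; apply: AB; first by rewrite inE in xA.
  by move: sI; rewrite inE /I /= in_itv.
by rewrite patchE xB !mul1r [(x + _)%R]addrC.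
Qed.

End shift_estimate.

(** * Oscillation over dyadic cubes *)

Lemma fine_integral_additive d (T : measurableType d) (R : realType)
    (mu : {measure set T -> \bar R}) (I : eqType) (D : finType)
    (child : I -> D -> I) (K : I -> set T) (f : T -> R) :
  (forall Q, measurable (K Q)) ->
  (forall Q, K Q = \big[setU/set0]_(d <- enum D) K (child Q d)) ->
  (forall Q (X : set D), trivIset X (fun d => K (child Q d))) ->
  measurable_fun setT f ->
  (forall Q, \int[mu]_(x in K Q) (f x)%:E \is a fin_num)%E ->
  tree_additive child (fun Q => fine (\int[mu]_(x in K Q) (f x)%:E)).
Proof.
move=> mK KE tK mf ffin Q; rewrite [in LHS]KE integral_bigsetU_EFin//.
- by rewrite big_enum/= -sum_fine.
- exact: enum_uniq.
- exact/measurable_EFinP/measurable_funTS.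
Qed.

Section oscillation.
Context (R : realType) (n : nat).
Implicit Types (f : 'rV[R]_n -> R) (k : R) (Q : int * 'rV[int]_n).
Implicit Types (a b : {ffun 'I_n -> bool}).
Local Notation m := (borel_lebesgue_rV R n).
Local Notation side := (@dyadic_side R n).
Local Notation cube := (@dyadic_cube R n).

Lemma bounded_integrable_cube f Q (M : R) : measurable_fun setT f ->
  (forall x, cube Q x -> `|f x| <= M) -> m.-integrable (cube Q) (EFin \o f).
Proof.
move=> mf fM; apply: measurable_bounded_integrable.
- exact: measurable_dyadic_cube.
- by rewrite [ltLHS]borel_dyadic_cube ltry.
- exact: measurable_funTS.
- exists M; split; [exact: num_real|] => x Mx y /= Qy; exact: le_trans (fM _ Qy) (ltW Mx).
Qed.

Lemma lipschitz_cube_le f k Q x y :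
  (forall x y, `|f x - f y| <= k * `|x - y|) -> cube Q x -> cube Q y ->
  `|f x - f y| <= `|k| * side Q.
Proof.
move=> fk Qx Qy; apply: le_trans (fk _ _) _.
apply: (@le_trans _ _ (`|k| * `|x - y|)); first by rewrite ler_wpM2r ?ler_norm.
by rewrite ler_wpM2l// dyadic_cube_dist.
Qed.

Lemma lipschitz_integrable_cube f k Q :
  (forall x y, `|f x - f y| <= k * `|x - y|) ->
  m.-integrable (cube Q) (EFin \o f).
Proof.
move=> fk; apply: (@bounded_integrable_cube _ _
  (`|f (dyadic_corner R Q)| + `|k| * side Q)); first exact: measurable_lipschitz fk.
move=> x Qx; rewrite -[f x](subrK (f (dyadic_corner R Q))) addrC.
apply: le_trans (ler_normD _ _) _; rewrite lerD2l.
apply: (lipschitz_cube_le fk) => //; exact: dyadic_cube_corner.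
Qed.

Lemma integral_shift_rV (c : 'rV[R]_n) (F : 'rV[R]_n -> \bar R) :
  measurable_fun setT F ->
  (\int[m]_x F (x + c)%R = \int[m]_x F x)%E.
Proof.
move=> mF; rewrite integralE [RHS]integralE; congr (_ - _)%E.
- rewrite -[RHS](ge0_integral_shift_rV c (measurable_funepos mF) (funepos_ge0 F)).
  by apply: eq_integral => x _; rewrite !funeposE.
- rewrite -[RHS](ge0_integral_shift_rV c (measurable_funeneg mF) (funeneg_ge0 F)).
  by apply: eq_integral => x _; rewrite !funenegE.
Qed.

(** Children that differ in a single bit are translates of each other by half a
side. *)
Lemma dyadic_child_shift Q a b i x : ~~ a i -> b i ->
  (forall j, j != i -> a j = b j) ->
  cube (dyadic_child Q b) ((side Q / 2) *: delta_mx ord0 i + x) <->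
  cube (dyadic_child Q a) x.
Proof.
move=> ai bi ab.
have H j : (side (dyadic_child Q b) * ((dyadic_child Q b).2 ord0 j)%:~R <=
    ((side Q / 2) *: delta_mx ord0 i + x) ord0 j <
  side (dyadic_child Q b) * ((dyadic_child Q b).2 ord0 j + 1)%:~R) =
  (side (dyadic_child Q a) * ((dyadic_child Q a).2 ord0 j)%:~R <= x ord0 j <
  side (dyadic_child Q a) * ((dyadic_child Q a).2 ord0 j + 1)%:~R).
  rewrite !dyadic_side_child !intrD !dyadic_child_coordE mulr1z !mxE eqxx /=.
  have [->|ji] := eqVneq j i; last by rewrite mulr0 add0r ab.
  rewrite (negbTE ai) bi mulr1 mulr1n mulr0n.
  by congr (_ && _); [rewrite -[RHS](lerD2l (side Q / 2))|
    rewrite -[RHS](ltrD2l (side Q / 2))]; congr (_ _ _); ring.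
by split => Hx j; have := Hx j; rewrite H.
Qed.

Lemma child_flip_estimate f k Q a b i (G : R) :
  (forall x y, `|f x - f y| <= k * `|x - y|) ->
  (\int[m]_(x in cube Q) `|'D_(delta_mx ord0 i) f x|%:E <= G%:E)%E ->
  ~~ a i -> b i -> (forall j, j != i -> a j = b j) ->
  `|fine (\int[m]_(x in cube (dyadic_child Q b)) (f x)%:E)
    - fine (\int[m]_(x in cube (dyadic_child Q a)) (f x)%:E)|
  <= side Q / 2 * G.
Proof.
move=> fk DG ai bi ab.
set ca := cube (dyadic_child Q a); set cb := cube (dyadic_child Q b).
pose e : 'rV[R]_n := delta_mx ord0 i; set t := side Q / 2.
have t0 : 0 < t by rewrite divr_gt0// dyadic_side_gt0.
have mca : measurable ca by exact: measurable_dyadic_cube.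
have mcb : measurable cb by exact: measurable_dyadic_cube.
have mf := measurable_lipschitz fk.
have fint c : m.-integrable (cube c) (EFin \o f) by exact: lipschitz_integrable_cube fk.
have fshift x y : `|f (t *: e + x) - f (t *: e + y)| <= k * `|x - y|.
  by apply: le_trans (fk _ _) _; rewrite opprD addrACA subrr add0r.
have sint : m.-integrable ca (EFin \o (fun x => f (t *: e + x))).
  exact: lipschitz_integrable_cube fshift.
have -> : (\int[m]_(x in cb) (f x)%:E = \int[m]_(x in ca) (f (t *: e + x))%:E)%E.
  rewrite integral_mkcond [RHS]integral_mkcond.
  rewrite -(integral_shift_rV (t *: e)); last first.
    apply/(measurable_restrictT _ _).1 => //; apply/measurable_funTS.
    exact/measurable_EFinP.
  apply: eq_integral => x _; rewrite !patchE addrC.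
  suff -> : (t *: e + x \in cb) = (x \in ca) by [].
  by apply/idP/idP; rewrite !inE => /(dyadic_child_shift _ _ ai bi ab).
have Fa : (\int[m]_(x in ca) (f x)%:E \is a fin_num)%E.
  exact (integrable_fin_num mca (fint _)).
have Fs : (\int[m]_(x in ca) (f (t *: e + x)%R)%:E \is a fin_num)%E.
  exact (integrable_fin_num mca sint).
rewrite -fineB// -lee_fin -abse_EFin fineK; last first.
  by rewrite fin_numB; apply/andP; split.
rewrite -integralB_EFin//; last exact: fint.
apply: le_trans (le_abse_integral _ _ _) _ => //.
  apply/measurable_EFinP/measurable_funB; last exact: measurable_funTS.
  by apply: measurable_funTS; exact: measurable_lipschitz fshift.
rewrite EFinM; apply: (@le_trans _ _ (t%:E *
    \int[m]_(x in cube Q) `|'D_e f x|%:E)%E); last first.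
  by rewrite lee_wpmul2l// lee_fin ltW.
apply: (shift_estimate t0 fk) => //; first exact: measurable_dyadic_cube.
move=> x s cax /andP[s0 st] j.
have := cax j; have sQ0 := dyadic_side_gt0 R Q.
rewrite dyadic_side_child !intrD dyadic_child_coordE mulr1z !mxE eqxx /= -/t.
have -> : side Q = 2 * t by rewrite /t mulrC divfK.
have [->|ji] := eqVneq j i.
  rewrite (negbTE ai) mulr1 mulr0n => /andP[? ?].
  by apply/andP; split; lra.
rewrite mulr0 add0r; case: (a j); rewrite ?mulr1n ?mulr0n => /andP[? ?].
  by apply/andP; split; lra.
by apply/andP; split; lra.
Qed.

(** A path from [a] to [b] that changes one bit at a time. *)
Definition hybrid a b (j : nat) : {ffun 'I_n -> bool} :=
  [ffun i : 'I_n => if (i < j)%N then b i else a i].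

Lemma child_oscillation f k Q a b (G : R) : 0 <= G ->
  (forall x y, `|f x - f y| <= k * `|x - y|) ->
  (forall i, \int[m]_(x in cube Q) `|'D_(delta_mx ord0 i) f x|%:E <= G%:E)%E ->
  `|fine (\int[m]_(x in cube (dyadic_child Q b)) (f x)%:E)
    - fine (\int[m]_(x in cube (dyadic_child Q a)) (f x)%:E)|
  <= n%:R * (side Q / 2 * G).
Proof.
move=> G0 fk DG.
pose I c := fine (\int[m]_(x in cube (dyadic_child Q c)) (f x)%:E).
have t0 : 0 < side Q / 2 by rewrite divr_gt0// dyadic_side_gt0.
suff H j : (j <= n)%N -> `|I (hybrid a b j) - I a| <= j%:R * (side Q / 2 * G).
  have := H n (leqnn n); rewrite (_ : hybrid a b n = b)//.
  by apply/ffunP => i; rewrite ffunE ltn_ord.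
elim: j => [_|j IH jn].
  rewrite (_ : hybrid a b 0 = a) ?subrr ?normr0 ?mul0r//.
  by apply/ffunP => i; rewrite ffunE.
apply: le_trans (ler_distD (I (hybrid a b j)) _ _) _.
rewrite -natr1 mulrDl mul1r addrC lerD ?IH// 1?ltnW//.
pose i := Ordinal jn.
have hy c : c != i -> hybrid a b j c = hybrid a b j.+1 c.
  move=> ci; rewrite !ffunE [in RHS]ltnS [in RHS]leq_eqVlt.
  by case: eqP => // cj; case/eqP: ci; exact: val_inj.
have hji : hybrid a b j i = a i by rewrite ffunE ltnn.
have hSi : hybrid a b j.+1 i = b i by rewrite ffunE ltnSn.
have [abi|] := eqVneq (a i) (b i).
  have -> : hybrid a b j.+1 = hybrid a b j; last first.
    by rewrite subrr normr0 mulr_ge0// ltW.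
  apply/ffunP => c; have [->|ci] := eqVneq c i; first by rewrite hji hSi.
  by rewrite hy.
case ai : (a i); case bi : (b i) => // _.
  rewrite distrC; apply: (child_flip_estimate fk (DG i)).
  - by rewrite hSi bi.
  - by rewrite hji ai.
  - by move=> c ci; rewrite hy.
apply: (child_flip_estimate fk (DG i)).
- by rewrite hji ai.
- by rewrite hSi bi.
- exact: hy.
Qed.

(** Half a side for each of the at most n bits, times the 2^n children. *)
Definition poincare_const : R := n%:R * 2 ^+ n / 2.

(** The average over [Q] is the mean of the averages over its 2^n children, each of
which [child_oscillation] compares with that over the child [b]. *)
Lemma child_average_oscillation f k Q b (G : R) : 0 <= G ->
  (forall x y, `|f x - f y| <= k * `|x - y|) ->
  (forall i, \int[m]_(x in cube Q) `|'D_(delta_mx ord0 i) f x|%:E <= G%:E)%E ->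
  `|fine (\int[m]_(x in cube (dyadic_child Q b)) (f x)%:E)
       / side (dyadic_child Q b) ^+ n
    - fine (\int[m]_(x in cube Q) (f x)%:E) / side Q ^+ n|
  <= poincare_const * (side Q * (G / side Q ^+ n)).
Proof.
move=> G0 fk DG.
pose I c := fine (\int[m]_(x in cube c) (f x)%:E).
have fint c : m.-integrable (cube c) (EFin \o f) by exact: lipschitz_integrable_cube fk.
have Iadd : tree_additive (@dyadic_child n) I.
  apply: fine_integral_additive.
  - exact: measurable_dyadic_cube.
  - exact: dyadic_cube_bigsetU.
  - by move=> ? ?; exact: dyadic_cube_trivIset.
  - exact: measurable_lipschitz fk.
  - by move=> c; apply: integrable_fin_num => //; exact: measurable_dyadic_cube.
rewrite -/(I Q) -/(I (dyadic_child Q b)) dyadic_side_child.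
have V0 : 0 < side Q ^+ n by rewrite exprn_gt0// dyadic_side_gt0.
have -> : I (dyadic_child Q b) / (side Q / 2) ^+ n =
    (\sum_(a : {ffun 'I_n -> bool}) I (dyadic_child Q b)) / side Q ^+ n.
  rewrite sumr_const card_ffun card_bool card_ord expr_div_n invf_div.
  by rewrite -(mulr_natr _ (2 ^ n)%N) natrX mulrA mulrAC.
rewrite (Iadd Q) -mulrBl -sumrB normrM [`|(_ ^+ n)^-1|]gtr0_norm ?invr_gt0//.
rewrite mulrA [leRHS]mulrA ler_pM2r ?invr_gt0//.
apply: le_trans (ler_norm_sum _ _ _) _.
apply: (@le_trans _ _ (\sum_(a : {ffun 'I_n -> bool}) n%:R * (side Q / 2 * G))).
  by apply: ler_sum => a _; exact: child_oscillation fk DG.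
rewrite sumr_const card_ffun card_bool card_ord -(mulr_natr _ (2 ^ n)%N) natrX.
by rewrite /poincare_const le_eqVlt; apply/orP; left; apply/eqP; ring.
Qed.

Lemma poincare_const_ge0 : 0 <= poincare_const.
Proof. by rewrite /poincare_const !mulr_ge0// exprn_ge0. Qed.

(** Telescope the averages along the dyadic cubes that contain [x]. After [N] steps
the average over the remaining cube differs from f x by at most k times its
side. *)
Lemma pointwise_tree_bound f k (g : 'rV[R]_n -> R) N Q x :
  (forall x y, `|f x - f y| <= k * `|x - y|) ->
  (forall c, \int[m]_(x in cube c) (g x)%:E \is a fin_num)%E ->
  measurable_fun setT g ->
  (forall x i, `|'D_(delta_mx ord0 i) f x| <= g x) ->
  (forall x, 0 <= g x) ->
  cube Q x ->
  `|f x - fine (\int[m]_(x in cube Q) (f x)%:E) / side Q ^+ n| <=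
  poincare_const *
    \sum_(S <- tree (@dyadic_child n) N Q)
      side S * (fine (\int[m]_(x in cube S) (g x)%:E)%E / side S ^+ n) *
      (x \in cube S)%:R
  + `|k| * side Q / 2 ^+ N.
Proof.
move=> fk gfin mg Dg g0 Qx.
pose A c := fine (\int[m]_(x in cube c) (g x)%:E)%E / side c ^+ n.
have mf := measurable_lipschitz fk.
have A0 c : 0 <= A c.
  apply: divr_ge0; last by rewrite exprn_ge0// ltW// dyadic_side_gt0.
  by apply: fine_ge0; apply: integral_ge0 => y _; rewrite lee_fin.
elim: N Q Qx => [|N IH] Q Qx /=.
  rewrite big_nil mulr0 add0r expr0 divr1.
  have fint : m.-integrable (cube Q) (EFin \o f) by exact: lipschitz_integrable_cube fk.
  have V0 : 0 < side Q ^+ n by rewrite exprn_gt0// dyadic_side_gt0.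
  have mfx : measurable_fun setT (fun y => f x - f y) by apply: measurable_funB.
  have cint (c : R) : m.-integrable (cube Q) (EFin \o cst c).
    by apply: (@bounded_integrable_cube _ _ `|c|).
  have intc (c : R) : (\int[m]_(x in cube Q) (cst c x)%:E = (c * side Q ^+ n)%:E)%E.
    rewrite (integral_cst m (measurable_dyadic_cube Q) c%:E).
    by rewrite [X in (_ * X)%E]borel_dyadic_cube EFinM.
  have -> : f x = f x * side Q ^+ n / side Q ^+ n by rewrite mulfK// gt_eqF.
  rewrite -mulrBl normrM [`|(_ ^+ n)^-1|]gtr0_norm ?invr_gt0//.
  rewrite ler_pdivrMr// -lee_fin -abse_EFin EFinB fineK; last first.
    exact (integrable_fin_num (measurable_dyadic_cube _) fint).
  rewrite -intc -(integralB_EFin (measurable_dyadic_cube Q) (cint (f x)) fint).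
  apply: le_trans (le_abse_integral _ _ _) _.
  - exact: measurable_dyadic_cube.
  - exact/measurable_EFinP/measurable_funTS.
  rewrite -intc; apply: ge0_le_integral => //.
  - exact: measurable_dyadic_cube.
  - by apply: measurableT_comp => //; exact/measurable_EFinP/measurable_funTS.
  - by apply/measurable_EFinP; exact: measurable_cst.
  by move=> y Qy; rewrite /cst -EFinB lee_fin (lipschitz_cube_le fk).
have [d dx] := (dyadic_cube_child Q x).1 Qx.
apply: le_trans (ler_distD (fine (\int[m]_(x in cube (dyadic_child Q d)) (f x)%:E)
       / side (dyadic_child Q d) ^+ n) _ _) _.
have DG i : (\int[m]_(x in cube Q) `|'D_(delta_mx ord0 i) f x|%:E <=
    (fine (\int[m]_(x in cube Q) (g x)%:E))%:E)%E.
  rewrite fineK//; apply: ge0_le_integral => //.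
  - exact: measurable_dyadic_cube.
  - apply/measurable_EFinP; apply: measurableT_comp => //.
    by apply: measurable_funTS; exact: measurable_derive_lipschitz fk.
  - exact/measurable_EFinP/measurable_funTS.
  - by move=> y _; rewrite lee_fin.
have G0 : 0 <= fine (\int[m]_(x in cube Q) (g x)%:E)%E.
  by apply: fine_ge0; apply: integral_ge0 => y _; rewrite lee_fin.
have := child_average_oscillation d G0 fk DG.
have := IH _ dx.
rewrite dyadic_side_child big_cons sum_flatten_child mem_set// mulr1.
set S := \sum_(d : _) _.
have : \sum_(S <- tree (@dyadic_child n) N (dyadic_child Q d))
    side S * A S * (x \in cube S)%:R <= S.
  rewrite /S (bigD1 d)//= lerDl; apply: sumr_ge0 => c _.
  apply: sumr_ge0 => c' _; apply: mulr_ge0; last exact: ler0n.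
  by apply: mulr_ge0; [rewrite ltW// dyadic_side_gt0|exact: A0].
move=> /(ler_wpM2l poincare_const_ge0).
rewrite exprS invfM.
have -> : `|k| * (side Q / 2) / 2 ^+ N = `|k| * side Q * (2^-1 * (2 ^+ N)^-1) by ring.
lra.
Qed.

End oscillation.

(** * Discrete and continuous Hoelder inequalities *)

Section discrete_hoelder.
Context (R : realType) (I : eqType) (S : seq I) (a b : I -> R).
Variables (A B q p : R).
Hypotheses (A0 : 0 < A) (B0 : 0 < B) (q0 : 0 < q) (p0 : 0 < p).
Hypotheses (a0 : forall i, 0 <= a i) (b0 : forall i, 0 <= b i).
Hypothesis bB : \sum_(i <- S) b i `^ p <= B `^ p.

(** Hoelder's inequality: divide [a] by [A] and [b] by [B], then sum Young's
inequality. *)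
Lemma sum_product_le_conj s : 0 < s -> q^-1 = p^-1 + s^-1 ->
  \sum_(i <- S) a i `^ s <= A `^ s ->
  \sum_(i <- S) (a i * b i) `^ q <= (A * B) `^ q.
Proof.
move=> s0 qps aA.
have AB0 : 0 < (A * B) `^ q by rewrite powR_gt0 ?mulr_gt0.
rewrite -[leRHS]mul1r -ler_pdivrMr// mulr_suml.
apply: (@le_trans _ _ (\sum_(i <- S)
    (q / s * (a i `^ s / A `^ s) + q / p * (b i `^ p / B `^ p)))).
  apply: ler_sum => i _; rewrite !powR_divE ?mulr_ge0 ?mulr_gt0//.
  rewrite invfM mulrACA; apply: young_product => //; rewrite divr_ge0// ltW//.
rewrite big_split/= -!mulr_sumr -!mulr_suml.
have -> : 1 = q / s + q / p by rewrite -mulrDr addrC -qps mulfV// gt_eqF.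
apply: lerD; rewrite ler_piMr ?divr_ge0 ?(ltW q0) ?(ltW s0) ?(ltW p0)//.
  by rewrite ler_pdivrMr ?mul1r// powR_gt0.
by rewrite ler_pdivrMr ?mul1r// powR_gt0.
Qed.

(** An l^p norm with p <= q dominates the l^q norm: b_i <= B implies
b_i^q <= B^(q-p) b_i^p. *)
Lemma sum_product_le_sup : p <= q -> {in S, forall i, a i <= A} ->
  \sum_(i <- S) (a i * b i) `^ q <= (A * B) `^ q.
Proof.
move=> pq aA.
have bleB i : i \in S -> b i <= B.
  move=> iS; rewrite leNgt; apply/negP => Bb.
  have : B `^ p < b i `^ p by apply: gt0_ltr_powR; rewrite ?nnegrE ?(ltW B0).
  rewrite ltNge => /negP; apply; apply: le_trans bB.
  by rewrite (big_rem i)//= lerDl sumr_ge0// => j _; exact: powR_ge0.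
have split_exp (x : R) : x `^ q = x `^ (q - p) * x `^ p.
  by rewrite -powRD subrK// gt_eqF.
apply: (@le_trans _ _ (\sum_(i <- S) A `^ q * B `^ (q - p) * b i `^ p)).
  rewrite !big_seq; apply: ler_sum => i iS.
  rewrite powRM// (split_exp (b i)) mulrA ler_wpM2r ?powR_ge0//.
  apply: ler_pM; rewrite ?powR_ge0//.
    by apply: ge0_ler_powR; rewrite ?nnegrE ?(ltW A0) ?(ltW q0)// aA.
  by apply: ge0_ler_powR; rewrite ?nnegrE ?(ltW B0) ?subr_ge0// bleB.
rewrite -mulr_sumr powRM ?(ltW A0) ?(ltW B0)// (split_exp B) mulrA.
by rewrite ler_wpM2l// mulr_ge0 ?powR_ge0.
Qed.

Lemma sum_product_le_dual (c : I -> R) (C q' : R) : 0 < C -> 1 < q ->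
  q^-1 + q'^-1 = 1 -> (forall i, 0 <= c i) ->
  \sum_(i <- S) (a i * b i) `^ q <= (A * B) `^ q ->
  \sum_(i <- S) c i `^ q' <= C `^ q' ->
  \sum_(i <- S) a i * b i * c i <= A * B * C.
Proof.
move=> C0 q1 qq' c0 abq cC.
have q'0 : 0 < q'.
  have : q^-1 < 1 by rewrite invf_lt1.
  by rewrite -qq' ltrDl invr_gt0.
have AB0 : 0 < A * B by rewrite mulr_gt0.
rewrite -[leRHS]mul1r -ler_pdivrMr ?mulr_gt0// mulr_suml.
apply: (@le_trans _ _ (\sum_(i <- S)
    ((a i * b i) `^ q / (A * B) `^ q / q + c i `^ q' / C `^ q' / q'))).
  apply: ler_sum => i _; rewrite !powR_divE ?mulr_ge0//.
  rewrite invfM mulrACA; apply: conjugate_powR => //;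
    by rewrite divr_ge0 ?mulr_ge0// ltW.
rewrite big_split/= -!mulr_suml -qq'.
apply: lerD; rewrite ler_piMl ?invr_ge0 ?(ltW q0) ?(ltW q'0)//.
  by rewrite ler_pdivrMr ?mul1r// powR_gt0.
by rewrite ler_pdivrMr ?mul1r// powR_gt0.
Qed.

End discrete_hoelder.

Section hoelder_on_sets.
Context d (T : measurableType d) (R : realType) (mu : {measure set T -> \bar R}).

Lemma hoelder_set (K : set T) (X Y : T -> R) (a b : R) : measurable K ->
  measurable_fun setT X -> measurable_fun setT Y ->
  (forall x, 0 <= X x) -> (forall x, 0 <= Y x) ->
  0 < a -> 0 < b -> a^-1 + b^-1 = 1 ->
  (\int[mu]_(x in K) (X x * Y x)%:E <=
   (\int[mu]_(x in K) (X x `^ a)%:E) `^ a^-1 *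
   (\int[mu]_(x in K) (Y x `^ b)%:E) `^ b^-1)%E.
Proof.
move=> mK mX mY X0 Y0 a0 b0 ab.
have mX' : measurable_fun setT (X \_ K).
  by apply/(measurable_restrictT _ _).1 => //; exact: measurable_funTS.
have mY' : measurable_fun setT (Y \_ K).
  by apply/(measurable_restrictT _ _).1 => //; exact: measurable_funTS.
have LE (c : R) (Z : T -> R) : 0 < c -> (forall x, 0 <= Z x) ->
    ('N[mu]_c%:E[EFin \o (Z \_ K)] =
    (\int[mu]_(x in K) (Z x `^ c)%:E) `^ c^-1)%E.
  move=> c0 Z0; rewrite unlock /=; congr (_ `^ _)%E.
  rewrite [RHS]integral_mkcond; apply: eq_integral => x _.
  rewrite /= !patchE; case: ifPn => _.
    by rewrite ger0_norm.
  by rewrite normr0 powR0// gt_eqF.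
have := hoelder mu mX' mY' a0 b0 ab; rewrite !LE//; apply: le_trans.
rewrite Lnorm1 integral_mkcond le_eqVlt; apply/orP; left; apply/eqP.
apply: eq_integral => x _; rewrite /= !patchE; case: ifPn => _.
  by rewrite ger0_norm// mulr_ge0.
by rewrite mul0r normr0.
Qed.

End hoelder_on_sets.

(** * Weighted estimates for sums over stopping cubes *)

Section stopping_mass.
Context d (T : measurableType d) (R : realType) (mu : {measure set T -> \bar R}).
Context (I : eqType) (D : finType) (child : I -> D -> I) (K : I -> set T).
Variable V : I -> R.
Hypothesis mK : forall Q, measurable (K Q).
Hypothesis KE :
  forall Q, K Q = \big[setU/set0]_(d <- enum D) K (child Q d).
Hypothesis tK : forall Q (X : set D), trivIset X (fun d => K (child Q d)).
Hypotheses (V0 : forall Q, 0 < V Q) (muK : forall Q, mu (K Q) = (V Q)%:E).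
Implicit Types (g h : T -> R) (Q : I) (sigma tau : R).

Definition mass h Q : R := fine (\int[mu]_(x in K Q) (h x)%:E).

Lemma mass_ge0 h Q : (forall x, 0 <= h x) -> 0 <= mass h Q.
Proof.
by move=> h0; apply: fine_ge0; apply: integral_ge0 => x _; rewrite lee_fin.
Qed.

Lemma massE h Q : (\int[mu]_(x in K Q) (h x)%:E \is a fin_num)%E ->
  (mass h Q)%:E = (\int[mu]_(x in K Q) (h x)%:E)%E.
Proof. by move=> hfin; rewrite /mass fineK. Qed.

Lemma integral_cst_cube (c : R) Q :
  (\int[mu]_(x in K Q) (cst c x)%:E = (c * V Q)%:E)%E.
Proof. by rewrite (integral_cst mu (mK Q) c%:E) muK EFinM. Qed.

Lemma le_fin_num_integral h g Q : measurable_fun setT h -> measurable_fun setT g ->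
  (forall x, 0 <= h x) -> (forall x, h x <= g x) ->
  (\int[mu]_(x in K Q) (g x)%:E \is a fin_num)%E ->
  (\int[mu]_(x in K Q) (h x)%:E \is a fin_num)%E.
Proof.
move=> mh mg h0 hg gfin.
rewrite ge0_fin_numE; last by apply: integral_ge0 => x _; rewrite lee_fin.
apply: (@le_lt_trans _ _ (\int[mu]_(x in K Q) (g x)%:E)%E).
  apply: ge0_le_integral => //.
  - by move=> x _; rewrite lee_fin.
  - exact/measurable_EFinP/measurable_funTS.
  - exact/measurable_EFinP/measurable_funTS.
  - by move=> x _; rewrite lee_fin.
by rewrite -ge0_fin_numE//; apply: integral_ge0 => x _; rewrite lee_fin (le_trans (h0 x)).
Qed.

Lemma fin_num_integral_powR h sigma tau Q : measurable_fun setT h ->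
  (forall x, 0 <= h x) -> 0 < sigma -> sigma <= tau ->
  (\int[mu]_(x in K Q) (h x `^ tau)%:E \is a fin_num)%E ->
  (\int[mu]_(x in K Q) (h x `^ sigma)%:E \is a fin_num)%E.
Proof.
move=> mh h0 s0 st hfin.
apply: (@le_fin_num_integral _ (fun x => 1 + h x `^ tau)).
- exact: measurable_powR_fun.
- by apply: measurable_funD => //; exact: measurable_powR_fun.
- by move=> x; exact: powR_ge0.
- by move=> x; exact: powR_le_add1.
under eq_integral do rewrite EFinD.
rewrite ge0_integralD//.
- by rewrite fin_numD hfin andbT (integral_cst_cube 1).
- by move=> x _; rewrite lee_fin powR_ge0.
- exact/measurable_EFinP/measurable_funTS/measurable_powR_fun.
Qed.

Lemma mass_additive h : measurable_fun setT h ->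
  (forall Q, \int[mu]_(x in K Q) (h x)%:E \is a fin_num)%E ->
  tree_additive child (mass h).
Proof. exact: fine_integral_additive. Qed.

Lemma volume_additive : tree_additive child V.
Proof.
have VE : V = mass (cst 1).
  by apply/funext => Q; rewrite /mass integral_cst_cube mul1r.
rewrite VE; apply: mass_additive => // Q.
by rewrite integral_cst_cube.
Qed.

(** Jensen's inequality for the power tau/sigma: integrate the tangent inequality
for h^sigma at its mean [c]. *)
Lemma jensen_mass h sigma tau Q : measurable_fun setT h ->
  (forall x, 0 <= h x) -> 0 < sigma -> sigma < tau ->
  (\int[mu]_(x in K Q) (h x `^ tau)%:E \is a fin_num)%E ->
  V Q * (mass (fun x => h x `^ sigma) Q / V Q) `^ (tau / sigma) <=
  mass (fun x => h x `^ tau) Q.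
Proof.
move=> mh h0 s0 st hfin.
have sfin := fin_num_integral_powR mh h0 s0 (ltW st) hfin.
set t := tau / sigma; set c := _ / V Q.
have t1 : 1 < t by rewrite ltr_pdivlMr// mul1r.
have c0 : 0 <= c.
  by rewrite divr_ge0 ?(ltW (V0 Q))// mass_ge0// => x; exact: powR_ge0.
have tc0 : 0 <= t * c `^ (t - 1) by rewrite mulr_ge0 ?powR_ge0// (le_trans ler01)// ltW.
have tc1 : 0 <= (t - 1) * c `^ t by rewrite mulr_ge0 ?powR_ge0// subr_ge0 ltW.
have H : t * c `^ (t - 1) * mass (fun x => h x `^ sigma) Q <=
    mass (fun x => h x `^ tau) Q + (t - 1) * c `^ t * V Q.
  rewrite -lee_fin EFinD EFinM !massE//.
  rewrite -ge0_integralZl_EFin//; last 2 first.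
  - by move=> x _; rewrite lee_fin powR_ge0.
  - exact/measurable_EFinP/measurable_funTS/measurable_powR_fun.
  rewrite -integral_cst_cube -ge0_integralD//; last 3 first.
  - by move=> x _; rewrite lee_fin powR_ge0.
  - exact/measurable_EFinP/measurable_funTS/measurable_powR_fun.
  - by apply/measurable_EFinP; exact: measurable_cst.
  apply: ge0_le_integral => //.
  - by move=> x _; rewrite -EFinM lee_fin mulr_ge0 ?powR_ge0.
  - apply/measurable_EFinP/measurable_funM => //.
    exact/measurable_funTS/measurable_powR_fun.
  - apply/measurable_EFinP/measurable_funD => //.
    exact/measurable_funTS/measurable_powR_fun.
  move=> x _; rewrite -EFinM -EFinD lee_fin -lerBlDr.
  have -> : h x `^ tau = (h x `^ sigma) `^ t.
    by rewrite -powRrM /t mulrCA mulfV ?mulr1// gt_eqF.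
  by apply: tangent_powR => //; exact: powR_ge0.
have cE : mass (fun x => h x `^ sigma) Q = c * V Q by rewrite divfK// gt_eqF.
have tE : c `^ t = c * c `^ (t - 1) by rewrite mulr_powRB1// (lt_trans ltr01).
move: H; rewrite cE tE; lra.
Qed.

Variable g : T -> R.
Hypotheses (mg : measurable_fun setT g) (g0 : forall x, 0 <= g x).
Hypothesis gfin : forall Q, (\int[mu]_(x in K Q) (g x)%:E \is a fin_num)%E.

(** The threshold starts at 0, so a root is selected as soon as [g] has positive
integral over it. *)
Definition stopping_cubes N roots : seq I :=
  flatten [seq stopping child (fun Q => mass g Q / V Q) 0 N Q | Q <- roots].

Variables (roots : seq I).
Hypotheses (uroots : uniq roots) (troots : trivIset [set` roots] K).

(** Apply [carleson_embedding] to the integrals of h^sigma; by Jensen the integrals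
of h^tau can serve as the budget, and over disjoint roots they add up to at most
the full integral. *)
Lemma carleson_stopping_cubes h sigma tau N : measurable_fun setT h ->
  (forall x, 0 <= h x) -> 0 < sigma -> sigma < tau ->
  (\int[mu]_x (h x `^ tau)%:E \is a fin_num)%E ->
  ((\sum_(S <- stopping_cubes N roots)
    V S * (mass (fun x => h x `^ sigma) S / V S) `^ (tau / sigma))%:E <=
  (carleson_const (tau / sigma))%:E * \int[mu]_x (h x `^ tau)%:E)%E.
Proof.
move=> mh h0 s0 st hfin.
have hK Q : (\int[mu]_(x in K Q) (h x `^ tau)%:E \is a fin_num)%E.
  rewrite ge0_fin_numE; last by apply: integral_ge0 => x _; rewrite lee_fin powR_ge0.
  apply: (@le_lt_trans _ _ (\int[mu]_x (h x `^ tau)%:E)%E).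
    apply: ge0_subset_integral => //.
    - exact/measurable_EFinP/measurable_powR_fun.
    - by move=> x _; rewrite lee_fin powR_ge0.
  by rewrite -ge0_fin_numE//; apply: integral_ge0 => x _; rewrite lee_fin powR_ge0.
have t1 : 1 < tau / sigma by rewrite ltr_pdivlMr// mul1r.
have C0 := carleson_const_gt0 t1.
apply: (@le_trans _ _ ((carleson_const (tau / sigma))%:E *
   \sum_(Q <- roots) \int[mu]_(x in K Q) (h x `^ tau)%:E)%E).
  rewrite (eq_bigr (fun Q => (mass (fun x => h x `^ tau) Q)%:E)); last first.
    by move=> Q _; rewrite massE.
  rewrite sumEFin -EFinM lee_fin /stopping_cubes big_flatten big_map mulr_sumr.
  apply: ler_sum => Q _; apply: carleson_embedding => //.
  - exact: volume_additive.
  - by move=> S; exact: mass_ge0.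
  - exact: mass_additive.
  - by move=> S; apply: mass_ge0 => x; exact: powR_ge0.
  - apply: mass_additive; first exact: measurable_powR_fun.
    by move=> S; apply: fin_num_integral_powR (hK S) => //; exact: ltW.
  - by apply: mass_additive => //; exact: measurable_powR_fun.
  - by move=> S; exact: jensen_mass.
apply: lee_wpmul2l; first by rewrite lee_fin ltW.
have mh' : measurable_fun setT (EFin \o (fun x => h x `^ tau)).
  exact/measurable_EFinP/measurable_powR_fun.
rewrite -(@ge0_integral_bigsetU _ _ _ mu _ K) //.
- apply: ge0_subset_integral => //.
  + exact: bigsetU_measurable.
  + by move=> x _; rewrite lee_fin powR_ge0.
- exact: measurable_funTS.
- by move=> x _; rewrite lee_fin powR_ge0.
Qed.

Lemma hoelder_average (X Y : T -> R) (a b : R) Q :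
  measurable_fun setT X -> measurable_fun setT Y ->
  (forall x, 0 <= X x) -> (forall x, 0 <= Y x) ->
  0 < a -> 0 < b -> a^-1 + b^-1 = 1 ->
  (\int[mu]_(x in K Q) (X x `^ a)%:E \is a fin_num)%E ->
  (\int[mu]_(x in K Q) (Y x `^ b)%:E \is a fin_num)%E ->
  (\int[mu]_(x in K Q) (X x * Y x)%:E \is a fin_num)%E /\
  mass (fun x => X x * Y x) Q / V Q <=
  (mass (fun x => X x `^ a) Q / V Q) `^ a^-1 *
  (mass (fun x => Y x `^ b) Q / V Q) `^ b^-1.
Proof.
move=> mX mY X0 Y0 a0 b0 ab Xfin Yfin.
have := hoelder_set mu (mK Q) mX mY X0 Y0 a0 b0 ab.
rewrite -(fineK Xfin) -(fineK Yfin) !poweR_EFin -EFinM => H.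
have XY0 : (0 <= \int[mu]_(x in K Q) (X x * Y x)%:E)%E.
  by apply: integral_ge0 => x _; rewrite lee_fin mulr_ge0.
have XYfin : (\int[mu]_(x in K Q) (X x * Y x)%:E \is a fin_num)%E.
  by rewrite ge0_fin_numE// (le_lt_trans H)// ltry.
split; first exact: XYfin.
move: H; rewrite -(fineK XYfin) lee_fin => H.
apply: (normalize_hoelder (V0 Q) _ _ ab H).
- by apply: mass_ge0 => x; exact: powR_ge0.
- by apply: mass_ge0 => x; exact: powR_ge0.
Qed.

Section weights.
Variables (l : I -> R) (w v : T -> R) (p q r rt : R) (N : nat).
Hypothesis l0 : forall Q, 0 <= l Q.
Hypotheses (mw : measurable_fun setT w) (mv : measurable_fun setT v).
Hypotheses (w0 : forall x, 0 < w x) (v0 : forall x, 0 < v x).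
Hypotheses (p1 : 1 < p) (q0 : 0 < q) (r1 : 1 < r) (rt1 : 1 <= rt).
Let p' := conjugate_exponent p.
Let s := conjugate_exponent (p' * r).
Let cubes := stopping_cubes N roots.
Hypothesis wfin : forall Q, Q \in cubes ->
  (\int[mu]_(x in K Q) (w x `^ (- (p' * r)))%:E \is a fin_num)%E.
Hypothesis vfin : forall Q, Q \in cubes ->
  (\int[mu]_(x in K Q) (v x `^ (q * rt))%:E \is a fin_num)%E.
Let h x := w x * g x.
Hypothesis hfin : (\int[mu]_x (h x `^ p)%:E \is a fin_num)%E.

Definition power_average (u : T -> R) (e : R) Q := (mass u Q / V Q) `^ e^-1.

Let W Q := power_average (fun x => w x `^ (- (p' * r))) (p' * r) Q.
Let Y Q := power_average (fun x => v x `^ (q * rt)) (q * rt) Q.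

(** The factor a_S of the stopping cube S, equal to its term in the two-weight
constant. *)
Definition weight_coeff Q := l Q / V Q `^ (p^-1 - q^-1) * W Q * Y Q.

(** The factor b_S of the stopping cube S, formed with [s], the conjugate exponent of
p' r. *)
Definition energy_coeff Q := V Q `^ p^-1 * power_average (fun x => h x `^ s) s Q.

Definition stopping_sum x :=
  \sum_(Q <- cubes) l Q * (mass g Q / V Q) * \1_(K Q) x.

Let p'1 : 1 < p'. Proof. by have [] := conjugate_exponentP p1. Qed.

Let p'r1 : 1 < p' * r.
Proof. by rewrite (lt_trans p'1)// ltr_pMr// (lt_trans ltr01). Qed.

Let s1 : 1 < s. Proof. by have [] := conjugate_exponentP p'r1. Qed.

Let sp : s < p.
Proof. by rewrite -[ltRHS](conjugate_exponentK p1) conjugate_exponentM_lt. Qed.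

Let h0 x : 0 <= h x. Proof. by rewrite mulr_ge0// ltW. Qed.

Let mh : measurable_fun setT h. Proof. exact: measurable_funM. Qed.

Lemma fin_num_subset (f : T -> R) Q : measurable_fun setT f ->
  (forall x, 0 <= f x) -> (\int[mu]_x (f x)%:E \is a fin_num)%E ->
  (\int[mu]_(x in K Q) (f x)%:E \is a fin_num)%E.
Proof.
move=> mf f0 ffin.
rewrite ge0_fin_numE; last by apply: integral_ge0 => x _; rewrite lee_fin.
apply: (@le_lt_trans _ _ (\int[mu]_x (f x)%:E)%E).
  apply: ge0_subset_integral => //; first exact/measurable_EFinP.
  by move=> x _; rewrite lee_fin.
by rewrite -ge0_fin_numE//; apply: integral_ge0 => x _; rewrite lee_fin.
Qed.

Let mhp e : measurable_fun setT (fun x => h x `^ e).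
Proof. exact: measurable_powR_fun. Qed.

(** Hoelder with exponents p' r and [s] for g = w^-1 (w g). *)
Lemma average_g_le Q : Q \in cubes ->
  mass g Q / V Q <= W Q * power_average (fun x => h x `^ s) s Q.
Proof.
move=> Qc; have [_ E] := conjugate_exponentP p'r1.
have p'r0 : 0 < p' * r by rewrite (lt_trans ltr01).
have s0 : 0 < s by rewrite (lt_trans ltr01).
have gE : g = fun x => w x `^ (-1) * h x.
  apply/funext => x; rewrite /h powR_inv1 ?(ltW (w0 x))// mulrA mulVf ?mul1r//.
  by rewrite gt_eqF.
have wE : (fun x => (w x `^ (-1)) `^ (p' * r)) = fun x => w x `^ (- (p' * r)).
  by apply/funext => x; rewrite -powRrM mulN1r.
have := @hoelder_average (fun x => w x `^ (-1)) h _ _ Q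
  (measurable_powR_fun (-1) mw) mh (fun x => powR_ge0 _ _) h0 p'r0 s0 E.
have hfin' : (\int[mu]_(x in K Q) (h x `^ s)%:E)%E \is a fin_num.
  apply: (@fin_num_integral_powR _ s p) => //; first exact: ltW.
  by apply: fin_num_subset => // x; exact: powR_ge0.
have -> : (\int[mu]_(x in K Q) ((w x `^ (-1)) `^ (p' * r))%:E =
    \int[mu]_(x in K Q) (w x `^ (- (p' * r)))%:E)%E.
  by apply: eq_integral => x _; rewrite -powRrM mulN1r.
by move=> /(_ (wfin Qc) hfin')[_]; rewrite wE -gE.
Qed.

(** The power of the volume splits as 1/q = 1/p - (1/p - 1/q). *)
Lemma coeff_product_ge Q : Q \in cubes ->
  l Q * (mass g Q / V Q) * V Q `^ q^-1 * Y Q <= weight_coeff Q * energy_coeff Q.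
Proof.
move=> Qc.
have -> : weight_coeff Q * energy_coeff Q =
    l Q * (W Q * power_average (fun x => h x `^ s) s Q)
    * V Q `^ q^-1 * Y Q.
  have -> : V Q `^ q^-1 = V Q `^ p^-1 / V Q `^ (p^-1 - q^-1).
    by rewrite -powRN -powRD ?(gt_eqF (V0 Q)) ?implybT// opprB addrC subrK.
  by rewrite /weight_coeff /energy_coeff; ring.
rewrite ler_wpM2r ?powR_ge0// ler_wpM2r ?powR_ge0// ler_wpM2l//.
exact: average_g_le.
Qed.

(** The Carleson embedding for (w g)^s with exponent p/s > 1. *)
Lemma sum_energy_coeff_le (B : R) : 0 < B ->
  ((carleson_const (p / s))%:E * \int[mu]_x (h x `^ p)%:E <= (B `^ p)%:E)%E ->
  \sum_(Q <- cubes) energy_coeff Q `^ p <= B `^ p.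
Proof.
move=> B0 hB; rewrite -lee_fin; apply: le_trans hB.
have s0 : 0 < s by rewrite (lt_trans ltr01).
have pn0 : p != 0 by rewrite gt_eqF// (lt_trans ltr01).
apply: le_trans (carleson_stopping_cubes N mh h0 s0 sp hfin).
rewrite lee_fin le_eqVlt; apply/orP; left; apply/eqP; apply: eq_bigr => Q _.
rewrite /energy_coeff /power_average powRM ?powR_ge0// powRKV ?(ltW (V0 Q))//.
by rewrite -[in LHS]powRrM [s^-1 * _]mulrC.
Qed.

Lemma weight_coeff_ge0 Q : 0 <= weight_coeff Q.
Proof.
apply: mulr_ge0; last exact: powR_ge0.
apply: mulr_ge0; last exact: powR_ge0.
by apply: mulr_ge0; [exact: l0|rewrite invr_ge0 powR_ge0].
Qed.

Lemma energy_coeff_ge0 Q : 0 <= energy_coeff Q.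
Proof. by apply: mulr_ge0; exact: powR_ge0. Qed.

Let co Q := l Q * (mass g Q / V Q).

Let co0 Q : 0 <= co Q.
Proof. by rewrite mulr_ge0// divr_ge0 ?mass_ge0// ltW. Qed.

Lemma measurable_stopping_sum : measurable_fun setT stopping_sum.
Proof.
rewrite /stopping_sum; apply: measurable_sum => Q.
by apply: measurable_funM => //; exact: measurable_indic.
Qed.

Lemma stopping_sum_ge0 x : 0 <= stopping_sum x.
Proof. by apply: sumr_ge0 => Q _; rewrite mulr_ge0 ?co0. Qed.

Let mvstop : measurable_fun setT (fun x => v x * stopping_sum x).
Proof. by apply: measurable_funM => //; exact: measurable_stopping_sum. Qed.

Let vstop0 x : 0 <= v x * stopping_sum x.
Proof. by rewrite mulr_ge0 ?stopping_sum_ge0// ltW. Qed.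

Lemma fin_num_weight_power Q : Q \in cubes ->
  (\int[mu]_(x in K Q) (v x `^ q)%:E \is a fin_num)%E.
Proof.
move=> Qc; have qrt : q <= q * rt by rewrite ler_pMr.
exact: (fin_num_integral_powR mv (fun x => ltW (v0 x)) q0 qrt (vfin Qc)).
Qed.

Lemma integral_stopping_pieces :
  (\int[mu]_x (\sum_(Q <- cubes) (v x * (co Q * \1_(K Q) x)) `^ q)%:E =
   (\sum_(Q <- cubes) co Q `^ q * mass (fun x => v x `^ q) Q)%:E)%E.
Proof.
under eq_integral do rewrite -sumEFin.
rewrite ge0_integral_sum//; last 2 first.
- by move=> Q; apply/measurable_EFinP/measurable_powR_fun;
    apply: measurable_funM => //; apply: measurable_funM => //; exact: measurable_indic.
- by move=> Q x _; rewrite lee_fin powR_ge0.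
rewrite -sumEFin big_seq [RHS]big_seq; apply: eq_bigr => Q Qc.
rewrite EFinM massE; last exact: fin_num_weight_power.
rewrite -ge0_integralZl_EFin ?powR_ge0//; last 2 first.
- by move=> x _; rewrite lee_fin powR_ge0.
- exact/measurable_EFinP/measurable_funTS/measurable_powR_fun.
rewrite [RHS]integral_mkcond; apply: eq_integral => x _.
rewrite patchE indicE; case: ifPn => _; last by rewrite !mulr0 powR0 ?gt_eqF.
by rewrite mulr1 powRM ?(ltW (v0 x))// mulrC EFinM.
Qed.

(** For q <= 1 the power q of the sum is at most the sum of the powers, and for
rt = 1 the last factor of [weight_coeff] is the average of v^q to the power 1/q. *)
Lemma weighted_bound_le1 (C : R) : q <= 1 -> rt = 1 ->
  \sum_(Q <- cubes) (weight_coeff Q * energy_coeff Q) `^ q <= C ->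
  (\int[mu]_x ((v x * stopping_sum x) `^ q)%:E <= C%:E)%E.
Proof.
move=> q1 rtE abC.
apply: (@le_trans _ _
  (\int[mu]_x (\sum_(Q <- cubes) (v x * (co Q * \1_(K Q) x)) `^ q)%:E)%E).
  apply: ge0_le_integral => //.
  - by move=> x _; rewrite lee_fin powR_ge0.
  - exact/measurable_EFinP/measurable_powR_fun.
  - apply/measurable_EFinP; apply: measurable_sum => Q.
    by apply: measurable_powR_fun; apply: measurable_funM => //;
      apply: measurable_funM => //; exact: measurable_indic.
  move=> x _; rewrite lee_fin /stopping_sum mulr_sumr.
  apply: sum_powR_le => // Q.
  by apply: mulr_ge0; [exact: ltW|apply: mulr_ge0; first exact: co0].
rewrite integral_stopping_pieces lee_fin; apply: le_trans abC.
rewrite big_seq [leRHS]big_seq; apply: ler_sum => Q Qc.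
have -> : co Q `^ q * mass (fun x => v x `^ q) Q = (co Q * V Q `^ q^-1 * Y Q) `^ q.
  have vm0 : 0 <= mass (fun x => v x `^ q) Q by apply: mass_ge0 => x; exact: powR_ge0.
  have cV0 : 0 <= co Q * V Q `^ q^-1 by rewrite mulr_ge0 ?powR_ge0 ?co0.
  rewrite [RHS]powRM ?powR_ge0// [X in _ = X * _]powRM ?powR_ge0 ?co0//.
  rewrite powRKV ?(ltW (V0 Q)) ?gt_eqF//.
  rewrite /Y /power_average rtE mulr1 powRKV ?gt_eqF//; last first.
    by rewrite divr_ge0 ?(ltW (V0 Q)).
  have Vn0 : V Q != 0 by rewrite gt_eqF.
  by rewrite -mulrA [V Q * _]mulrC divfK.
apply: ge0_ler_powR; rewrite ?nnegrE ?(ltW q0)//.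
- by apply: mulr_ge0; [apply: mulr_ge0; [exact: co0|exact: powR_ge0]|exact: powR_ge0].
- by apply: mulr_ge0; [exact: weight_coeff_ge0|exact: energy_coeff_ge0].
- exact: coeff_product_ge.
Qed.

(** The duality argument for q > 1 divides by a power of this integral. *)
Lemma fin_num_weighted_stopping_sum :
  (\int[mu]_x ((v x * stopping_sum x) `^ q)%:E \is a fin_num)%E.
Proof.
have [C [C0 HC]] := sum_powR_le_const cubes q0.
rewrite ge0_fin_numE; last by apply: integral_ge0 => x _; rewrite lee_fin powR_ge0.
apply: (@le_lt_trans _ _ (\int[mu]_x
  (C%:E * (\sum_(Q <- cubes) (v x * (co Q * \1_(K Q) x)) `^ q)%:E))%E).
  apply: ge0_le_integral => //.
  - by move=> x _; rewrite lee_fin powR_ge0.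
  - exact/measurable_EFinP/measurable_powR_fun.
  - apply/measurable_EFinP; apply: measurable_funM => //; apply: measurable_sum => Q.
    by apply: measurable_powR_fun; apply: measurable_funM => //;
      apply: measurable_funM => //; exact: measurable_indic.
  move=> x _; rewrite -EFinM lee_fin /stopping_sum mulr_sumr; apply: HC => Q.
  by apply: mulr_ge0; [exact: ltW|apply: mulr_ge0; first exact: co0].
rewrite ge0_integralZl_EFin//; last 2 first.
- by move=> x _; rewrite lee_fin sumr_ge0// => Q _; exact: powR_ge0.
- apply/measurable_EFinP; apply: measurable_sum => Q.
  by apply: measurable_powR_fun; apply: measurable_funM => //;
    apply: measurable_funM => //; exact: measurable_indic.
by rewrite integral_stopping_pieces -EFinM ltry.
Qed.

(** With X the integral and psi = (v Phi)^(q-1), X is the sum over the cubes of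
l_S <g>_S times the integral of v psi over S. Hoelder on S turns each term into
a_S b_S c_S with c_S = |S|^(1/q') <psi^u>_S^(1/u), the Carleson embedding gives
sum c_S^q' <= C X, and discrete Hoelder yields X <= A B (C X)^(1/q'). *)
Lemma weighted_bound_gt1 (A B : R) : 1 < q -> 1 < rt -> 0 < A -> 0 < B ->
  \sum_(Q <- cubes) (weight_coeff Q * energy_coeff Q) `^ q <= (A * B) `^ q ->
  (\int[mu]_x ((v x * stopping_sum x) `^ q)%:E <=
   ((A * B) `^ q * carleson_const
     (conjugate_exponent q / conjugate_exponent (q * rt)) `^ (q - 1))%:E)%E.
Proof.
move=> q1 rt1' A0 B0 abAB.
set q' := conjugate_exponent q; set u := conjugate_exponent (q * rt).
have qrt1 : 1 < q * rt by rewrite (lt_trans q1)// ltr_pMr.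
have [q'1 qq'] := conjugate_exponentP q1; have [u1 qu] := conjugate_exponentP qrt1.
rewrite -/q' in q'1 qq'; rewrite -/u in u1 qu.
have u0 : 0 < u by rewrite (lt_trans ltr01).
have q'0 : 0 < q' by rewrite (lt_trans ltr01).
have qrt0 : 0 < q * rt by rewrite (lt_trans ltr01).
have uq' : u < q' by exact: conjugate_exponentM_lt.
have C0 : 0 < carleson_const (q' / u).
  by apply: carleson_const_gt0; rewrite ltr_pdivlMr// mul1r.
set C := carleson_const _ in C0 *.
have Xfin := fin_num_weighted_stopping_sum.
move: Xfin; move XE0 : (\int[mu]_x _)%E => X Xfin.
have X0 : 0 <= fine X.
  apply: fine_ge0; rewrite -XE0.
  by apply: integral_ge0 => x _; rewrite lee_fin powR_ge0.
rewrite -(fineK Xfin) lee_fin; move: X0; rewrite le_eqVlt => /predU1P[<-|X0].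
  by rewrite mulr_ge0 ?powR_ge0.
pose psi x := (v x * stopping_sum x) `^ (q - 1).
have mpsi : measurable_fun setT psi by exact: measurable_powR_fun.
have psi0 x : 0 <= psi x by exact: powR_ge0.
have qq1 : (q - 1) * q' = q.
  by rewrite /q' /conjugate_exponent mulrC divfK// gt_eqF// subr_gt0.
have psiq x : psi x `^ q' = (v x * stopping_sum x) `^ q.
  by rewrite /psi -powRrM qq1.
have XE : X = (\int[mu]_x (psi x `^ q')%:E)%E.
  by rewrite -XE0; apply: eq_integral => x _; rewrite psiq.
have psiq'fin : (\int[mu]_x (psi x `^ q')%:E \is a fin_num)%E by rewrite -XE.
pose c Q := V Q `^ q'^-1 * power_average (fun x => psi x `^ u) u Q.
have c0 Q : 0 <= c Q by rewrite mulr_ge0 ?powR_ge0.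
pose G := (C * fine X) `^ q'^-1.
have G0 : 0 < G by rewrite powR_gt0// mulr_gt0.
have cG : \sum_(Q <- cubes) c Q `^ q' <= G `^ q'.
  have CX0 : 0 <= C * fine X by exact: ltW (mulr_gt0 C0 X0).
  have q'n0 : q' != 0 by rewrite gt_eqF.
  rewrite /G (powRKV CX0 q'n0).
  rewrite -lee_fin EFinM (fineK Xfin) XE.
  apply: le_trans (carleson_stopping_cubes N mpsi psi0 u0 uq' psiq'fin).
  rewrite lee_fin le_eqVlt; apply/orP; left; apply/eqP; apply: eq_bigr => Q _.
  rewrite /c /power_average (powRM _ (powR_ge0 _ _) (powR_ge0 _ _)).
  rewrite (powRKV (ltW (V0 Q)) q'n0); congr (_ * _).
  by rewrite -powRrM [u^-1 * _]mulrC.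
have piece Q : Q \in cubes ->
    (\int[mu]_(x in K Q) (v x * psi x)%:E \is a fin_num)%E /\
    co Q * mass (fun x => v x * psi x) Q <= weight_coeff Q * energy_coeff Q * c Q.
  move=> Qc.
  have psiufin : (\int[mu]_(x in K Q) (psi x `^ u)%:E \is a fin_num)%E.
    apply: (fin_num_integral_powR mpsi psi0 u0 (ltW uq')).
    apply: (fin_num_subset Q (measurable_powR_fun q' mpsi) _ psiq'fin) => x.
    exact: powR_ge0.
  have [vpfin vple] := @hoelder_average v psi _ _ Q mv mpsi (fun x => ltW (v0 x))
    psi0 qrt0 u0 qu (vfin Qc) psiufin.
  split => //.
  have -> : mass (fun x => v x * psi x) Q =
      mass (fun x => v x * psi x) Q / V Q * V Q by rewrite divfK// gt_eqF.
  apply: (@le_trans _ _ (co Q * (Y Q * power_average (fun x => psi x `^ u) u Q * V Q))).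
    by rewrite ler_wpM2l ?co0// ler_wpM2r// ltW.
  have -> : co Q * (Y Q * power_average (fun x => psi x `^ u) u Q * V Q) =
      co Q * V Q `^ q^-1 * Y Q * c Q.
    have VE : V Q `^ q^-1 * V Q `^ q'^-1 = V Q.
      by rewrite -powRD qq' ?oner_eq0// powRr1// ltW.
    by rewrite -[in LHS]VE /c; ring.
  by rewrite ler_wpM2r// coeff_product_ge.
have Xle : fine X <= A * B * G.
  apply: le_trans (@sum_product_le_dual R I cubes weight_coeff energy_coeff
    A B q A0 B0 q0 weight_coeff_ge0 energy_coeff_ge0 c G q' G0 q1 qq' c0 abAB cG).
  have -> : fine X = \sum_(Q <- cubes) co Q * mass (fun x => v x * psi x) Q.
    apply: EFin_inj; rewrite -sumEFin (fineK Xfin).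
    have -> : X = (\int[mu]_x (\sum_(Q <- cubes)
        (co Q * (v x * psi x) * \1_(K Q) x))%:E)%E.
      rewrite -XE0; apply: eq_integral => x _; congr EFin.
      rewrite -mulr_powRB1// -/(psi x) /stopping_sum mulr_sumr mulr_suml.
      by apply: eq_bigr => Q _; rewrite /co; ring.
    under eq_integral do rewrite -sumEFin.
    rewrite ge0_integral_sum//; last 2 first.
    - move=> Q; apply/measurable_EFinP; apply: measurable_funM.
        by apply: measurable_funM => //; apply: measurable_funM.
      exact: measurable_indic.
    - move=> Q x _; rewrite lee_fin; apply: mulr_ge0 => //.
      apply: mulr_ge0; first exact: co0.
      by apply: mulr_ge0 => //; exact: ltW.
    rewrite big_seq [RHS]big_seq; apply: eq_bigr => Q Qc.
    have [vpfin _] := piece Q Qc.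
    rewrite EFinM massE// -ge0_integralZl_EFin//; last 2 first.
    - by move=> x _; rewrite lee_fin mulr_ge0// ltW.
    - by apply/measurable_EFinP/measurable_funTS; exact: measurable_funM.
    rewrite [RHS]integral_mkcond; apply: eq_integral => x _.
    rewrite patchE indicE; case: ifPn => _; last by rewrite mulr0.
    by rewrite mulr1 EFinM.
  rewrite big_seq [leRHS]big_seq; apply: ler_sum => Q Qc.
  by have [_] := piece Q Qc.
have AB0 : 0 < A * B by rewrite mulr_gt0.
have q'1E : q * q'^-1 = q - 1.
  have -> : q'^-1 = 1 - q^-1 by rewrite -qq' addrC addKr.
  by rewrite mulrBr mulr1 mulfV// gt_eqF.
have : (fine X) `^ q^-1 <= A * B * C `^ q'^-1.
  rewrite -(ler_pM2r (powR_gt0 q'^-1 X0)).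
  rewrite -[leLHS]powRD; last by rewrite qq' oner_eq0.
  rewrite qq' (powRr1 (ltW X0)).
  suff -> : A * B * C `^ q'^-1 * fine X `^ q'^-1 = A * B * G by exact: Xle.
  by rewrite /G (powRM _ (ltW C0) (ltW X0)) mulrA.
move=> Hq.
have -> : fine X = (fine X `^ q^-1) `^ q by rewrite powRKV ?(ltW X0)// gt_eqF.
have -> : (A * B) `^ q * C `^ (q - 1) = (A * B * C `^ q'^-1) `^ q.
  rewrite [RHS](powRM _ (ltW AB0) (powR_ge0 _ _)); congr (_ * _).
  by rewrite -powRrM [q'^-1 * _]mulrC q'1E.
by apply: ge0_ler_powR; rewrite ?nnegrE ?(ltW q0) ?powR_ge0 ?mulr_ge0 ?powR_ge0// ltW.
Qed.

End weights.
End stopping_mass.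

(** * Lebesgue and Borel integrals; the gradient *)

Section lebesgue_vs_borel.
Context (R : realType) (n : nat).
Local Notation mu := (lebesgue_rV R n).
Local Notation m := (borel_lebesgue_rV R n).

Lemma borel_lebesgue_measurable (A : set 'rV[R]_n) :
  measurable A -> measurable (A : set (lebesgue_rV_type R n)).
Proof. by move=> mA; apply: sub_caratheodory; apply: sub_sigma_algebra. Qed.

Lemma lebesgue_rV_borelE (A : set 'rV[R]_n) : measurable A -> mu A = m A.
Proof.
by move=> mA; rewrite /lebesgue_rV /= /completed_measure_extension measurable_mu_extE.
Qed.

(** The identity, read as a map from the Lebesgue to the Borel sigma-algebra: pushing
Lebesgue measure forward along it relates the two integrals. *)
Definition lebesgue_to_borel (x : lebesgue_rV_type R n) : 'rV[R]_n := x.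

Lemma measurable_lebesgue_to_borel : measurable_fun setT lebesgue_to_borel.
Proof. by move=> _ A mA; rewrite setTI; exact: borel_lebesgue_measurable. Qed.

Lemma borel_measurable_fun d (U : measurableType d) (f : 'rV[R]_n -> U) :
  measurable_fun setT f ->
  measurable_fun (setT : set (lebesgue_rV_type R n)) f.
Proof. by move=> mf; exact: (measurableT_comp mf measurable_lebesgue_to_borel). Qed.

Lemma ge0_integral_lebesgue_rV (A : set 'rV[R]_n) (F : 'rV[R]_n -> \bar R) :
  measurable A -> measurable_fun setT F -> (forall x, 0 <= F x)%E ->
  (\int[mu]_(x in A) F x = \int[m]_(x in A) F x)%E.
Proof.
move=> mA mF F0.
have := @ge0_integral_pushforward _ _ _ _ R _ measurable_lebesgue_to_borel mu A F mA
  (measurable_funTS mF) (fun y _ => F0 y).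
move=> <-; apply: eq_measure_integral; first exact: measurable_lebesgue_to_borel.
by move=> mF' B mB _; exact: lebesgue_rV_borelE.
Qed.

Lemma lebesgue_dyadic_cube Q :
  mu (@dyadic_cube R n Q) = (@dyadic_side R n Q ^+ n)%:E.
Proof.
by rewrite lebesgue_rV_borelE ?borel_dyadic_cube//; exact: measurable_dyadic_cube.
Qed.

Lemma dyadic_volumeE Q : @dyadic_volume R n Q = @dyadic_side R n Q ^+ n.
Proof. by rewrite /dyadic_volume lebesgue_dyadic_cube. Qed.

Lemma small_dyadicP Q : 0 <= Q.1 -> @small_dyadic R n Q.
Proof.
case: Q => j x /= j0; rewrite /small_dyadic /= dyadic_volumeE.
rewrite exprn_ile1//; first by rewrite ltW// dyadic_side_gt0.
rewrite /dyadic_side /=; case: j j0 => // j _.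
by rewrite -exprnN -exprVn exprn_ile1// invf_le1// ler1n.
Qed.

End lebesgue_vs_borel.

Section gradient.
Context (R : realType) (n : nat) (f : 'rV[R]_n -> R) (k : R).
Hypothesis fk : forall x y, `|f x - f y| <= k * `|x - y|.

(** Where the derivative does not exist its value is the default point, which
accounts for the last summand. *)
Lemma derive_lipschitz_bound e x : `|'D_e f x| <= `|k| * `|e| + `|point : R|.
Proof.
have [dfe|/dvgP] := pselect (derivable f x e); last first.
  by rewrite /derive => ->; rewrite lerDr mulr_ge0.
apply: (@le_trans _ _ (`|k| * `|e|)); last by rewrite lerDl.
have dq : diff_quotient f e h x @[h --> 0^'] --> 'D_e f x by exact: dfe.
apply: (cvgr_to_le (cvg_norm dq)).
near=> h; have h0 : h != 0 by near: h; exact: nbhs_dnbhs_neq.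
rewrite /diff_quotient normrZ normfV ler_pdivrMl ?normr_gt0//.
apply: le_trans (fk _ _) _; rewrite addrK normrZ [leRHS]mulrCA.
by apply: ler_wpM2r; [exact: mulr_ge0|exact: ler_norm].
Unshelve. all: by end_near. Qed.

Lemma coord_le_grad_norm i x : `|'D_(delta_mx ord0 i) f x| <= grad_norm f x.
Proof.
rewrite /grad_norm -sqrtr_sqr ler_wsqrtr// (bigD1 i)//= lerDl sumr_ge0// => j _.
exact: sqr_ge0.
Qed.

Lemma grad_norm_ge0 x : 0 <= grad_norm f x.
Proof. exact: sqrtr_ge0. Qed.

Lemma measurable_grad_norm : measurable_fun setT (grad_norm f).
Proof.
rewrite (_ : grad_norm f =
    fun x => (\sum_(i < n) ('D_(delta_mx ord0 i) f x) ^+ 2) `^ 2^-1); last first.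
  by apply/funext => x; rewrite powR12_sqrt// sumr_ge0// => i _; exact: sqr_ge0.
apply: (measurableT_comp (@measurable_powR R 2^-1)).
apply: measurable_sum => i; apply: measurable_funX.
exact: measurable_derive_lipschitz fk.
Qed.

End gradient.

(** * Almost everywhere positive weights *)

Section positive_version.
Context d (T : measurableType d) (R : realType) (mu : {measure set T -> \bar R}).

(** A weight is positive only almost everywhere. The value 1 on the exceptional null
set makes it positive everywhere and changes no integral. *)
Definition positive_version (w : T -> R) (x : T) : R := if 0 < w x then w x else 1.

Lemma positive_version_gt0 w x : 0 < positive_version w x.
Proof. by rewrite /positive_version; case: ifPn. Qed.

Lemma measurable_positive_version w : measurable_fun setT w ->
  measurable_fun setT (positive_version w).
Proof.
move=> mw; apply: measurable_fun_ifT => //.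
by apply: measurable_fun_ltr => //; exact: measurable_cst.
Qed.

Variable w : T -> R.
Hypotheses (mw : measurable_fun setT w) (w0 : {ae mu, forall x, 0 < w x}).

Let mw1 := measurable_positive_version mw.

Lemma integral_positive_version (A : set T) (e : R) : measurable A ->
  (\int[mu]_(x in A) (w x `^ e)%:E =
   \int[mu]_(x in A) (positive_version w x `^ e)%:E)%E.
Proof.
move=> mA; apply: ge0_ae_eq_integral mA _ _ _ _ _.
- exact/measurable_EFinP/measurable_funTS/measurable_powR_fun.
- exact/measurable_EFinP/measurable_funTS/measurable_powR_fun.
- by move=> x _; rewrite lee_fin powR_ge0.
- by move=> x _; rewrite lee_fin powR_ge0.
apply: (@filterS _ _ (ae_filter_ringOfSetsType _)) w0 => x wx _.
by rewrite /positive_version wx.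
Qed.

Lemma Lnorm_positive_version (F : T -> R) (p : R) : measurable_fun setT F ->
  'N[mu]_p%:E[EFin \o (fun x => w x * F x)%R]%E =
  'N[mu]_p%:E[EFin \o (fun x => positive_version w x * F x)%R]%E.
Proof.
move=> mF; rewrite unlock; congr (_ `^ _)%E.
apply: ge0_ae_eq_integral measurableT _ _ _ _ _.
- apply/measurable_EFinP; apply: measurable_powR_fun.
  by apply: measurableT_comp; [exact: normr_measurable|exact: measurable_funM].
- apply/measurable_EFinP; apply: measurable_powR_fun.
  by apply: measurableT_comp; [exact: normr_measurable|exact: measurable_funM].
- by move=> x _; exact: poweR_ge0.
- by move=> x _; exact: poweR_ge0.
apply: (@filterS _ _ (ae_filter_ringOfSetsType _)) w0 => x wx _.
by rewrite /= /positive_version wx.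
Qed.

Lemma integral_positive_gt0 (u : T -> R) (A : set T) : measurable A ->
  measurable_fun setT u ->
  (forall x, 0 < u x) -> (0 < mu A)%E -> (0 < \int[mu]_(x in A) (u x)%:E)%E.
Proof.
move=> mA mu' u0 A0.
rewrite lt0e integral_ge0 ?andbT; last by move=> x _; rewrite lee_fin ltW.
apply/eqP => int0.
have [+ _] := ae_eq_integral_abs mu mA
  ((measurable_EFinP A u).2 (measurable_funTS mu')).
have -> : (\int[mu]_(x in A) `|(EFin \o u) x| = 0)%E.
  by rewrite -[RHS]int0; apply: eq_integral => x _; rewrite /= ger0_norm// ltW.
move=> /(_ erefl)[N [mN N0 QN]].
have : (mu A <= mu N)%E.
  apply: le_measure; rewrite ?inE//.
  move=> x Qx; apply: QN => /= /(_ Qx)[ux].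
  by have := u0 x; rewrite ux ltxx.
by rewrite N0 leNgt A0.
Qed.

(** Each factor is positive, so an infinite average would make the product infinite.
This is how finiteness of the two-weight constant makes the integrals of the
weights over each single cube finite. *)
Lemma average_product_lty (c V a b : R) (i j : \bar R) :
  0 < c -> 0 < V -> 0 < a -> 0 < b -> (0 < i)%E -> (0 < j)%E ->
  (c%:E * ((V^-1)%:E * i) `^ a^-1 * ((V^-1)%:E * j) `^ b^-1 < +oo)%E ->
  [/\ i \is a fin_num, j \is a fin_num &
   (c%:E * ((V^-1)%:E * i) `^ a^-1 * ((V^-1)%:E * j) `^ b^-1)%E =
   (c * (fine i / V) `^ a^-1 * (fine j / V) `^ b^-1)%:E].
Proof.
move=> c0 V0 a0 b0.
have V'0 : (0 < V^-1%:E)%E by rewrite lte_fin invr_gt0.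
have av0 : a^-1 != 0 by rewrite invr_eq0 gt_eqF.
have bv0 : b^-1 != 0 by rewrite invr_eq0 gt_eqF.
case: i => [i| |]//; case: j => [j| |]//.
- rewrite !lte_fin => i0 j0 _; split => //.
  by rewrite -!EFinM /= ![V^-1 * _]mulrC.
- rewrite lte_fin => i0 _.
  rewrite -!EFinM (gt0_muley V'0) (poweRyr bv0).
  by rewrite gt0_muley// lte_fin mulr_gt0// powR_gt0// mulr_gt0// invr_gt0.
- rewrite lte_fin => _ j0.
  rewrite -!EFinM (gt0_muley V'0) (poweRyr av0).
  rewrite (@gt0_muley _ c%:E) ?lte_fin//.
  by rewrite gt0_mulye// lte_fin powR_gt0// mulr_gt0// invr_gt0.
- move=> _ _; rewrite (gt0_muley V'0) (poweRyr av0) (poweRyr bv0).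
  by rewrite (@gt0_muley _ c%:E) ?lte_fin.
Qed.

End positive_version.

(** * Letting the depth of the tree grow *)

(** The error c/2^N on [U] tends to zero in the norm weighted by [v], because v^q is
integrable over [U]. For q < 1 there is no triangle inequality; the factor 2 comes
from (x + y)^q <= 2^q (x^q + y^q). *)
Lemma approximation_limit d (T : measurableType d) (R : realType)
    (mu : {measure set T -> \bar R}) (f v : T -> R) (phi : nat -> T -> R)
    (U : set T) (q C1 c Z : R) :
  0 < q -> 0 <= C1 -> 0 <= c -> 0 <= Z ->
  measurable_fun setT f -> measurable_fun setT v ->
  (forall N, measurable_fun setT (phi N)) -> measurable U ->
  (forall x, 0 < v x) -> (forall N x, 0 <= phi N x) ->
  (forall N x, `|f x| <= C1 * phi N x + c / 2 ^+ N * \1_U x) ->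
  (\int[mu]_(x in U) (v x `^ q)%:E \is a fin_num)%E ->
  (forall N, \int[mu]_x ((v x * phi N x) `^ q)%:E <= Z%:E)%E ->
  (\int[mu]_x (`|v x * f x| `^ q)%:E <= ((2 * C1) `^ q * Z)%:E)%E.
Proof.
move=> q0 C10 c0 Z0 mf mv mphi mU v0 phi0 fle vU phiZ.
have q0' := ltW q0.
have mpow e (u : T -> R) : measurable_fun setT u ->
  measurable_fun setT (EFin \o (fun x => u x `^ e)).
  by move=> mu'; exact/measurable_EFinP/measurable_powR_fun.
pose M := fine (\int[mu]_(x in U) (v x `^ q)%:E)%E.
have M0 : 0 <= M.
  by apply: fine_ge0; apply: integral_ge0 => x _; rewrite lee_fin powR_ge0.
have bound N : (\int[mu]_x (`|v x * f x| `^ q)%:E <=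
    ((2 * C1) `^ q * Z + 2 `^ q * (c / 2 ^+ N) `^ q * M)%:E)%E.
  have cN0 : 0 <= c / 2 ^+ N by rewrite divr_ge0// exprn_ge0.
  apply: (@le_trans _ _ (\int[mu]_x (((2 * C1) `^ q)%:E * ((v x * phi N x) `^ q)%:E +
      (2 `^ q * (c / 2 ^+ N) `^ q)%:E * (v x `^ q * \1_U x)%:E))%E).
    have m1 : measurable_fun setT (fun x => v x * phi N x).
      by apply: measurable_funM => //; exact: mphi.
    have m2 : measurable_fun setT (fun x => v x `^ q * \1_U x).
      by apply: measurable_funM; [exact: measurable_powR_fun|exact: measurable_indic].
    apply: ge0_le_integral; first exact: measurableT.
    - by move=> x _; rewrite lee_fin powR_ge0.
    - apply: mpow; apply: measurableT_comp; first exact: normr_measurable.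
      exact: measurable_funM.
    - apply: emeasurable_funD.
        by apply: emeasurable_funM; [exact: measurable_cst|exact: mpow].
      by apply: emeasurable_funM; [exact: measurable_cst|exact/measurable_EFinP].
    move=> x _; rewrite -!EFinM -EFinD lee_fin normrM (gtr0_norm (v0 x)).
    apply: (@le_trans _ _ ((C1 * (v x * phi N x) + c / 2 ^+ N * (v x * \1_U x)) `^ q)).
      apply: ge0_ler_powR; rewrite ?nnegrE//.
      + by rewrite mulr_ge0// ltW.
      + apply: addr_ge0; apply: mulr_ge0 => //; apply: mulr_ge0 => //; exact: ltW.
      + have := fle N x; rewrite -(ler_pM2l (v0 x)); lra.
    apply: le_trans (powRD_le_double q0 _ _) _.
    - by apply: mulr_ge0 => //; apply: mulr_ge0 => //; exact: ltW.
    - by apply: mulr_ge0 => //; apply: mulr_ge0 => //; exact: ltW.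
    have vphi0 : 0 <= v x * phi N x by apply: mulr_ge0 => //; exact: ltW.
    have v1 : 0 <= v x * \1_U x by apply: mulr_ge0 => //; exact: ltW.
    rewrite (powRM _ C10 vphi0) (powRM _ cN0 v1).
    rewrite (powRM _ _ C10)// mulrDr !mulrA lerD2l -[leRHS]mulrA ler_wpM2l//.
      by rewrite mulr_ge0 ?powR_ge0.
    rewrite (powRM _ (ltW (v0 x)))// ler_wpM2l ?powR_ge0//.
    by rewrite indicE; case: (x \in U); rewrite ?powR1// powR0 ?gt_eqF.
  rewrite ge0_integralD//; last 4 first.
  - by move=> x _; rewrite -EFinM lee_fin mulr_ge0 ?powR_ge0.
  - apply: emeasurable_funM; first exact: measurable_cst.
    by apply: mpow; apply: measurable_funM => //; exact: mphi.
  - by move=> x _; rewrite -EFinM lee_fin !mulr_ge0 ?powR_ge0.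
  - apply: emeasurable_funM; first exact: measurable_cst.
    apply/measurable_EFinP/measurable_funM; last exact: measurable_indic.
    exact: measurable_powR_fun.
  rewrite EFinD; apply: leeD.
    rewrite ge0_integralZl_EFin ?powR_ge0//; last 2 first.
    - by move=> x _; rewrite lee_fin powR_ge0.
    - by apply: mpow; apply: measurable_funM => //; exact: mphi.
    by rewrite EFinM lee_wpmul2l ?phiZ// lee_fin powR_ge0.
  rewrite ge0_integralZl_EFin//; last 3 first.
  - by move=> x _; rewrite lee_fin !mulr_ge0 ?powR_ge0.
  - apply/measurable_EFinP/measurable_funM; last exact: measurable_indic.
    exact: measurable_powR_fun.
  - by rewrite mulr_ge0 ?powR_ge0.
  rewrite [leRHS]EFinM /M fineK//.
  rewrite lee_wpmul2l ?lee_fin ?mulr_ge0 ?powR_ge0//.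
  rewrite [leRHS]integral_mkcond le_eqVlt; apply/orP; left; apply/eqP.
  apply: eq_integral => x _; rewrite patchE indicE.
  by case: ifP => _; rewrite ?mulr1// mulr0.
apply/lee_addgt0Pr => eps eps0.
(* The + 1 keeps the denominator positive when M = 0. *)
pose dl := (eps / (2 `^ q * M + 1)) `^ q^-1.
have D0 : 0 < 2 `^ q * M + 1 by rewrite ltr_wpDl// mulr_ge0// powR_ge0.
have dl0 : 0 < dl by rewrite powR_gt0// divr_gt0.
have [N cN] : exists N : nat, c / 2 ^+ N <= dl.
  have : (fun N => c * (2^-1 : R) ^+ N) @ \oo --> c * 0.
    apply: cvgMr; apply: cvg_expr; rewrite ger0_norm ?invr_ge0//.
    by rewrite invf_lt1// ltr1n.
  rewrite mulr0 => /cvgrPdist_le /(_ dl dl0)[N _ HN]; exists N.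
  have := HN N (leqnn N); rewrite sub0r normrN -exprVn; apply: le_trans.
  exact: ler_norm.
apply: le_trans (bound N) _; rewrite EFinD leeD2l// lee_fin.
apply: (@le_trans _ _ (2 `^ q * dl `^ q * M)).
  rewrite ler_wpM2r// ler_wpM2l ?powR_ge0//.
  by apply: ge0_ler_powR; rewrite ?nnegrE ?(ltW dl0)// divr_ge0// exprn_ge0.
rewrite /dl powRKV ?gt_eqF//; last by rewrite ltW// divr_gt0.
set D := 2 `^ q * M + 1 in D0 *.
have -> : 2 `^ q * (eps / D) * M = eps * ((2 `^ q * M) / D) by ring.
rewrite ler_piMr ?(ltW eps0)// ler_pdivrMr// mul1r /D; lra.
Qed.

(** * Dyadic forests over unit cubes *)

Section dyadic_trees.
Context (R : realType) (n : nat).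
Implicit Types Q S : int * 'rV[int]_n.
Local Notation tree := (tree (@dyadic_child n)).
Local Notation cube := (@dyadic_cube R n).

Lemma tree_subset N Q S : S \in tree N Q -> Q.1 <= S.1 /\ cube S `<=` cube Q.
Proof.
elim: N Q => [//|N IH] Q /=; rewrite inE => /predU1P[->|].
  by split.
move=> /flattenP[_ /mapP[d _ ->]] /IH[le1 sub]; split.
  by apply: le_trans le1; rewrite /= lerDl.
by apply: subset_trans sub _ => x xd; apply/dyadic_cube_child; exists d.
Qed.

(** A descendant has a higher level than its ancestor, and the subtrees of distinct
children share no cube, since every cube contains its corner. *)
Lemma tree_uniq N Q : uniq (tree N Q).
Proof.
elim: N Q => [//|N IH] Q /=; apply/andP; split.
  apply/negP => /flattenP[_ /mapP[d _ ->]] /tree_subset[+ _] /=.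
  by rewrite -subr_ge0 opprD addrA subrr add0r.
apply: uniq_flatten_map => //; first exact: enum_uniq.
move=> d d' S _ _ /tree_subset[_ Sd] /tree_subset[_ Sd'].
have Sc := dyadic_cube_corner R S.
apply: (@dyadic_child_inj n Q).
exact: dyadic_cube_disjoint (Sd _ Sc) (Sd' _ Sc).
Qed.

Lemma tree_forest_uniq N (roots : seq (int * 'rV[int]_n)) : uniq roots ->
  {in roots, forall Q, Q.1 = 0} -> uniq (flatten [seq tree N Q | Q <- roots]).
Proof.
move=> ur r0; apply: uniq_flatten_map => // [Q _|]; first exact: tree_uniq.
move=> Q Q' S rQ rQ' /tree_subset[_ SQ] /tree_subset[_ SQ'].
have Sc := dyadic_cube_corner R S.
by apply: dyadic_cube_disjoint (SQ _ Sc) (SQ' _ Sc); rewrite !r0.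
Qed.

(** The cubes m + [0,1)^n whose coordinates m_i range from -M to M. *)
Definition unit_cubes (M : nat) : seq (int * 'rV[int]_n) :=
  [seq (0%Z, \row_i ((e i : nat)%:Z - M%:Z)) |
    e : {ffun 'I_n -> 'I_(2 * M).+1} <- enum {ffun 'I_n -> 'I_(2 * M).+1}].

Lemma unit_cubes_uniq M : uniq (unit_cubes M).
Proof.
rewrite map_inj_uniq ?enum_uniq// => e e' [] /rowP ee'.
apply/ffunP => i; apply/val_inj; have := ee' i; rewrite !mxE => /addIr[].
by [].
Qed.

Lemma unit_cubes_level M : {in unit_cubes M, forall Q, Q.1 = 0}.
Proof. by move=> Q /mapP[e _ ->]. Qed.

Lemma unit_cubes_cover M (x : 'rV[R]_n) : `|x| < M%:R ->
  dyadic_index 0 x \in unit_cubes M.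
Proof.
move=> xM; apply/mapP.
have fl i : exists e : 'I_(2 * M).+1, Num.floor (x ord0 i) == (e : nat)%:Z - M%:Z.
  have : `|x ord0 i| < M%:R by apply: le_lt_trans xM; exact: coord_norm_le.
  rewrite ltr_norml => /andP[Mx xM'].
  have f1 : - M%:Z <= Num.floor (x ord0 i).
    by rewrite real_floor_ge_int ?num_real// mulrNz; exact: ltW.
  have f2 : Num.floor (x ord0 i) < M%:Z by rewrite real_floor_lt_int ?num_real.
  have e0 : 0 <= Num.floor (x ord0 i) + M%:Z by rewrite -lerBlDr sub0r.
  have e1 : (absz (Num.floor (x ord0 i) + M%:Z)%R < (2 * M).+1)%N.
    rewrite -ltz_nat gez0_abs//; lia.
  exists (Ordinal e1); apply/eqP => /=; rewrite gez0_abs//; lia.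
exists [ffun i => xchoose (fl i)]; first by rewrite mem_enum.
rewrite /dyadic_index; congr pair; apply/rowP => i; rewrite !mxE ffunE.
by rewrite oppr0 expr0z divr1; exact: (eqP (xchooseP (fl i))).
Qed.

End dyadic_trees.

Section lebesgue_cubes.
Context (R : realType) (n : nat).
Local Notation mu := (lebesgue_rV R n).
Local Notation T := (lebesgue_rV_type R n).
Implicit Types Q S : int * 'rV[int]_n.

Definition lebesgue_cube Q : set T := @dyadic_cube R n Q.
Definition cube_volume Q : R := @dyadic_side R n Q ^+ n.

Lemma measurable_lebesgue_cube Q : measurable (lebesgue_cube Q).
Proof. by apply: borel_lebesgue_measurable; exact: measurable_dyadic_cube. Qed.

Lemma lebesgue_cube_bigsetU Q : lebesgue_cube Q =
  \big[setU/set0]_(d <- enum {ffun 'I_n -> bool}) lebesgue_cube (dyadic_child Q d).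
Proof. exact: dyadic_cube_bigsetU. Qed.

Lemma lebesgue_cube_trivIset Q (D : set {ffun 'I_n -> bool}) :
  trivIset D (fun d => lebesgue_cube (dyadic_child Q d)).
Proof. exact: dyadic_cube_trivIset. Qed.

Lemma cube_volume_gt0 Q : 0 < cube_volume Q.
Proof. by rewrite exprn_gt0// dyadic_side_gt0. Qed.

Lemma lebesgue_cube_volume Q : mu (lebesgue_cube Q) = (cube_volume Q)%:E.
Proof. exact: lebesgue_dyadic_cube. Qed.

Section Aloc.
Variables (w v : 'rV[R]_n -> R) (p q r rt : R).
Hypotheses (mw : measurable_fun (setT : set T) w).
Hypotheses (mv : measurable_fun (setT : set T) v).
Hypotheses (w0 : forall x, 0 < w x) (v0 : forall x, 0 < v x).
Hypotheses (p1 : 1 < p) (q0 : 0 < q) (r1 : 1 < r) (rt1 : 1 <= rt).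

Definition cube_weight_coeff Q : R :=
  weight_coeff mu lebesgue_cube cube_volume (@dyadic_side R n) w v p q r rt Q.

Lemma Aloc_term_lty Q : (Aloc_term p q r rt w v Q < +oo)%E ->
  [/\ (\int[mu]_(x in lebesgue_cube Q)
         (w x `^ (- (conjugate_exponent p * r)))%:E \is a fin_num)%E,
      (\int[mu]_(x in lebesgue_cube Q) (v x `^ (q * rt))%:E \is a fin_num)%E &
      Aloc_term p q r rt w v Q = (cube_weight_coeff Q)%:E].
Proof.
have P0 : 0 < conjugate_exponent p * r.
  rewrite mulr_gt0 ?(lt_trans ltr01 r1)// /conjugate_exponent divr_gt0 ?subr_gt0//.
  exact: lt_trans ltr01 p1.
have c0 : 0 < @dyadic_side R n Q / cube_volume Q `^ (p^-1 - q^-1).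
  by rewrite divr_gt0 ?dyadic_side_gt0// powR_gt0// cube_volume_gt0.
have qrt0 : 0 < q * rt by rewrite mulr_gt0// (lt_le_trans ltr01).
have muQ : (0 < mu (lebesgue_cube Q))%E.
  by rewrite lebesgue_cube_volume lte_fin cube_volume_gt0.
have I0 (u : T -> R) (e : R) : measurable_fun setT u -> (forall x, 0 < u x) ->
    (0 < \int[mu]_(x in lebesgue_cube Q) (u x `^ e)%:E)%E.
  move=> mu' u0; apply: integral_positive_gt0 => //.
  - exact: measurable_lebesgue_cube.
  - exact: measurable_powR_fun.
  - by move=> x; exact: powR_gt0.
have := @average_product_lty R _ _ _ _ _ _ c0 (cube_volume_gt0 Q) P0 qrt0
  (I0 w (- (conjugate_exponent p * r)) mw w0) (I0 v (q * rt) mv v0).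
rewrite /Aloc_term /dyadic_average dyadic_volumeE; exact.
Qed.

End Aloc.
End lebesgue_cubes.

(** * The two-weight constant *)

Section Aloc_constant.
Context (R : realType) (n : nat).
Local Notation mu := (lebesgue_rV R n).
Local Notation T := (lebesgue_rV_type R n).
Variables (w v : 'rV[R]_n -> R) (p q r rt : R).
Hypotheses (mw : measurable_fun (setT : set T) w).
Hypotheses (mv : measurable_fun (setT : set T) v).
Hypotheses (w0 : forall x, 0 < w x) (v0 : forall x, 0 < v x).
Hypotheses (p1 : 1 < p) (q0 : 0 < q) (r1 : 1 < r) (rt1 : 1 <= rt).
Local Notation term := (Aloc_term p q r rt w v).
Implicit Types (Q : int * 'rV[int]_n) (S : seq (int * 'rV[int]_n)).

Lemma Aloc_term_ge0 Q : (0 <= term Q)%E.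
Proof.
apply: mule_ge0; last exact: poweR_ge0.
apply: mule_ge0; last exact: poweR_ge0.
by rewrite lee_fin divr_ge0 ?powR_ge0// ltW// dyadic_side_gt0.
Qed.

Lemma Aloc_term_gt0 Q : (0 < term Q)%E.
Proof.
rewrite lt0e Aloc_term_ge0 andbT.
have pos (u : T -> R) (e e' : R) : measurable_fun setT u -> (forall x, 0 < u x) ->
    (dyadic_average Q (fun x => (u x `^ e)%R) `^ e' != 0)%E.
  move=> mu' u0; have : (0 < dyadic_average Q (fun x => (u x `^ e)%R))%E.
    rewrite /dyadic_average dyadic_volumeE mule_gt0//.
      by rewrite lte_fin invr_gt0 exprn_gt0// dyadic_side_gt0.
    apply: (@integral_positive_gt0 _ _ _ mu (fun x => u x `^ e) (lebesgue_cube Q)).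
    - exact: measurable_lebesgue_cube.
    - exact: measurable_powR_fun.
    - by move=> x; exact: powR_gt0.
    - by rewrite lebesgue_cube_volume lte_fin cube_volume_gt0.
  by move=> av0; rewrite gt_eqF// poweR_gt0.
rewrite /Aloc_term !mule_eq0 !negb_or.
rewrite (pos w)// (pos v)// !andbT eqe gt_eqF// divr_gt0 ?dyadic_side_gt0//.
by rewrite powR_gt0// dyadic_volumeE exprn_gt0// dyadic_side_gt0.
Qed.

Lemma Aloc_term_le_sup Q : 0 <= Q.1 ->
  (term Q <= Aloc_const p q r rt +oo%E w v)%E.
Proof. by move=> Q0; apply: ereal_sup_ubound; exists Q => //; exact: small_dyadicP. Qed.

Lemma sum_Aloc_term_le s S : 0 < s -> uniq S -> {in S, forall Q, 0 <= Q.1} ->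
  (\sum_(Q <- S) term Q `^ s <= Aloc_const p q r rt s%:E w v `^ s)%E.
Proof.
move=> s0 uS S0; rewrite /Aloc_const.
set E := (\esum_(Q in _) _)%E.
have E0 : (0 <= E)%E by apply: esum_ge0 => Q _; exact: poweR_ge0.
rewrite -poweRrM mulVf ?gt_eqF// poweRe1//.
apply: esum_ge; exists [set` S]; last by rewrite fsbig_seq.
split; first exact: finite_seq.
by move=> Q /= QS; apply: small_dyadicP; exact: S0.
Qed.

(** When the norms on the right are infinite, so is their product with a positive
constant. *)
Lemma Aloc_const_gt0 (rho : \bar R) :
  rho = +oo%E \/ (exists2 s : R, rho = s%:E & 0 < s) ->
  (0 < Aloc_const p q r rt rho w v)%E.
Proof.
pose Q0 : int * 'rV[int]_n := (0, 0).
move=> [->|[s -> s0]].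
  by apply: lt_le_trans (Aloc_term_gt0 Q0) _; exact: Aloc_term_le_sup.
have : (\sum_(Q <- [:: Q0]) term Q `^ s <= Aloc_const p q r rt s%:E w v `^ s)%E.
  by apply: sum_Aloc_term_le => // Q; rewrite inE => /eqP ->.
rewrite big_seq1 => H.
have : (0 < Aloc_const p q r rt s%:E w v `^ s)%E.
  by apply: lt_le_trans H; rewrite poweR_gt0 ?Aloc_term_gt0.
by move/gt0_poweR => -> //; exact: poweR_ge0.
Qed.

Lemma Aloc_const_term_lty (rho : \bar R) Q :
  rho = +oo%E \/ (exists2 s : R, rho = s%:E & 0 < s) -> 0 <= Q.1 ->
  (Aloc_const p q r rt rho w v < +oo)%E -> (term Q < +oo)%E.
Proof.
move=> [->|[s -> s0]] Q0 coo.
  exact: le_lt_trans (Aloc_term_le_sup Q0) coo.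
have : (\sum_(Q <- [:: Q]) term Q `^ s <= Aloc_const p q r rt s%:E w v `^ s)%E.
  by apply: sum_Aloc_term_le => // Q'; rewrite inE => /eqP ->.
rewrite big_seq1 => H.
have : (term Q `^ s < +oo)%E by apply: le_lt_trans H _; exact: poweR_lty.
have : term Q != +oo%E -> (term Q < +oo)%E by case: (term Q) => // x; rewrite ltry.
move=> fin tsoo; apply: fin; apply: contraTneq tsoo => ->.
by rewrite poweRyr ?ltxx// gt_eqF.
Qed.

(** For rho = +oo the coefficients a_S are bounded by the constant and p <= q; for
finite rho its value is the exponent s of discrete Hoelder. *)
Lemma sum_Aloc_product_le (rho : \bar R) S b (B : R) :
  (p <= q /\ rho = +oo%E) \/
  (exists2 s : R, rho = s%:E & 0 < s /\ q^-1 = p^-1 + s^-1) ->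
  (Aloc_const p q r rt rho w v < +oo)%E ->
  uniq S -> {in S, forall Q, 0 <= Q.1} -> 0 < B -> (forall Q, 0 <= b Q) ->
  \sum_(Q <- S) b Q `^ p <= B `^ p ->
  \sum_(Q <- S) (cube_weight_coeff w v p q r rt Q * b Q) `^ q <=
    (fine (Aloc_const p q r rt rho w v) * B) `^ q.
Proof.
move=> rhoP coo uS S0 B0 b0 bB.
have p0 : 0 < p by rewrite (lt_trans ltr01).
have rhoP' : rho = +oo%E \/ (exists2 s : R, rho = s%:E & 0 < s).
  by case: rhoP => [[_ ->]|[s -> [s0 _]]]; [left|right; exists s].
have c0 := Aloc_const_gt0 rhoP'.
have cfin : Aloc_const p q r rt rho w v \is a fin_num by rewrite ge0_fin_numE// ltW.
have A0 : 0 < fine (Aloc_const p q r rt rho w v) by rewrite fine_gt0// c0.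
have a0 Q : 0 <= cube_weight_coeff w v p q r rt Q.
  by apply: weight_coeff_ge0 => Q'; rewrite ltW// dyadic_side_gt0.
have aE Q : Q \in S -> term Q = (cube_weight_coeff w v p q r rt Q)%:E.
  move=> QS; have := Aloc_const_term_lty rhoP' (S0 _ QS) coo.
  by case/(Aloc_term_lty mw mv w0 v0 p1 q0 r1 rt1).
case: rhoP => [[pq rhoE]|[s rhoE [s0 qps]]].
  apply: (sum_product_le_sup A0 B0 q0 p0 a0 b0 bB pq) => Q QS.
  by rewrite -lee_fin fineK// -aE// rhoE; apply: Aloc_term_le_sup; exact: S0.
apply: (sum_product_le_conj A0 B0 q0 p0 a0 b0 bB s0 qps).
rewrite -lee_fin -poweR_EFin fineK// -sumEFin.
rewrite rhoE; apply: le_trans (sum_Aloc_term_le s0 uS S0).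
rewrite le_eqVlt; apply/orP; left; apply/eqP.
by rewrite big_seq [RHS]big_seq; apply: eq_bigr => Q QS; rewrite aE.
Qed.

End Aloc_constant.

(** * Weighted norms *)

Section Lnorm_bounds.
Context d (T : measurableType d) (R : realType) (mu : {measure set T -> \bar R}).

Lemma LnormE (q : R) (h : T -> R) : 'N[mu]_q%:E[EFin \o h]%E =
  ((\int[mu]_x (`|h x| `^ q)%:E) `^ q^-1)%E.
Proof. by rewrite unlock. Qed.

Lemma Lnorm_le_powR (q c : R) (h : T -> R) : 0 < q -> 0 <= c ->
  (\int[mu]_x (`|h x| `^ q)%:E <= (c `^ q)%:E)%E ->
  ('N[mu]_q%:E[EFin \o h] <= c%:E)%E.
Proof.
move=> q0 c0 hc; rewrite LnormE.
have I0 : (0 <= \int[mu]_x (`|h x| `^ q)%:E)%E.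
  by apply: integral_ge0 => x _; rewrite lee_fin powR_ge0.
have -> : c = (c `^ q) `^ q^-1 by rewrite powRVK ?gt_eqF.
by rewrite -poweR_EFin le_poweR// invr_ge0 ltW.
Qed.

(** Minkowski's inequality, raised to the power p. *)
Lemma integral_weighted_sum_le (w u0 u1 : T -> R) (p : R) :
  measurable_fun setT w -> measurable_fun setT u0 -> measurable_fun setT u1 ->
  1 <= p -> (forall x, 0 < w x) -> (forall x, 0 <= u0 x) ->
  (\int[mu]_x ((w x * (u0 x + `|u1 x|)) `^ p)%:E <=
   ('N[mu]_p%:E[EFin \o (fun x => w x * u0 x)%R] +
    'N[mu]_p%:E[EFin \o (fun x => w x * u1 x)%R]) `^ p)%E.
Proof.
move=> mw mu0 mu1 p1 w0 u00.
have m0 : measurable_fun setT (fun x => w x * u0 x) by exact: measurable_funM.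
have m1 : measurable_fun setT (fun x => w x * `|u1 x|).
  apply: measurable_funM => //.
  by apply: measurableT_comp; first exact: normr_measurable.
have p0 : 0 < p by rewrite (lt_le_trans ltr01).
have := minkowski_EFin mu m0 m1 p1.
have -> : 'N[mu]_p%:E[EFin \o (fun x => w x * `|u1 x|)%R]%E =
    'N[mu]_p%:E[EFin \o (fun x => w x * u1 x)%R]%E.
  by rewrite !LnormE; congr (_ `^ _)%E; apply: eq_integral => x _;
    rewrite !normrM normr_id.
rewrite [X in (X <= _)%E -> _]LnormE.
set I := (\int[mu]_x _)%E; set J := (\int[mu]_x _)%E.
have IJ : I = J.
  apply: eq_integral => x _; rewrite /= -mulrDr ger0_norm// mulr_ge0 ?addr_ge0//.
  exact: ltW.
have J0 : (0 <= J)%E by apply: integral_ge0 => x _; rewrite lee_fin powR_ge0.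
rewrite IJ => H.
have -> : J = ((J `^ p^-1) `^ p)%E.
  by rewrite -poweRrM mulVf ?gt_eqF// poweRe1.
by rewrite le_poweR ?poweR_ge0// ltW.
Qed.

End Lnorm_bounds.

(** * Domination by stopping cubes *)

Section stopping_domination.
Context (R : realType) (n : nat).
Local Notation mu := (lebesgue_rV R n).
Local Notation m := (borel_lebesgue_rV R n).
Local Notation side := (@dyadic_side R n).
Variables (f g : 'rV[R]_n -> R) (k : R).
Hypothesis fk : forall x y, `|f x - f y| <= k * `|x - y|.
Hypothesis mg : measurable_fun setT g.
Hypothesis g0 : forall x, 0 <= g x.
Hypothesis gfin : forall Q, (\int[m]_(x in dyadic_cube Q) (g x)%:E \is a fin_num)%E.
Hypothesis Dg : forall x i, `|'D_(delta_mx ord0 i) f x| <= g x.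
Hypothesis fg : forall x, `|f x| <= g x.
Implicit Types Q S : int * 'rV[int]_n.

Lemma integral_lebesgue_cube (h : 'rV[R]_n -> R) Q :
  measurable_fun setT h -> (forall x, 0 <= h x) ->
  (\int[mu]_(x in lebesgue_cube Q) (h x)%:E = \int[m]_(x in dyadic_cube Q) (h x)%:E)%E.
Proof.
move=> mh h0; apply: ge0_integral_lebesgue_rV.
- exact: measurable_dyadic_cube.
- exact/measurable_EFinP.
- by move=> x; rewrite lee_fin.
Qed.

Lemma abs_average_le Q :
  `|fine (\int[m]_(x in dyadic_cube Q) (f x)%:E)| <=
  fine (\int[m]_(x in dyadic_cube Q) (g x)%:E).
Proof.
have mQ := @measurable_dyadic_cube R n Q.
have fint : m.-integrable (dyadic_cube Q) (EFin \o f).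
  exact: lipschitz_integrable_cube fk.
have mf := measurable_lipschitz fk.
have ffin : (\int[m]_(x in dyadic_cube Q) (f x)%:E)%E \is a fin_num.
  exact: integrable_fin_num.
rewrite -lee_fin -abse_EFin !fineK//.
apply: le_trans (le_abse_integral m mQ _) _.
  exact/measurable_EFinP/measurable_funTS.
apply: ge0_le_integral => //.
- apply/measurable_EFinP/measurable_funTS.
  by apply: measurableT_comp; first exact: normr_measurable.
- exact/measurable_EFinP/measurable_funTS.
- by move=> x _; rewrite lee_fin.
Qed.

(** The average of [f] over the root is at most that of [g], which is the term of the
root in the sum over the tree since the root has side 1. *)
Lemma lipschitz_le_stopping_sum (roots : seq (int * 'rV[int]_n)) N Q x :
  Q \in roots -> Q.1 = 0 -> dyadic_cube Q x ->
  `|f x| <= 4 * (poincare_const R n + 1) *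
      stopping_sum mu (@dyadic_child n) (@lebesgue_cube R n) (@cube_volume R n) g roots
        side N.+1 x + `|k| / 2 ^+ N.
Proof.
move=> Qroots Q0 Qx.
have side1 : side Q = 1 by rewrite /dyadic_side Q0 oppr0 expr0z.
pose A S := mass mu (@lebesgue_cube R n) g S / cube_volume R S.
have AE S : fine (\int[m]_(x in dyadic_cube S) (g x)%:E)%E / side S ^+ n = A S.
  by rewrite /A /mass integral_lebesgue_cube.
have A0 S : 0 <= A S by rewrite divr_ge0 ?mass_ge0// ltW// cube_volume_gt0.
pose chi S : R := (x \in @dyadic_cube R n S)%:R.
pose F s := \sum_(S <- s) side S * A S * chi S.
have t0 S : 0 <= side S * A S * chi S.
  apply: mulr_ge0 (ler0n _ _); apply: mulr_ge0 (A0 S).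
  by rewrite ltW// dyadic_side_gt0.
have B := pointwise_tree_bound N.+1 fk gfin mg Dg g0 Qx.
rewrite side1 (eq_bigr (fun S => side S * A S * chi S)) in B; last first.
  by move=> S _; rewrite AE.
have rootF : A Q <= F (tree (@dyadic_child n) N.+1 Q).
  have chiQ : chi Q = 1 by rewrite /chi mem_set.
  rewrite /F /= big_cons side1 mul1r chiQ mulr1 lerDl.
  exact: sumr_ge0.
have avf : `|fine (\int[m]_(x in dyadic_cube Q) (f x)%:E)%E / 1 ^+ n| <= A Q.
  by rewrite -AE side1 expr1n !divr1; exact: abs_average_le.
have stopF : F (tree (@dyadic_child n) N.+1 Q) <=
    4 * F (stopping (@dyadic_child n) A 0 N.+1 Q).
  have G0 S : 0 <= mass mu (@lebesgue_cube R n) g S by exact: mass_ge0.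
  have chi0 S : 0 <= chi S by exact: ler0n.
  have s0 S : 0 <= side S by rewrite ltW// dyadic_side_gt0.
  have := tree_le_stopping (@cube_volume_gt0 R n) G0 N.+1 Q chi0
    (@dyadic_indicator_additive R n x) s0 (@dyadic_side_child R n) (lexx 0).
  by rewrite !mul0r addr0.
have sfE : F (stopping (@dyadic_child n) A 0 N.+1 Q) <=
    stopping_sum mu (@dyadic_child n) (@lebesgue_cube R n) (@cube_volume R n) g
      roots side N.+1 x.
  have -> : stopping_sum mu (@dyadic_child n) (@lebesgue_cube R n) (@cube_volume R n) g
      roots side N.+1 x =
      \sum_(Q' <- roots) F (stopping (@dyadic_child n) A 0 N.+1 Q').
    by rewrite /stopping_sum /stopping_cubes big_flatten big_map.
  rewrite (big_rem Q)//= lerDl; apply: sumr_ge0 => S' _; apply: sumr_ge0 => S _.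
  exact: t0.
set sf := stopping_sum _ _ _ _ _ _ _ _ _ in sfE *.
have P0 := @poincare_const_ge0 R n.
have k2 : `|k| * 1 / 2 ^+ N.+1 <= `|k| / 2 ^+ N.
  rewrite mulr1 ler_wpM2l// lef_pV2 ?posrE ?exprn_gt0//.
  by rewrite ler_eXn2l ?ltr1n.
have F4 : F (tree (@dyadic_child n) N.+1 Q) <= 4 * sf.
  by apply: le_trans stopF _; rewrite ler_wpM2l.
rewrite -/(F _) in B.
have PF : poincare_const R n * F (tree (@dyadic_child n) N.+1 Q) <=
    poincare_const R n * (4 * sf).
  by rewrite ler_wpM2l.
rewrite -[f x](subrK (fine (\int[m]_(x in dyadic_cube Q) (f x)%:E)%E / 1 ^+ n)).
apply: le_trans (ler_normD _ _) _.
apply: le_trans (lerD B avf) _.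
lra.
Qed.

End stopping_domination.

Lemma fin_num_integral_bigsetU d (T : measurableType d) (R : realType)
    (mu : {measure set T -> \bar R}) (I : eqType) (K : I -> set T) (s : seq I)
    (h : T -> R) :
  (forall Q, measurable (K Q)) -> uniq s -> trivIset [set` s] K ->
  measurable_fun setT h -> (forall x, 0 <= h x) ->
  {in s, forall Q, \int[mu]_(x in K Q) (h x)%:E \is a fin_num}%E ->
  (\int[mu]_(x in \big[setU/set0]_(Q <- s) K Q) (h x)%:E \is a fin_num)%E.
Proof.
move=> mK us ts mh h0 hfin.
rewrite (ge0_integral_bigsetU mu mK us ts); last 2 first.
- exact/measurable_EFinP/measurable_funTS.
- by move=> x _; rewrite lee_fin.
rewrite (_ : (\sum_(Q <- s) _)%E =
    (\sum_(Q <- s) fine (\int[mu]_(x in K Q) (h x)%:E)%E)%:E)//.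
by rewrite -sumEFin big_seq [RHS]big_seq; apply: eq_bigr => Q /hfin /fineK.
Qed.

Section test_functions.
Context (R : realType) (n : nat).
Local Notation m := (borel_lebesgue_rV R n).
Implicit Types f : 'rV[R]_n -> R.

Lemma compact_support_bounded f : compact (closure [set x | f x != 0]) ->
  exists M : nat, forall x, f x != 0 -> `|x| < M%:R.
Proof.
move=> /compact_bounded[M0 [_ HM]].
exists (Num.truncn (M0 + 1)).+1 => x fx.
apply: le_lt_trans (truncnS_gt _).
apply: HM; first by rewrite ltrDl.
exact: subset_closure.
Qed.

Variables (f : 'rV[R]_n -> R) (k : R).
Hypothesis fk : forall x y, `|f x - f y| <= k * `|x - y|.

Lemma grad_norm_bounded : exists G : R, forall x, grad_norm f x <= G.
Proof.
exists (Num.sqrt (\sum_(i < n) (`|k| * `|delta_mx ord0 i : 'rV[R]_n| + `|point : R|) ^+ 2)).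
move=> x; apply: ler_wsqrtr; apply: ler_sum => i _.
rewrite -real_normK ?num_real// lerXn2r ?nnegrE ?addr_ge0 ?mulr_ge0//.
exact: derive_lipschitz_bound.
Qed.

Lemma fin_num_grad_norm_cube Q :
  (\int[m]_(x in dyadic_cube Q) (grad_norm f x + `|f x|)%:E \is a fin_num)%E.
Proof.
have mQ := @measurable_dyadic_cube R n Q.
have [G HG] := grad_norm_bounded.
have i1 : m.-integrable (dyadic_cube Q) (EFin \o grad_norm f).
  apply: (@bounded_integrable_cube _ _ _ _ G); first exact: measurable_grad_norm fk.
  by move=> x _; rewrite ger0_norm ?grad_norm_ge0.
have i2 : m.-integrable (dyadic_cube Q) (EFin \o (fun x => `|f x|)).
  apply: (@lipschitz_integrable_cube _ _ _ k) => x y.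
  by apply: le_trans (fk x y); exact: ler_dist_dist.
by have := integrable_fin_num mQ (integrableD mQ i1 i2).
Qed.

End test_functions.

(** * The two-weight inequality *)

Section two_weight_bound.
Context (R : realType) (n : nat).
Local Notation mu := (lebesgue_rV R n).
Local Notation m := (borel_lebesgue_rV R n).
Local Notation T := (lebesgue_rV_type R n).
Local Notation side := (@dyadic_side R n).
Variables (p q r rt : R) (rho : \bar R).
Hypotheses (p1 : 1 < p) (q0 : 0 < q) (r1 : 1 < r) (rt1 : 1 <= rt).
Hypothesis qrt : (1 < q /\ 1 < rt) \/ (q <= 1 /\ rt = 1).
Hypothesis rhoP : (p <= q /\ rho = +oo%E) \/
  (exists2 s : R, rho = s%:E & 0 < s /\ q^-1 = p^-1 + s^-1).
Local Notation maximal_const :=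
  (carleson_const (p / conjugate_exponent (conjugate_exponent p * r))).

(** The factor lost in passing from the coefficients to the integral. *)
Definition weighted_const : R :=
  if q <= 1 then 1
  else carleson_const (conjugate_exponent q / conjugate_exponent (q * rt)) `^ (q - 1).

(** The factor 2 comes from [approximation_limit], the next one from
[lipschitz_le_stopping_sum], and the powers from [weighted_stopping_sum_le] and
[sum_energy_coeff_le]. *)
Definition two_weight_const : R :=
  2 * (4 * (poincare_const R n + 1)) * weighted_const `^ q^-1 * maximal_const `^ p^-1.

Lemma maximal_const_gt0 : 0 < maximal_const.
Proof.
have [p'1 _] := conjugate_exponentP p1.
have p'r1 : 1 < conjugate_exponent p * r.
  by rewrite (lt_trans p'1)// ltr_pMr// (lt_trans ltr01).
have [s1 _] := conjugate_exponentP p'r1.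
apply: carleson_const_gt0; rewrite ltr_pdivlMr ?(lt_trans ltr01 s1)// mul1r.
by rewrite -[ltRHS](conjugate_exponentK p1) conjugate_exponentM_lt.
Qed.

Lemma weighted_const_gt0 : 0 < weighted_const.
Proof.
rewrite /weighted_const; case: qrt => [[q1 rt1']|[-> _]]; last exact: ltr01.
rewrite leNgt q1 /= powR_gt0//; apply: carleson_const_gt0.
have qrt1 : 1 < q * rt by rewrite (lt_trans q1)// ltr_pMr.
have [u1 _] := conjugate_exponentP qrt1.
by rewrite ltr_pdivlMr ?(lt_trans ltr01 u1)// mul1r conjugate_exponentM_lt.
Qed.

Lemma two_weight_const_gt0 : 0 < two_weight_const.
Proof.
have P0 := @poincare_const_ge0 R n.
have k0 : 0 < 2 * (4 * (poincare_const R n + 1)) by lra.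
apply: mulr_gt0; last exact: powR_gt0 maximal_const_gt0.
by apply: mulr_gt0; last exact: powR_gt0 weighted_const_gt0.
Qed.

Variables (w v : 'rV[R]_n -> R).
Hypotheses (mw : measurable_fun (setT : set T) w).
Hypotheses (mv : measurable_fun (setT : set T) v).
Hypotheses (w0 : forall x, 0 < w x) (v0 : forall x, 0 < v x).
Hypothesis coo : (Aloc_const p q r rt rho w v < +oo)%E.
Let A := fine (Aloc_const p q r rt rho w v).

Let rhoP' : rho = +oo%E \/ (exists2 s : R, rho = s%:E & 0 < s).
Proof. by case: rhoP => [[_ ->]|[s -> [s0 _]]]; [left|right; exists s]. Qed.

Let constfin : (A%:E = Aloc_const p q r rt rho w v)%E.
Proof.
have c0 : (0 < Aloc_const p q r rt rho w v)%E := Aloc_const_gt0 p q r rt mw mv w0 v0 rhoP'.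
by rewrite fineK// ge0_fin_numE// ltW.
Qed.

Let A0 : 0 < A.
Proof. by rewrite -lte_fin constfin; exact: Aloc_const_gt0. Qed.

Section fixed_level.
Variable g : 'rV[R]_n -> R.
Hypotheses (mg : measurable_fun setT g) (g0 : forall x, 0 <= g x).
Hypothesis gfin : forall Q, (\int[m]_(x in dyadic_cube Q) (g x)%:E \is a fin_num)%E.
Hypothesis hfin : (\int[mu]_x ((w x * g x) `^ p)%:E \is a fin_num)%E.
Variables (B : R) (M N : nat).
Hypothesis B0 : 0 < B.
Hypothesis hB : (maximal_const%:E * \int[mu]_x ((w x * g x) `^ p)%:E <= (B `^ p)%:E)%E.
Local Notation stopsum := (stopping_sum mu (@dyadic_child n) (@lebesgue_cube R n)
  (@cube_volume R n) g (unit_cubes n M) side N).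

(** All selected cubes are distinct and have side at most 1, so their
terms are among those that define the two-weight constant. *)
Lemma weighted_stopping_sum_le :
  (\int[mu]_x ((v x * stopsum x) `^ q)%:E <= ((A * B) `^ q * weighted_const)%:E)%E.
Proof.
have mgT : measurable_fun (setT : set T) g := borel_measurable_fun mg.
have gfinT Q : (\int[mu]_(x in lebesgue_cube Q) (g x)%:E \is a fin_num)%E.
  by rewrite integral_lebesgue_cube.
set S := stopping_cubes mu (@dyadic_child n) (@lebesgue_cube R n) (@cube_volume R n) g N
  (unit_cubes n M).
have SS : subseq S (flatten [seq tree (@dyadic_child n) N Q | Q <- unit_cubes n M]).
  by apply: subseq_flatten_map => Q; exact: stopping_subseq.
have uS : uniq S.
  apply: subseq_uniq SS _; apply: (@tree_forest_uniq R).
    exact: unit_cubes_uniq.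
  exact: unit_cubes_level.
have S0 : {in S, forall Q, 0 <= Q.1}.
  move=> Q /(mem_subseq SS) /flattenP[_ /mapP[Q0 rQ0 ->]].
  by move=> /(@tree_subset R) [+ _]; rewrite (unit_cubes_level rQ0).
have Sfin Q : Q \in S ->
    (\int[mu]_(x in lebesgue_cube Q)
       (w x `^ (- (conjugate_exponent p * r)))%:E \is a fin_num)%E /\
    (\int[mu]_(x in lebesgue_cube Q) (v x `^ (q * rt))%:E \is a fin_num)%E.
  move=> QS.
  have := Aloc_const_term_lty rhoP' (S0 _ QS) coo.
  by case/(Aloc_term_lty mw mv w0 v0 p1 q0 r1 rt1).
have ur : uniq (unit_cubes n M) := unit_cubes_uniq n M.
have tr : trivIset [set` unit_cubes n M] (@lebesgue_cube R n).
  move=> Q Q' rQ rQ' [x [xQ xQ']].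
  by apply: dyadic_cube_disjoint xQ xQ'; rewrite !(@unit_cubes_level n M).
have side0 Q : 0 <= side Q by rewrite ltW// dyadic_side_gt0.
have wfin Q (QS : Q \in S) := (Sfin Q QS).1.
have vfin Q (QS : Q \in S) := (Sfin Q QS).2.
have bB := sum_energy_coeff_le (@measurable_lebesgue_cube R n) (@lebesgue_cube_bigsetU R n)
  (@lebesgue_cube_trivIset R n) (@cube_volume_gt0 R n) (@lebesgue_cube_volume R n)
  mgT g0 gfinT ur tr N mw w0 p1 r1 hfin B0 hB.
have ab := sum_Aloc_product_le mw mv w0 v0 p1 q0 r1 rt1 rhoP coo uS S0 B0
  (fun Q => energy_coeff_ge0 _ _ _ _ _ _ _ Q) bB.
case: qrt => [[q1 rt1']|[q1 rtE]].
  have := weighted_bound_gt1 (@measurable_lebesgue_cube R n) (@lebesgue_cube_bigsetU R n)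
    (@lebesgue_cube_trivIset R n) (@cube_volume_gt0 R n) (@lebesgue_cube_volume R n)
    mgT g0 gfinT ur tr side0 mw mv w0 v0 p1 q0 r1 rt1 wfin vfin hfin q1 rt1' A0 B0 ab.
  by rewrite /weighted_const [q <= 1]leNgt q1.
have := weighted_bound_le1 (@measurable_lebesgue_cube R n)
  (@cube_volume_gt0 R n) (@lebesgue_cube_volume R n)
  mgT g0 side0 mw mv w0 v0 p1 q0 r1 rt1 wfin vfin hfin q1 rtE ab.
by rewrite /weighted_const q1 mulr1.
Qed.

End fixed_level.

Lemma fin_num_weight_unit_cubes M :
  (\int[mu]_(x in \big[setU/set0]_(Q <- unit_cubes n M) @lebesgue_cube R n Q)
     (v x `^ q)%:E \is a fin_num)%E.
Proof.
apply: fin_num_integral_bigsetU.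
- exact: measurable_lebesgue_cube.
- exact: unit_cubes_uniq.
- move=> Q Q' rQ rQ' [x [xQ xQ']].
  by apply: dyadic_cube_disjoint xQ xQ'; rewrite !(@unit_cubes_level n M).
- exact: measurable_powR_fun.
- by move=> x; exact: powR_ge0.
move=> Q rQ.
have Q0 : 0 <= Q.1 by rewrite (unit_cubes_level rQ).
have [_ vfin _] := Aloc_term_lty mw mv w0 v0 p1 q0 r1 rt1
  (Aloc_const_term_lty rhoP' Q0 coo).
have qrt' : q <= q * rt by rewrite ler_pMr.
exact: (fin_num_integral_powR (@measurable_lebesgue_cube R n) (@lebesgue_cube_volume R n)
  mv (fun x => ltW (v0 x)) q0 qrt' vfin).
Qed.

(** Discrete Hoelder is normalized by a positive bound [B] for the energy, while the
right-hand norm [L] may vanish: hence the argument with L + eps, for every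
eps > 0. *)
Lemma two_weight_inequality f : Lip_c f ->
  (Lnorm_rV q (fun x => v x * f x)%R
   <= two_weight_const%:E * Aloc_const p q r rt rho w v
      * (Lnorm_rV p (fun x => w x * grad_norm f x)%R
         + Lnorm_rV p (fun x => w x * f x)%R))%E.
Proof.
move=> [[k /klipschitzP fk] cf].
have [M fM] := compact_support_bounded cf.
rewrite -constfin; set L := (Lnorm_rV p _ + _)%E.
have C0 := two_weight_const_gt0.
have L0 : (0 <= L)%E by rewrite adde_ge0// Lnorm_ge0.
have [Loo|Lfin] := eqVneq L +oo%E.
  by rewrite Loo -EFinM gt0_muley ?leey// lte_fin mulr_gt0.
have {}Lfin : L \is a fin_num by rewrite ge0_fin_numE// ltey.
pose g x := grad_norm f x + `|f x|.
have mf : measurable_fun setT f := measurable_lipschitz fk.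
have mgrad : measurable_fun setT (grad_norm f) := measurable_grad_norm fk.
have mg : measurable_fun setT g.
  by apply: measurable_funD => //; apply: measurableT_comp; first exact: normr_measurable.
have g0 x : 0 <= g x by rewrite addr_ge0 ?grad_norm_ge0.
have gfin Q := fin_num_grad_norm_cube fk Q.
have Dg x i : `|'D_(delta_mx ord0 i) f x| <= g x.
  by apply: le_trans (coord_le_grad_norm f i x) _; rewrite lerDl.
have fg x : `|f x| <= g x by rewrite lerDr grad_norm_ge0.
have p0 : 0 < p by rewrite (lt_trans ltr01).
have hL : (\int[mu]_x ((w x * g x) `^ p)%:E <= (fine L `^ p)%:E)%E.
  rewrite -poweR_EFin fineK//.
  apply: (integral_weighted_sum_le mu mw (borel_measurable_fun mgrad)
    (borel_measurable_fun mf) (ltW p1) w0).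
  exact: grad_norm_ge0.
have h0 : (0 <= \int[mu]_x ((w x * g x) `^ p)%:E)%E.
  by apply: integral_ge0 => x _; rewrite lee_fin powR_ge0.
have hfin : (\int[mu]_x ((w x * g x) `^ p)%:E \is a fin_num)%E.
  by rewrite ge0_fin_numE//; apply: le_lt_trans hL (ltry _).
have fL0 : 0 <= fine L by exact: fine_ge0.
pose U := \big[setU/set0]_(Q <- unit_cubes n M) @lebesgue_cube R n Q.
have W0 := weighted_const_gt0; have Ct0 := maximal_const_gt0.
have P0 := @poincare_const_ge0 R n.
pose C1 := 4 * (poincare_const R n + 1).
have C10 : 0 <= C1 by rewrite /C1; lra.
pose phi N := stopping_sum mu (@dyadic_child n) (@lebesgue_cube R n)
  (@cube_volume R n) g (unit_cubes n M) side N.+1.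
have dom N x : `|f x| <= C1 * phi N x + `|k| / 2 ^+ N * \1_U x.
  have phi0 : 0 <= phi N x.
    apply: stopping_sum_ge0; [exact: cube_volume_gt0|exact: g0|].
    by move=> Q; rewrite ltW// dyadic_side_gt0.
  have [fx0|fx0] := eqVneq (f x) 0.
    rewrite fx0 normr0; apply: addr_ge0; first exact: mulr_ge0.
    by rewrite indicE; apply: mulr_ge0 (ler0n _ _); rewrite divr_ge0// exprn_ge0.
  have rx := unit_cubes_cover (fM x fx0).
  have xQ := dyadic_cube_index 0 x.
  have xU : U x.
    by rewrite /U -bigcup_seq; exists (dyadic_index 0 x).
  rewrite indicE mem_set// mulr1.
  exact: (lipschitz_le_stopping_sum fk mg g0 gfin Dg fg N rx).
have key eps : 0 < eps ->
    (Lnorm_rV q (fun x => v x * f x)%R <= (two_weight_const * A * (fine L + eps))%:E)%E.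
  move=> eps0.
  have Le0 : 0 < fine L + eps by rewrite ltr_wpDl.
  (* The power B^p absorbs the Carleson constant of [sum_energy_coeff_le]. *)
  pose B := maximal_const `^ p^-1 * (fine L + eps).
  have B0 : 0 < B by apply: mulr_gt0 => //; exact: powR_gt0.
  have hB : (maximal_const%:E * \int[mu]_x ((w x * g x) `^ p)%:E <= (B `^ p)%:E)%E.
    rewrite /B (powRM _ (powR_ge0 _ _) (ltW Le0)) (powRKV (ltW Ct0)) ?gt_eqF//.
    rewrite EFinM lee_wpmul2l ?lee_fin ?(ltW Ct0)//.
    apply: le_trans hL _; rewrite lee_fin.
    by apply: ge0_ler_powR; rewrite ?nnegrE ?(ltW p0) ?(ltW Le0)// lerDl ltW.
  have E : two_weight_const * A * (fine L + eps) =
      2 * C1 * (A * B * weighted_const `^ q^-1).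
    by rewrite /two_weight_const /B /C1; ring.
  have AB0 : 0 <= A * B by rewrite mulr_ge0// ltW.
  have ABW0 : 0 <= A * B * weighted_const `^ q^-1 by rewrite mulr_ge0 ?powR_ge0.
  apply: Lnorm_le_powR => //.
    by rewrite E mulr_ge0// mulr_ge0.
  rewrite E (powRM _ (mulr_ge0 (ler0n _ 2) C10) ABW0).
  rewrite [X in (2 * C1) `^ q * X](powRM _ AB0 (powR_ge0 _ _)).
  rewrite (powRKV (ltW W0)) ?gt_eqF//.
  apply: (@approximation_limit _ T R mu f v phi U q C1 `|k|) => //.
  - by rewrite mulr_ge0 ?powR_ge0// ltW.
  - exact: borel_measurable_fun mf.
  - by move=> N; apply: measurable_stopping_sum; exact: measurable_lebesgue_cube.
  - by apply: bigsetU_measurable => Q _; exact: measurable_lebesgue_cube.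
  - move=> N x; apply: stopping_sum_ge0; [exact: cube_volume_gt0|exact: g0|].
    by move=> Q; rewrite ltW// dyadic_side_gt0.
  - exact: fin_num_weight_unit_cubes.
  - by move=> N; exact: (weighted_stopping_sum_le mg g0 gfin hfin M N.+1 B0 hB).
rewrite -(fineK Lfin) -!EFinM.
apply/lee_addgt0Pr => e e0.
have CA0 : 0 < two_weight_const * A by rewrite mulr_gt0.
apply: le_trans (key (e / (two_weight_const * A)) (divr_gt0 e0 CA0)) _.
rewrite -EFinD lee_fin mulrDr lerD2l mulrC divfK// gt_eqF//.
Qed.

End two_weight_bound.

Section positive_weights.
Context (R : realType) (n : nat).
Local Notation mu := (lebesgue_rV R n).
Local Notation T := (lebesgue_rV_type R n).
Implicit Types w v : 'rV[R]_n -> R.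

Lemma weight_measurable w : weight w -> measurable_fun (setT : set T) w.
Proof. by case=> -[]. Qed.

Lemma weight_ae_gt0 w : weight w -> {ae mu, forall x, 0 < w x}.
Proof.
by case=> _; apply: (@filterS _ _ (ae_filter_ringOfSetsType _)) => x [].
Qed.

Lemma Aloc_const_positive_version w v (p q r rt : R) rho : weight w -> weight v ->
  Aloc_const p q r rt rho w v =
  Aloc_const p q r rt rho (@positive_version _ T R w : 'rV[R]_n -> R)
    (@positive_version _ T R v : 'rV[R]_n -> R).
Proof.
move=> ww wv.
have mc Q := @measurable_lebesgue_cube R n Q.
have E u (e : R) Q : weight u -> dyadic_average Q (fun x => u x `^ e) =
    dyadic_average Q (fun x => (@positive_version _ T R u : 'rV[R]_n -> R) x `^ e).
  move=> wu; rewrite /dyadic_average; congr (_ * _)%E.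
  exact: (integral_positive_version (weight_measurable wu) (weight_ae_gt0 wu) e (mc Q)).
have TE : Aloc_term p q r rt w v = Aloc_term p q r rt
    (@positive_version _ T R w : 'rV[R]_n -> R) (@positive_version _ T R v : 'rV[R]_n -> R).
  by apply/funext => Q; rewrite /Aloc_term (E w _ _ ww) (E v _ _ wv).
by rewrite /Aloc_const TE.
Qed.

End positive_weights.

Theorem corollary7p2 (R : realType) (n : nat) (p q r rt : R) (rho : \bar R)
    (n_gt0 : (0 < n)%N)
    (params :
      [\/ [/\ 1 < p, p <= q, 1 < r, 1 < rt & rho = +oo%E],
          [/\ 1 < q, q < p, 1 < r, 1 < rt
            & exists2 s : R, rho = s%:E & 0 < s /\ q^-1 = p^-1 + s^-1]
        | [/\ 0 < q <= 1, 1 < p, 1 < r, rt = 1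
            & exists2 s : R, rho = s%:E & 0 < s /\ q^-1 = p^-1 + s^-1]]) :
  exists2 C : R, 0 < C &
    forall w v f : 'rV[R]_n -> R,
      Aloc p q r rt rho w v -> Lip_c f ->
      (Lnorm_rV q (fun x => v x * f x)%R
       <= C%:E * Aloc_const p q r rt rho w v
          * (Lnorm_rV p (fun x => w x * grad_norm f x)%R
             + Lnorm_rV p (fun x => w x * f x)%R))%E.
Proof.
have [p1 q0 r1 rt1 [qrt rhoP]] : [/\ 1 < p, 0 < q, 1 < r, 1 <= rt &
    ((1 < q /\ 1 < rt) \/ (q <= 1 /\ rt = 1)) /\
    ((p <= q /\ rho = +oo%E) \/
      (exists2 s : R, rho = s%:E & 0 < s /\ q^-1 = p^-1 + s^-1))].
  case: params => [[p1 pq r1 rt1 rhoE]|[q1 qp r1 rt1 rhoE]|[/andP[q0 q1] p1 r1 -> rhoE]].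
  - have q1 := lt_le_trans p1 pq.
    by split; [..|split; left]; rewrite ?(ltW rt1) ?(lt_trans ltr01 q1).
  - by split; [exact: lt_trans qp|exact: lt_trans q1| |exact: ltW|split; [left|right]].
  - by split; [..|split; right].
exists (two_weight_const n p q r rt).
  exact: two_weight_const_gt0.
move=> w v f [ww wv coo] Lf; have [[k /klipschitzP fk] _] := Lf.
have mf := borel_measurable_fun (measurable_lipschitz fk).
have mgrad := borel_measurable_fun (measurable_grad_norm fk).
have [mw w0] := (weight_measurable ww, weight_ae_gt0 ww).
have [mv v0] := (weight_measurable wv, weight_ae_gt0 wv).
rewrite (Aloc_const_positive_version p q r rt rho ww wv) in coo *.
rewrite /Lnorm_rV (Lnorm_positive_version mw w0 p mgrad)
  (Lnorm_positive_version mw w0 p mf) (Lnorm_positive_version mv v0 q mf).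
exact: (two_weight_inequality p1 q0 r1 rt1 qrt rhoP
  (measurable_positive_version mw) (measurable_positive_version mv)
  (positive_version_gt0 w) (positive_version_gt0 v) coo Lf).
Qed.
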